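(* Let $\gamma\subset\mathbb{R}^2$ be a closed convex $C^1$-curve and let $Q$ be a cyclic quadrilateral. Then $Q$ can be inscribed in $\gamma$, i.e. there is a map $\phi:\mathbb{R}^2\to\mathbb{R}^2$ which is a composition of a non-degenerate scaling, a rotation and a translation such that $\phi$ maps all four vertices of $Q$ to points of $\gamma$.
   Context: A closed convex curve is the boundary of a compact convex subset of the plane with nonempty interior; it is a $C^1$-curve if it is a $C^1$-smooth embedded curve (so it has a tangent line at every point). A quadrilateral is cyclic if it is inscribed in a circle, i.e. its vertices are four distinct points of a circle, taken in their cyclic order along the circle. To inscribe a quadrilateral $Q$ in a Jordan curve is to find a non-degenerate scaling (by a factor $\lambda>0$), rotation, and translation whose composition maps all of the vertices of $Q$ to the curve (reflections are not allowed). *)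

(* Defs.v *)
From HB Require Import structures.
From mathcomp Require Import all_boot all_order all_algebra.
From mathcomp Require Import all_classical all_reals all_analysis.
Import Order.TTheory GRing.Theory Num.Theory.
Import numFieldNormedType.Exports.

Set Implicit Arguments.
Unset Strict Implicit.
Unset Printing Implicit Defensive.

Local Open Scope classical_set_scope.
Local Open Scope ring_scope.

(* The plane is ['rV[R]_2]. The library norm on it is the sup norm, which is   *)
(* only used for its topology and for derivatives; the Euclidean structure     *)
(* enters through circles and rotations, given by [cos] and [sin].             *)

Definition vec2 (R : realType) (x y : R) : 'rV[R]_2 :=
  \row_(i < 2) (if i == 0 then x else y).

Definition boundary (T : topologicalType) (A : set T) : set T :=
  closure A `\` interior A.

Definition closed_convex_curve (R : realType) (g : set 'rV[R]_2) : Prop :=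
  exists K : set 'rV[R]_2,
    [/\ compact K, convex_set K, interior K !=set0 & g = boundary K].

(* [g] is the image of a C^1 embedding of the circle [R / L Z]; the embedding  *)
(* is written as an [L]-periodic map on [R].                                   *)
Definition C1_closed_curve (R : realType) (g : set 'rV[R]_2) : Prop :=
  exists (L : R) (c : R -> 'rV[R]_2),
    [/\ 0 < L /\ periodic c L,
        {in `[0, L[ &, injective c},
        (forall t : R, derivable c t 1) /\ continuous (derive1 c),
        (forall t : R, derive1 c t != 0) &
        g = range c].

Definition circle_point (R : realType) (o : 'rV[R]_2) (r t : R) : 'rV[R]_2 :=
  o + r *: vec2 (cos t) (sin t).

(* The angles increase strictly within less than one turn, so the vertices are *)
(* pairwise distinct and met in the order 0, 1, 2, 3 when going once around    *)
(* the circle counterclockwise.                                                *)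
Definition counterclockwise_on_circle (R : realType) (o : 'rV[R]_2) (r : R)
    (q : 'I_4 -> 'rV[R]_2) : Prop :=
  exists t : 'I_4 -> R,
    [/\ forall i j : 'I_4, (i < j)%N -> t i < t j,
        t ord_max < t ord0 + 2 * pi &
        forall i, q i = circle_point o r (t i)].

(* The vertices may be listed in either direction around the circle.           *)
Definition cyclic_quadrilateral (R : realType) (q : 'I_4 -> 'rV[R]_2) : Prop :=
  exists (o : 'rV[R]_2) (r : R), 0 < r /\
    (counterclockwise_on_circle o r q \/
     counterclockwise_on_circle o r (fun i => q (rev_ord i))).

Definition scaling (R : realType) (l : R) (v : 'rV[R]_2) : 'rV[R]_2 := l *: v.

Definition rotation (R : realType) (t : R) (v : 'rV[R]_2) : 'rV[R]_2 :=
  vec2 (cos t * v 0 0 - sin t * v 0 1) (sin t * v 0 0 + cos t * v 0 1).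

Definition translation (R : realType) (b v : 'rV[R]_2) : 'rV[R]_2 := v + b.

(* Scalings and rotations about other centers, and other orders of             *)
(* composition, give the same maps.                                            *)
Definition direct_similarity (R : realType) (phi : 'rV[R]_2 -> 'rV[R]_2) : Prop :=
  exists (l t : R) (b : 'rV[R]_2),
    0 < l /\ phi = translation b \o rotation t \o scaling l.

(* Main.v *)
Require Import Defs.
From HB Require Import structures.
From mathcomp Require Import all_boot all_order all_algebra.
From mathcomp Require Import all_classical all_reals all_analysis.
From mathcomp Require Import ring lra.
Import Order.TTheory GRing.Theory Num.Theory.
Import numFieldNormedType.Exports.
Local Open Scope classical_set_scope.
Local Open Scope ring_scope.

(* Let the curve first be strictly convex, and let the sides q1 q2 and q4 q3 of
   the quadrilateral, extended, meet at P, with |P q1| = x, |P q2| = r1 x,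
   |P q4| = y, |P q3| = r2 y. That the quadrilateral is cyclic amounts to the
   power of the point P: r1 x^2 = r2 y^2. Among the wedges with the angle of the
   quadrilateral at P whose sides cut the curve in chords ab and dc, minimise

     area (cap ab) / (r1 - 1) + area (cap cd) / (r2 - 1)
       + area (between the vertex of the wedge and the curve).

   Degenerate wedges (a side tangent to the curve, or the vertex on the curve)
   are not minimal. At a minimum, stationarity under translating a side
   says that the distances from the vertex to b and a have ratio r1, and those
   to c and d ratio r2; stationarity under rotating the wedge says that
   r1 |Pa|^2 = r2 |Pd|^2. Hence abcd is directly similar to the quadrilateral.

   A convex curve around the origin is the limit as e -> 0 of its strictly
   convex images under z |-> z / sqrt (1 + e |z|^2), and quadrilaterals with
   parallel sides are limits of others. The inscribed copies do not shrink to
   a point: on a C^1 curve close triples are nearly collinear, uniformly in e,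
   whereas three vertices of the quadrilateral are not. *)

Set Implicit Arguments.
Unset Strict Implicit.
Unset Printing Implicit Defensive.

(** * Real functions of one variable *)

(** Write [x], [y] for the distances from the vertex of the wedge to the points [a], [d], and [l1],
    [l2] for the lengths of the two chords. To first order, shifting the first side by h changes its
    cap by [l1] h and the area at the vertex by - [x] h; with the weight 1/(r1 - 1), stationarity
    reads l1 = (r1 - 1) x, which is where the weights come from. Rotating both sides, about [a] and
    about [d], keeps the angle and gives w1 l1^2 - w2 l2^2 + x^2 - y^2 = 0; once the lengths are
    substituted this is exactly r1 x^2 = r2 y^2. The obstacle is that these derivatives are
    available only where the sides cut the curve transversally: at a tangency the ends of the chord
    need not depend differentiably on the shift. Degenerate wedges therefore stay in the domain, for
    compactness. Tangent sides are excluded by a direct comparison of areas, a vertex on the curve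
    by a shift in the one direction that is still allowed. The limit is taken without sequences: a
    continuous defect whose infimum is zero is minimised over a compact set. *)

Lemma is_derive_add (R : realType) (f g : R -> R) (x a b : R) :
  is_derive x 1 f a -> is_derive x 1 g b ->
  is_derive x 1 (fun t => f t + g t) (a + b).
Proof. by move=> df dg; exact: is_deriveD. Qed.

Lemma is_derive_sub (R : realType) (f g : R -> R) (x a b : R) :
  is_derive x 1 f a -> is_derive x 1 g b ->
  is_derive x 1 (fun t => f t - g t) (a - b).
Proof. by move=> df dg; exact: is_deriveB. Qed.

Lemma is_derive_opp (R : realType) (f : R -> R) (x a : R) :
  is_derive x 1 f a -> is_derive x 1 (fun t => - f t) (- a).
Proof. by move=> df; exact: is_deriveN. Qed.

Lemma is_derive_mul (R : realType) (f g : R -> R) (x a b : R) :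
  is_derive x 1 f a -> is_derive x 1 g b ->
  is_derive x 1 (fun t => f t * g t) (a * g x + f x * b).
Proof.
move=> df dg; apply: (@is_derive_eq _ _ _ _ _ _ _ _ (is_deriveM df dg)).
by rewrite addrC /GRing.scale /= mulrC.
Qed.

Lemma is_derive_const (R : realType) (k x : R) : is_derive x 1 (fun=> k) 0.
Proof. exact: is_derive_cst. Qed.

Lemma is_derive_var (R : realType) (x : R) : is_derive x 1 (fun t => t) 1.
Proof. exact: is_derive_id. Qed.

Lemma is_derive_inv (R : realType) (f : R -> R) (x a : R) :
  is_derive x 1 f a -> f x != 0 ->
  is_derive x 1 (fun t => (f t)^-1) (- a / f x ^+ 2).
Proof.
move=> df f0; apply: (@is_derive_eq _ _ _ _ _ _ _ _ (is_deriveV f0 df)).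
by rewrite /GRing.scale /= mulrC mulrN mulNr.
Qed.

Lemma is_derive_composite (R : realType) (f g : R -> R) (x a b : R) :
  is_derive (g x) 1 f a -> is_derive x 1 g b ->
  is_derive x 1 (fun t => f (g t)) (a * b).
Proof. by move=> df dg; exact: is_derive1_comp. Qed.

Lemma is_derive_continuous (R : realType) (f : R -> R) (x a : R) :
  is_derive x 1 f a -> {for x, continuous f}.
Proof.
by move=> [df _]; exact/differentiable_continuous/derivable1_diffP.
Qed.

Lemma continuous_ball (R : realType) (f : R -> R) (x e : R) :
  {for x, continuous f} -> 0 < e ->
  exists2 d, 0 < d & forall y, `|y - x| < d -> `|f y - f x| < e.
Proof.
move=> /cvgrPdist_lt/(_ e) + e0 => /(_ e0) /nbhs_ballP[d /= d0 h].
by exists d => // y yx; rewrite distrC; apply: h; rewrite /ball /= distrC.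
Qed.

Lemma near_ball (R : realType) (x : R) (P : R -> Prop) :
  (\forall y \near x, P y) ->
  exists2 d, 0 < d & forall y, `|y - x| < d -> P y.
Proof.
move=> /nbhs_ballP[d /= d0 h].
by exists d => // y yx; apply: h; rewrite /ball /= distrC.
Qed.

Lemma ball_near (R : realType) (x d : R) (P : R -> Prop) :
  0 < d -> (forall y, `|y - x| < d -> P y) -> \forall y \near x, P y.
Proof.
move=> d0 h; apply/nbhs_ballP; exists d => //= y xy.
by apply: h; rewrite distrC.
Qed.

Lemma is_derive_linear_approx (R : realType) (f : R -> R) (x a e : R) :
  is_derive x 1 f a -> 0 < e ->
  exists2 d, 0 < d & forall y, `|y - x| < d ->
    `|f y - f x - a * (y - x)| <= e * `|y - x|.
Proof.
move=> /is_derive1_caratheodory[g [fE gc ga]] e0.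
have [d d0 h] := continuous_ball gc e0.
exists d => // y yx; rewrite fE -ga -mulrBl normrM ler_wpM2r //.
exact: ltW (h _ yx).
Qed.

Lemma linear_approx_is_derive (R : realType) (f : R -> R) (x a : R) :
  (forall e, 0 < e -> exists2 d, 0 < d & forall y, `|y - x| < d ->
    `|f y - f x - a * (y - x)| <= e * `|y - x|) ->
  is_derive x 1 f a.
Proof.
move=> h; apply/is_derive1_caratheodory.
exists (fun z => if z == x then a else (f z - f x) / (z - x)).
split; last by rewrite eqxx.
  move=> z; case: eqP => [->|/eqP zx]; first by rewrite !subrr mulr0.
  by rewrite divfK // subr_eq0.
apply/cvgrPdist_le => e e0; have [d d0 H] := h _ e0.
apply: (ball_near d0) => y yx; rewrite eqxx.
case: eqP => [_|/eqP yNx]; first by rewrite subrr normr0 ltW.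
have yx0 : 0 < `|y - x| by rewrite normr_gt0 subr_eq0.
rewrite distrC -(ler_pM2r yx0) -normrM mulrBl divfK ?subr_eq0 //.
exact: H.
Qed.

Lemma continuous_seg (R : realType) (f : R -> R) (a b : R) :
  continuous f -> {within `[a, b], continuous f}.
Proof. by move=> cf; exact: continuous_subspaceT. Qed.

Lemma is_derive_fun_continuous (R : realType) (f f' : R -> R) :
  (forall x : R, is_derive x 1 f (f' x)) -> continuous f.
Proof. by move=> df x; exact: is_derive_continuous (df x). Qed.

Lemma mean_value (R : realType) (f f' : R -> R) (a b : R) :
  (forall x : R, is_derive x 1 f (f' x)) -> a < b ->
  exists2 c, a < c < b & f b - f a = f' c * (b - a).
Proof.
move=> df ab; have cf := is_derive_fun_continuous df.
have [c] := MVT ab (fun x _ => df x) (@continuous_seg _ _ a b cf).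
by rewrite in_itv; exists c.
Qed.

Lemma nondecreasing_of_derive (R : realType) (f f' : R -> R) (a b : R) :
  (forall x : R, is_derive x 1 f (f' x)) -> a <= b ->
  (forall x, a < x < b -> 0 <= f' x) -> f a <= f b.
Proof.
move=> df; rewrite le_eqVlt => /predU1P[->//|ab] f0.
have [c cab E] := mean_value df ab.
by rewrite -subr_ge0 E mulr_ge0 ?f0 // subr_ge0 ltW.
Qed.

Lemma derive_pos_right (R : realType) (f : R -> R) (x a : R) :
  is_derive x 1 f a -> 0 < a ->
  exists2 d, 0 < d & forall y, `|y - x| < d ->
    (x < y -> f x < f y) /\ (y < x -> f y < f x).
Proof.
move=> df a0; have a2 : 0 < a / 2 by rewrite divr_gt0.
have [d d0 h] := is_derive_linear_approx df a2.
exists d => // y /h H; split => xy; move: (xy); rewrite -subr_gt0 => yx.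
  have p : 0 < a * (y - x) by rewrite mulr_gt0.
  by move: H; rewrite ler_norml (gtr0_norm yx) => /andP[H1 H2]; lra.
have p : 0 < a * (x - y) by rewrite mulr_gt0.
by move: H; rewrite ler_norml (distrC y x) (gtr0_norm yx) => /andP[H1 H2]; lra.
Qed.

Lemma intermediate_value_seg (R : realType) (f : R -> R) (a b v : R) :
  (forall t, a <= t <= b -> {for t, continuous f}) -> a <= b ->
  (f a <= v <= f b) \/ (f b <= v <= f a) ->
  exists2 c, a <= c <= b & f c = v.
Proof.
move=> cf ab h; have [|| c] := @IVT R f a b v ab.
- apply: continuous_in_subspaceT => t; rewrite inE /= in_itv /=; exact: cf.
- rewrite ge_min le_max.
  by case: h => /andP[-> ->]; rewrite ?orbT.
- by rewrite in_itv; exists c.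
Qed.

Lemma intermediate_value (R : realType) (f : R -> R) (a b v : R) :
  continuous f -> a <= b -> (f a <= v <= f b) \/ (f b <= v <= f a) ->
  exists2 c, a <= c <= b & f c = v.
Proof. by move=> cf; apply: intermediate_value_seg => t _; exact: cf. Qed.

(** [k] need not be injective near [a], so there is no genuine inverse. The intermediate value
    theorem supplies some solution within [d] of [a] for each small value, one is chosen, and
    differentiability of [k] at [a] makes any such choice differentiable at 0. *)
Lemma local_inverse (R : realType) (k : R -> R) (a k' : R) :
  (\forall t \near a, {for t, continuous k}) -> is_derive a 1 k k' -> k' != 0 -> k a = 0 ->
  exists f : R -> R, [/\ f 0 = a, is_derive (0 : R) 1 f k'^-1 &
    \forall h \near (0 : R), k (f h) = h].
Proof.
move=> /near_ball[dc dc0 ck] dk k'0 ka.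
have n0 : 0 < `|k'| by rewrite normr_gt0.
have [d' d'0 H'] := is_derive_linear_approx dk (divr_gt0 n0 (ltr0Sn R 1)).
pose d := Num.min dc d'.
have d0 : 0 < d by rewrite lt_min dc0.
have H y : `|y - a| < d -> `|k y - k a - k' * (y - a)| <= `|k'| / 2 * `|y - a|.
  by rewrite lt_min => /andP[_]; exact: H'.
have {}ck y : `|y - a| < d -> {for y, continuous k}.
  by rewrite lt_min => /andP[+ _]; exact: ck.
pose P h t := `|t - a| < d /\ k t = h.
(* With [r = d / 2], the values of [k] at [a + r] and [a - r] differ from [k' * r] and [- k' * r] by
   at most half of [|k'| * r], so they bracket every [h] of size below [|k'| * d / 4]. *)
have ex h : `|h| < `|k'| * (d / 4) -> exists t, P h t.
  move=> hd; pose r := d / 2.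
  have r0 : 0 < r by rewrite divr_gt0.
  have rd : r < d by rewrite /r; lra.
  have Hr : `|k (a + r) - k' * r| <= `|k'| / 2 * r.
    have := H (a + r); rewrite addrAC subrr add0r ka subr0 (gtr0_norm r0).
    exact.
  have Hl : `|k (a - r) + k' * r| <= `|k'| / 2 * r.
    have := H (a - r); rewrite addrAC subrr add0r ka subr0 normrN (gtr0_norm r0).
    by rewrite mulrN opprK; exact.
  have := hd; rewrite (_ : `|k'| * (d / 4) = `|k'| / 2 * r); last first.
    by rewrite /r; field.
  move=> hd'.
  have [|||t /andP[t1 t2] kt] := @intermediate_value_seg _ k (a - r) (a + r) h.
  - move=> t /andP[t1 t2]; apply: ck; rewrite ltr_norml.
    by apply/andP; split; lra.
  - lra.
  - move: k'0; rewrite neq_lt => /orP[k0|k0].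
      move: Hr Hl hd'; rewrite (ltr0_norm k0) !ler_norml ltr_norml.
      by right; apply/andP; split; lra.
    move: Hr Hl hd'; rewrite (gtr0_norm k0) !ler_norml ltr_norml.
    by left; apply/andP; split; lra.
  - exists t; split => //; rewrite ltr_norml; apply/andP; split; lra.
have e0 : 0 < `|k'| * (d / 4) by rewrite mulr_gt0 // divr_gt0.
pose f h := if `|h| < `|k'| * (d / 4) then xget a (P h) else a.
have fP h : `|h| < `|k'| * (d / 4) -> P h (f h).
  by move=> hd; rewrite /f hd; apply: xgetPex; exact: ex.
have fb h : `|h| < `|k'| * (d / 4) -> `|f h - a| <= 2 / `|k'| * `|h|.
  move=> hd; have [h1 h2] := fP _ hd; have := H _ h1; rewrite h2 ka subr0.
  move=> H3; have : `|k' * (f h - a)| <= `|h| + `|k'| / 2 * `|f h - a|.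
    rewrite -[k' * _](subKr h); apply: le_trans (ler_normB _ _) _.
    by rewrite lerD2l.
  rewrite normrM => H4.
  have {}H4 : `|f h - a| * `|k'| <= 2 * `|h| by lra.
  by rewrite mulrAC ler_pdivlMr.
have f0 : f 0 = a.
  have := fb 0; rewrite normr0 mulr0 normr_le0 subr_eq0 => /(_ e0) /eqP.
  by [].
exists f; split => //; last first.
  by apply: (ball_near e0) => y; rewrite subr0 => /fP[].
apply: linear_approx_is_derive => e epos.
(* By [fb], [f y - a] is at most [2 / |k'| * |y|] in size, so this tolerance turns into
   [e * |k'| * |y|]; dividing by [|k'|] leaves [e * |y|]. *)
have e1 : 0 < e * `|k'| * (`|k'| / 2) by rewrite !mulr_gt0 // divr_gt0.
have [d1 d10 H1] := is_derive_linear_approx dk e1.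
pose d2 := Num.min (`|k'| * (d / 4)) (`|k'| / 2 * d1).
exists d2; first by rewrite lt_min e0 mulr_gt0 // divr_gt0.
move=> y; rewrite subr0 lt_min f0 => /andP[y1 y2].
have fy := fb _ y1; have [_ ky] := fP _ y1.
have fd1 : `|f y - a| < d1.
  apply: le_lt_trans fy _; rewrite mulrAC ltr_pdivrMr //.
  by move: y2; lra.
have := H1 _ fd1; rewrite ky ka subr0 => H2.
have {}H2 : `|k'| * `|f y - a - k'^-1 * y| <= e * `|k'| * `|y|.
  rewrite -normrM mulrBr mulrA divff // mul1r -normrN opprB.
  apply: le_trans H2 _.
  have : e * `|k'| * (`|k'| / 2) * `|f y - a| <=
    e * `|k'| * (`|k'| / 2) * (2 / `|k'| * `|y|) by rewrite ler_pM2l.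
  move/le_trans; apply; rewrite le_eqVlt; apply/orP; left; apply/eqP.
  by field; rewrite normr_eq0.
by rewrite -(ler_pM2l n0) mulrA (mulrC _ e).
Qed.

Lemma primitive_exists (R : realType) (f : R -> R) :
  continuous f -> exists F : R -> R, forall x : R, is_derive x 1 F (f x).
Proof.
move=> cf.
pose I (a b : R) : R := (\int[@lebesgue_measure R]_(t in `]a, b]) f t)%R.
have int (a b : R) : (@lebesgue_measure R).-integrable `[a, b] (EFin \o f).
  apply: continuous_compact_integrable; first exact: segment_compact.
  exact: continuous_subspaceT.
have chasles (a b c : R) : a <= b -> b <= c -> I a b + I b c = I a c.
  move=> ab bc; rewrite /I -(@Rintegral_itvB _ f (BRight a) (BRight c) b) //.
  - by rewrite addrC subrK.
  - by apply: (integrableS _ _ _ (int a c)) => //; exact: subset_itv_oc_cc.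
(* At most one of the two integrals is over a nonempty interval, so this is the oriented integral
   from 0 to [x] for either sign of [x]. *)
pose F x := I 0 x - I x 0.
exists F => x.
pose a := Num.min x 0 - 1.
have ax : a < x by rewrite /a ltrBlDr gt_min ltrDl ltr01.
have a0 : a < 0 by rewrite /a subr_lt0 gt_min ltr01 orbT.
have Fa y : a < y -> F y = I a y - I a 0.
  move=> ay; rewrite /F.
  have nul (u v : R) : v <= u -> I u v = 0.
    by move=> vu; rewrite /I set_itv_ge ?Rintegral_set0 // bnd_simp -leNgt.
  have [y0|y0] := leP 0 y.
    by rewrite (nul _ _ y0) subr0 -(chasles a 0 y) // ?ltW // addrAC subrr add0r.
  by rewrite (nul _ _ (ltW y0)) sub0r -(chasles a y 0) ?ltW // opprD addrA subrr add0r.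
have [dI I'] : derivable (I a) x 1 /\ (I a)^`()%classic x = f x.
  have xx1 : x < x + 1 by rewrite ltrDl.
  apply: (@continuous_FTC1 _ f (BRight a) x (x + 1)) => //.
  - by apply: (integrableS _ _ _ (int a (x + 1))) => //; exact: subset_itv_oc_cc.
  - exact: cf.
have dIx : is_derive x 1 (I a) (f x).
  by rewrite -I' derive1E; exact: derivableP.
have dG := is_derive_sub dIx (is_derive_const (I a 0) x).
rewrite subr0 in dG; apply: near_eq_is_derive dG.
have xa : 0 < x - a by rewrite subr_gt0.
apply: (ball_near xa) => y; rewrite ltr_norml => /andP[ya _].
by rewrite Fa //; move: ya; lra.
Qed.

(** * Strictly convex curves *)

Ltac derive_rules base :=
  eapply is_derive_eq;
  [repeat first [apply is_derive_const | apply is_derive_var | base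
    | eapply is_derive_add | eapply is_derive_sub | eapply is_derive_opp
    | eapply is_derive_mul] | cbv beta].

Definition cross (R : realType) (x1 y1 x2 y2 : R) : R := x1 * y2 - y1 * x2.

(** [sc_turn] puts every other point strictly to the left of the tangent at [t]. It encodes strict
    convexity and counterclockwise orientation at once, and it also yields injectivity on a period
    and nonzero speed. *)
Record strict_curve (R : realType) (X Y X' Y' : R -> R) (L : R) : Prop := {
  sc_period : 0 < L;
  sc_dX : forall t : R, is_derive t 1 X (X' t);
  sc_dY : forall t : R, is_derive t 1 Y (Y' t);
  sc_cX' : continuous X';
  sc_cY' : continuous Y';
  sc_pX : forall t, X (t + L) = X t;
  sc_pY : forall t, Y (t + L) = Y t;
  sc_pX' : forall t, X' (t + L) = X' t;
  sc_pY' : forall t, Y' (t + L) = Y' t;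
  sc_turn : forall t s, t < s < t + L ->
    0 < cross (X' t) (Y' t) (X s - X t) (Y s - Y t) }.

Lemma cross_collinear (R : realType) (x y p q : R) :
  cross x y p q = 0 -> p ^+ 2 + q ^+ 2 = 1 ->
  x = (x * p + y * q) * p /\ y = (x * p + y * q) * q.
Proof.
rewrite /cross => c0 n.
have p2 : p ^+ 2 = 1 - q ^+ 2 by rewrite -n addrK.
have q2 : q ^+ 2 = 1 - p ^+ 2 by rewrite -n addrAC subrr add0r.
split.
  have -> : (x * p + y * q) * p = x * p ^+ 2 + y * p * q by ring.
  have -> : y * p = x * q by move: c0; lra.
  by rewrite p2; ring.
have -> : (x * p + y * q) * q = x * q * p + y * q ^+ 2 by ring.
have -> : x * q = y * p by move: c0; lra.
by rewrite q2; ring.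
Qed.

Section StrictCurve.
Context (R : realType) (X Y X' Y' : R -> R) (L : R).
Hypothesis sc : strict_curve X Y X' Y' L.

Let L0 : 0 < L. Proof. exact: sc_period sc. Qed.
Let dX := sc_dX sc.
Let dY := sc_dY sc.
Let cX : continuous X. Proof. exact: is_derive_fun_continuous dX. Qed.
Let cY : continuous Y. Proof. exact: is_derive_fun_continuous dY. Qed.
Let pX := sc_pX sc.
Let pY := sc_pY sc.

(** For a unit vector [(p, q)], the signed distance of the point [t] from the line through the point
    [a] in direction [(p, q)], positive on the right of that direction. *)
Definition rcross (a t p q : R) := cross (X t - X a) (Y t - Y a) p q.

Lemma sc_turn_left t s : t - L < s < t ->
  0 < cross (X' t) (Y' t) (X s - X t) (Y s - Y t).
Proof.
move=> /andP[h1 h2]; rewrite -(pX s) -(pY s); apply: (sc_turn sc).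
by apply/andP; split; lra.
Qed.

Lemma sc_speed_neq0 t : 0 < X' t ^+ 2 + Y' t ^+ 2.
Proof.
have h : t < t + L / 2 < t + L by apply/andP; split; move: L0; lra.
rewrite lt_neqAle addr_ge0 ?sqr_ge0 // andbT eq_sym paddr_eq0 ?sqr_ge0 //.
rewrite !sqrf_eq0; apply/negP => /andP[/eqP x0 /eqP y0].
by have := sc_turn sc h; rewrite x0 y0 /cross !mul0r subr0 ltxx.
Qed.

Lemma is_derive_rcross a (t : R) p q :
  is_derive t 1 (fun s => rcross a s p q) (cross (X' t) (Y' t) p q).
Proof.
rewrite /rcross /cross; derive_rules ltac:(first [apply: dX | apply: dY]).
by ring.
Qed.

Lemma continuous_rcross a p q : continuous (fun s => rcross a s p q).
Proof. by move=> t; exact: is_derive_continuous (is_derive_rcross a t p q). Qed.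

Lemma rcrossL a t p q : rcross a (t + L) p q = rcross a t p q.
Proof. by rewrite /rcross pX pY. Qed.

(** On a common line, the tangents at [a] and [b] would force the point [t] strictly between the
    other two, and then the tangent at [t] could not have both of them strictly on its left. *)
Lemma not_collinear a t b : a < t < b -> b < a + L ->
  rcross a t (X b - X a) (Y b - Y a) != 0.
Proof.
move=> /andP[at_ tb] ba; apply/eqP => c0.
have Ta : 0 < cross (X' a) (Y' a) (X b - X a) (Y b - Y a).
  by apply: (sc_turn sc); apply/andP; split; lra.
have Ta2 : 0 < cross (X' a) (Y' a) (X t - X a) (Y t - Y a).
  by apply: (sc_turn sc); apply/andP; split; lra.
have Tb : 0 < cross (X' b) (Y' b) (X a - X b) (Y a - Y b).
  by apply: sc_turn_left; apply/andP; split; lra.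
have Tb2 : 0 < cross (X' b) (Y' b) (X t - X b) (Y t - Y b).
  by apply: sc_turn_left; apply/andP; split; lra.
have Tt : 0 < cross (X' t) (Y' t) (X a - X t) (Y a - Y t).
  by apply: sc_turn_left; apply/andP; split; lra.
have Tt2 : 0 < cross (X' t) (Y' t) (X b - X t) (Y b - Y t).
  by apply: (sc_turn sc); apply/andP; split; lra.
pose n := (X b - X a) ^+ 2 + (Y b - Y a) ^+ 2.
have n0 : n != 0.
  apply/eqP => /eqP; rewrite /n paddr_eq0 ?sqr_ge0 // !sqrf_eq0.
  by move=> /andP[/eqP e1 /eqP e2]; move: Ta; rewrite e1 e2 /cross !mulr0 subr0 ltxx.
pose l := ((X t - X a) * (X b - X a) + (Y t - Y a) * (Y b - Y a)) / n.
have E1 : X t - X a = l * (X b - X a).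
  apply: (mulIf n0); rewrite mulrAC divfK //.
  apply/eqP; rewrite -subr_eq0; apply/eqP.
  transitivity ((Y b - Y a) * rcross a t (X b - X a) (Y b - Y a)).
    by rewrite /rcross /cross /n; ring.
  by rewrite c0 mulr0.
have E2 : Y t - Y a = l * (Y b - Y a).
  apply: (mulIf n0); rewrite mulrAC divfK //.
  apply/eqP; rewrite -subr_eq0; apply/eqP.
  transitivity (- (X b - X a) * rcross a t (X b - X a) (Y b - Y a)).
    by rewrite /rcross /cross /n; ring.
  by rewrite c0 mulr0.
have l0 : 0 < l.
  by move: Ta2; rewrite /cross E1 E2 mulrCA (mulrCA _ l) -mulrBr pmulr_lgt0.
have l1 : l < 1.
  have F1 : X t - X b = (1 - l) * (X a - X b) by move: E1; lra.
  have F2 : Y t - Y b = (1 - l) * (Y a - Y b) by move: E2; lra.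
  move: Tb2; rewrite /cross F1 F2 mulrCA (mulrCA _ (1 - l)) -mulrBr pmulr_lgt0 //.
  by rewrite subr_gt0.
have F1 : X a - X t = l * (X a - X b) by move: E1; lra.
have F2 : Y a - Y t = l * (Y a - Y b) by move: E2; lra.
have G1 : X b - X t = (1 - l) * (X b - X a) by move: E1; lra.
have G2 : Y b - Y t = (1 - l) * (Y b - Y a) by move: E2; lra.
move: Tt; rewrite /cross F1 F2 mulrCA (mulrCA _ l) -mulrBr pmulr_rgt0 // => Tt.
move: Tt2; rewrite /cross G1 G2 mulrCA (mulrCA _ (1 - l)) -mulrBr pmulr_rgt0 ?subr_gt0 //.
by move: Tt; lra.
Qed.

(** Just after [a] the sign is given by the derivative at [a], and [not_collinear] rules out a
    change of sign before [b]. *)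
Lemma orientation a t b : a < t < b -> b < a + L ->
  0 < rcross a t (X b - X a) (Y b - Y a).
Proof.
move=> /andP[at_ tb] ba.
set f := fun s => rcross a s (X b - X a) (Y b - Y a).
rewrite -/(f t) ltNge; apply/negP => ft.
have Ta : 0 < cross (X' a) (Y' a) (X b - X a) (Y b - Y a).
  by apply: (sc_turn sc); apply/andP; split; lra.
have [d d0 H] := derive_pos_right (is_derive_rcross a a _ _) Ta.
pose s := a + Num.min (d / 2) ((t - a) / 2).
have sa : a < s by rewrite /s ltrDl lt_min !divr_gt0 // subr_gt0.
have st : s < t.
  have : Num.min (d / 2) ((t - a) / 2) <= (t - a) / 2 by rewrite ge_min lexx orbT.
  by rewrite /s; lra.
have sd : `|s - a| < d.
  rewrite /s addrAC subrr add0r gtr0_norm ?lt_min ?divr_gt0 ?subr_gt0 //.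
  by rewrite gt_min; apply/orP; left; lra.
have fs : 0 < f s.
  have [/(_ sa) + _] := H s sd.
  by rewrite {1}/rcross !subrr /cross !mul0r subr0.
have cf : continuous f by exact: continuous_rcross.
have [||r /andP[r1 r2] fr] := @intermediate_value _ f s t 0 cf.
- exact: ltW.
- by right; rewrite ft ltW.
have rab : a < r < b by apply/andP; split; lra.
by have := not_collinear rab ba; rewrite -/(f r) fr eqxx.
Qed.

(* The line through the points [a] and [b] has direction [(p, q)], pointing from
   [b] to [a]; for [a = b] it is the tangent. *)
Definition chord_line (a b p q : R) :=
  (forall t, a <= t <= b -> rcross a t p q <= 0) /\
  (forall t, b <= t <= a + L -> 0 <= rcross a t p q).

Lemma chord_lineP a b p q l : a < b < a + L -> 0 < l ->
  X a - X b = l * p -> Y a - Y b = l * q -> chord_line a b p q.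
Proof.
move=> /andP[ab ba] l0 Ep Eq.
have E t : l * rcross a t p q = - rcross a t (X b - X a) (Y b - Y a).
  rewrite -(opprB (X a)) -(opprB (Y a)) Ep Eq /rcross /cross; ring.
have Z t : X t = X a -> Y t = Y a -> rcross a t p q = 0.
  by rewrite /rcross => -> ->; rewrite !subrr /cross !mul0r subr0.
have Zb : rcross a b p q = 0.
  by apply: (mulfI (lt0r_neq0 l0)); rewrite E mulr0 /rcross /cross; ring.
split=> t /andP[].
  rewrite le_eqVlt => /predU1P[<- _|at_]; first by rewrite Z.
  rewrite le_eqVlt => /predU1P[->|tb]; first by rewrite Zb.
  rewrite -(pmulr_rle0 _ l0) E oppr_le0 ltW // orientation //.
  by rewrite at_ tb.
rewrite le_eqVlt => /predU1P[<- _|bt]; first by rewrite Zb.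
rewrite le_eqVlt => /predU1P[->|ta]; first by rewrite Z.
have abt : a < b < t by rewrite ab bt.
have := orientation abt ta.
have -> : rcross a b (X t - X a) (Y t - Y a) = l * rcross a t p q.
  by rewrite E /rcross /cross; ring.
by rewrite pmulr_rgt0 // => /ltW.
Qed.

(** The point [b] is subject to both sign conditions, hence lies on the line; the middle of the arc
    from [a] to [b] decides the sign of the factor. *)
Lemma chord_line_proper a b p q : a < b < a + L -> p ^+ 2 + q ^+ 2 = 1 ->
  chord_line a b p q ->
  exists2 l, 0 < l & X a - X b = l * p /\ Y a - Y b = l * q.
Proof.
move=> /andP[ab ba] n [h1 h2].
have c0 : cross (X b - X a) (Y b - Y a) p q = 0.
  apply/eqP; rewrite eq_le; apply/andP; split.
    by apply: h1; rewrite lexx ltW.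
  by apply: h2; rewrite lexx ltW.
have [E1 E2] := cross_collinear c0 n.
set m := _ * p + _ * q in E1 E2.
exists (- m); last by rewrite !mulNr -E1 -E2 !opprB.
pose t := (a + b) / 2.
have tab : a < t < b by apply/andP; rewrite /t; split; lra.
have := orientation tab ba.
have -> : rcross a t (X b - X a) (Y b - Y a) = m * rcross a t p q.
  by rewrite E1 E2 /rcross /cross; ring.
have ht : rcross a t p q <= 0 by apply: h1; case/andP: tab => /ltW-> /ltW->.
rewrite oppr_gt0 ltNge => H; rewrite ltNge; apply/negP => m0; move/negP: H; apply.
exact: mulr_ge0_le0.
Qed.

(** By periodicity the offset from the line is minimal at [a] on both sides, so its derivative
    vanishes and the line is tangent. The point [a + L / 2] shows that the direction is opposite to
    the motion. *)
Lemma tangent_of_sign a p q : p ^+ 2 + q ^+ 2 = 1 ->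
  (forall t, a <= t <= a + L -> 0 <= rcross a t p q) ->
  exists2 l, 0 < l & p = - l * X' a /\ q = - l * Y' a.
Proof.
move=> n h.
have ra : rcross a a p q = 0 by rewrite /rcross !subrr /cross !mul0r subr0.
have c0 : cross (X' a) (Y' a) p q = 0.
  apply/eqP/negPn/negP; rewrite neq_lt => /orP[c0|c0].
    have c1 : 0 < - cross (X' a) (Y' a) p q by rewrite oppr_gt0.
    have [d d0 H] := derive_pos_right (is_derive_opp (is_derive_rcross a a _ _)) c1.
    pose s := a + Num.min (d / 2) (L / 2).
    have m0 : 0 < Num.min (d / 2) (L / 2) by rewrite lt_min !divr_gt0.
    have sd : `|s - a| < d.
      rewrite /s addrAC subrr add0r gtr0_norm // gt_min; apply/orP; left; lra.
    have [] := H s sd.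
    rewrite ra ltrDl m0 oppr0 => /(_ isT); rewrite oppr_gt0 ltNge => /negP HH _.
    apply: HH; apply: h; rewrite lerDl ltW //= lerD2l ge_min; apply/orP; right.
    by move: L0; lra.
  have [d d0 H] := derive_pos_right (is_derive_rcross a a _ _) c0.
  pose s := a - Num.min (d / 2) (L / 2).
  have m0 : 0 < Num.min (d / 2) (L / 2) by rewrite lt_min !divr_gt0.
  have sd : `|s - a| < d.
    rewrite /s addrAC subrr add0r normrN gtr0_norm // gt_min; apply/orP; left; lra.
  have [] := H s sd.
  rewrite ra gtrBl m0 => _ /(_ isT); rewrite ltNge => /negP; apply.
  rewrite -rcrossL; apply: h.
  have : Num.min (d / 2) (L / 2) <= L / 2 by rewrite ge_min lexx orbT.
  by move: m0 L0; rewrite /s => *; apply/andP; split; lra.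
have [E1 E2] := cross_collinear c0 n.
set m := _ * p + _ * q in E1 E2.
have m0 : m != 0.
  apply/eqP => m0; have := sc_speed_neq0 a.
  by rewrite E1 E2 m0 !mul0r expr0n /= addr0 ltxx.
exists (- m^-1); last first.
  by rewrite opprK E1 E2 !mulrA; split; rewrite {1}/m -?E1 -?E2 -/m mulVf // mul1r.
rewrite oppr_gt0 invr_lt0 ltNge le_eqVlt eq_sym (negPf m0) /=.
apply/negP => mp.
have hh : a < a + L / 2 < a + L by apply/andP; move: L0; split; lra.
have := sc_turn sc hh; rewrite E1 E2.
have -> : cross (m * p) (m * q) (X (a + L / 2) - X a) (Y (a + L / 2) - Y a) =
  - (m * rcross a (a + L / 2) p q) by rewrite /rcross /cross; ring.
rewrite oppr_gt0 ltNge => /negP; apply; apply: mulr_ge0; first exact: ltW.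
by apply: h; move: L0 => *; apply/andP; split; lra.
Qed.

Lemma chord_line_tangent a p q : p ^+ 2 + q ^+ 2 = 1 -> chord_line a a p q ->
  exists2 l, 0 < l & p = - l * X' a /\ q = - l * Y' a.
Proof. by move=> n [_ h]; exact: tangent_of_sign. Qed.

(** With [b = a + L] the cut-off arc is the whole curve instead of a point: the same tangent line,
    in the opposite sense. *)
Lemma chord_line_tangentL a p q : p ^+ 2 + q ^+ 2 = 1 ->
  chord_line a (a + L) p q ->
  exists2 l, 0 < l & p = l * X' a /\ q = l * Y' a.
Proof.
move=> n [h _].
have n' : (- p) ^+ 2 + (- q) ^+ 2 = 1 by rewrite !sqrrN.
have [|l l0 [Ep Eq]] := tangent_of_sign n' (a := a).
  move=> t /h; rewrite /rcross /cross => H.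
  by rewrite !mulrN -opprD oppr_ge0; lra.
by exists l => //; split; [rewrite -[p]opprK Ep|rewrite -[q]opprK Eq];
  rewrite mulNr opprK.
Qed.

End StrictCurve.

(** * The energy of a wedge *)

Lemma continuous_add (T : topologicalType) (R : realType) (f g : T -> R) :
  continuous f -> continuous g -> continuous (fun z => f z + g z).
Proof. by move=> cf cg z; apply: continuousD; [exact: cf|exact: cg]. Qed.

Lemma continuous_opp (T : topologicalType) (R : realType) (f : T -> R) :
  continuous f -> continuous (fun z => - f z).
Proof. by move=> cf z; apply: continuousN; exact: cf. Qed.

Lemma continuous_mul (T : topologicalType) (R : realType) (f g : T -> R) :
  continuous f -> continuous g -> continuous (fun z => f z * g z).
Proof. by move=> cf cg z; apply: continuousM; [exact: cf|exact: cg]. Qed.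

Lemma continuous_const (T : topologicalType) (R : realType) (k : R) :
  continuous (fun _ : T => k).
Proof. by move=> z; exact: cst_continuous. Qed.

Lemma continuous_composite (T U V : topologicalType) (f : U -> V) (g : T -> U) :
  continuous f -> continuous g -> continuous (fun z => f (g z)).
Proof. by move=> cf cg z; apply: continuous_comp; [exact: cg|exact: cf]. Qed.

Lemma continuous_fst (T U : topologicalType) : continuous (@fst T U).
Proof. by move=> z; exact: cvg_fst. Qed.

Lemma continuous_snd (T U : topologicalType) : continuous (@snd T U).
Proof. by move=> z; exact: cvg_snd. Qed.

Lemma continuous_ident (T : topologicalType) : continuous (fun z : T => z).
Proof. by move=> z; exact: cvg_id. Qed.

Ltac continuity_rules base :=
  repeat lazymatch goal with
  | |- forall x, continuous_at x (fun z => Algebra.add _ _) =>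
      refine (continuous_add _ _)
  | |- forall x, continuous_at x (fun z => Algebra.opp _) =>
      refine (continuous_opp _)
  | |- forall x, continuous_at x (fun z => GRing.mul _ _) =>
      refine (continuous_mul _ _)
  | |- forall x, continuous_at x (fun z => fst _) =>
      refine (continuous_composite (@continuous_fst _ _) _)
  | |- forall x, continuous_at x (fun z => snd _) =>
      refine (continuous_composite (@continuous_snd _ _) _)
  | |- forall x, continuous_at x (fun z => z) => exact: continuous_ident
  | _ => first [base | exact: continuous_const | exact: continuous_fst
      | exact: continuous_snd]
  end.

Lemma closed_le0 (T : topologicalType) (R : realType) (f : T -> R) :
  continuous f -> closed [set z | f z <= 0].
Proof.
move=> cf; apply: (@closed_comp _ _ f [set x | x <= 0]) => //.
Qed.

Section Minimization.
Context (R : realType) (X Y X' Y' : R -> R) (L : R).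
Hypothesis sc : strict_curve X Y X' Y' L.
Context (sg : R -> R).
Hypothesis dsg : forall t : R,
  is_derive t 1 sg (cross (X t) (Y t) (X' t) (Y' t) / 2).
Context (w1 w2 k s : R).
Hypothesis s0 : 0 < s.

Let L0 : 0 < L. Proof. exact: sc_period sc. Qed.
Let dX := sc_dX sc.
Let dY := sc_dY sc.
Let cX : continuous X. Proof. exact: is_derive_fun_continuous dX. Qed.
Let cY : continuous Y. Proof. exact: is_derive_fun_continuous dY. Qed.
Let csg : continuous sg. Proof. exact: is_derive_fun_continuous dsg. Qed.
Let pX := sc_pX sc.
Let pY := sc_pY sc.

(* As [sg] is the area swept from the origin, this is the area between the arc
   from [a] to [b] and its chord. *)
Definition arc_cap (a b : R) : R :=
  sg b - sg a + cross (X b) (Y b) (X a) (Y a) / 2.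

(** [k] and [s] are the cosine and sine of the angle of the wedge; [(rotp, rotq)] is the direction
    of its second side, from [c] towards [d] and the vertex. *)
Definition rotp (p q : R) : R := k * p - s * q.
Definition rotq (p q : R) : R := s * p + k * q.

(** For a unit direction the two [rcross] terms are [s] times the distances from the vertex to [d]
    and to [a], so the quotient is the area of the triangle with corners [a], [d] and the vertex;
    the cap of the arc from [d] to [a + L] is taken away. The denominator makes the expression
    homogeneous of degree 0 in [(p, q)], which will be rotated without being normalised. *)
Definition wedge_area (p q a d : R) : R :=
  rcross X Y a d p q * rcross X Y a d (rotp p q) (rotq p q)
    / (2 * s * (p ^+ 2 + q ^+ 2)) - arc_cap d (a + L).

Definition energy (p q a b c d : R) : R :=
  w1 * arc_cap a b + w2 * arc_cap c d + wedge_area p q a d.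

(** [chord_line] points from its second end to its first. On the first side this is towards the
    vertex, on the second away from it, whence the minus signs. *)
Definition admissible (p q a b c d : R) : Prop :=
  [/\ a <= b, b <= c, c <= d & d <= a + L] /\
  chord_line X Y L a b p q /\
  chord_line X Y L c d (- rotp p q) (- rotq p q).

Lemma continuous_rcross_comp (T : topologicalType) (a t p q : T -> R) :
  continuous a -> continuous t -> continuous p -> continuous q ->
  continuous (fun z => rcross X Y (a z) (t z) (p z) (q z)).
Proof.
move=> ca ct cp cq; rewrite /rcross /cross.
have cXf := @continuous_composite T _ _ X _ cX.
have cYf := @continuous_composite T _ _ Y _ cY.
by continuity_rules ltac:(first [exact cp|exact cq|refine (cXf _ ca)
  |refine (cYf _ ca)|refine (cXf _ ct)|refine (cYf _ ct)]).
Qed.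

Lemma continuous_arc_cap (T : topologicalType) (a b : T -> R) :
  continuous a -> continuous b -> continuous (fun z => arc_cap (a z) (b z)).
Proof.
move=> ca cb; rewrite /arc_cap /cross.
have cXf := @continuous_composite T _ _ X _ cX.
have cYf := @continuous_composite T _ _ Y _ cY.
have cSf := @continuous_composite T _ _ sg _ csg.
by continuity_rules ltac:(first [refine (cXf _ ca)|refine (cYf _ ca)
  |refine (cXf _ cb)|refine (cYf _ cb)|refine (cSf _ ca)|refine (cSf _ cb)]).
Qed.

Lemma sgL t : sg (t + L) - sg t = sg L - sg 0.
Proof.
have d0 (x : R) : is_derive x 1 (fun t => sg (t + L) - sg t) 0.
  have d1 := @is_derive_composite _ sg (fun t => t + L) x _ _
    (dsg (x + L)) (is_derive_add (is_derive_var x) (is_derive_const L x)).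
  apply: (is_derive_eq (is_derive_sub d1 (dsg x))).
  by rewrite addr0 mulr1 pX pY (sc_pX' sc) (sc_pY' sc) subrr.
by rewrite (is_derive_0_is_cst t 0 d0) add0r.
Qed.

Lemma arc_capL a b : arc_cap (a + L) (b + L) = arc_cap a b.
Proof.
rewrite /arc_cap !pX !pY.
have := sgL a; have := sgL b; lra.
Qed.

Lemma energyL p q a b c d :
  energy p q (a + L) (b + L) (c + L) (d + L) = energy p q a b c d.
Proof. by rewrite /energy /wedge_area !arc_capL /rcross !pX !pY. Qed.

Lemma chord_lineL a b p q :
  chord_line X Y L (a + L) (b + L) p q <-> chord_line X Y L a b p q.
Proof.
have E t : rcross X Y (a + L) (t + L) p q = rcross X Y a t p q.
  by rewrite /rcross !pX !pY.
split=> -[h1 h2]; split=> t /andP[t1 t2].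
- by rewrite -E; apply: h1; apply/andP; split; lra.
- by rewrite -E; apply: h2; apply/andP; split; lra.
- by rewrite -(subrK L t) E; apply: h1; apply/andP; split; lra.
- by rewrite -(subrK L t) E; apply: h2; apply/andP; split; lra.
Qed.

Lemma admissibleL p q a b c d :
  admissible p q (a + L) (b + L) (c + L) (d + L) <-> admissible p q a b c d.
Proof.
rewrite /admissible !chord_lineL; split=> -[[h1 h2 h3 h4] h5]; split=> //;
  split; lra.
Qed.

(** The tangency is the minimum over a period of a linear form constant along [(p, q)]. The free
    starting point [a0] allows a second tangency to be found after a given one. *)
Lemma tangent_exists p q a0 :
  exists c, a0 <= c <= a0 + L /\ chord_line X Y L c c p q.
Proof.
pose f t := X t * q - Y t * p.
have cf : continuous f.
  by rewrite /f; continuity_rules ltac:(first [exact: cX|exact: cY]).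
have a0L : a0 <= a0 + L by rewrite lerDl ltW.
have [c ci cm] := @EVT_min R f a0 (a0 + L) a0L (continuous_seg cf).
move: (ci); rewrite in_itv /= => /andP[c1 c2].
exists c; split; first by rewrite c1 c2.
split=> t /andP[t1 t2].
  have -> : t = c by lra.
  by rewrite /rcross !subrr /cross !mul0r subr0.
have : f c <= f t.
  have [tL|tL] := leP t (a0 + L).
    by apply: cm; rewrite in_itv /= tL andbT; lra.
  have -> : f t = f (t - L) by rewrite /f -{1 2}(subrK L t) pX pY.
  by apply: cm; rewrite in_itv /=; apply/andP; split; lra.
by rewrite /f /rcross /cross; lra.
Qed.

Lemma chord_line_scale a b p q n : 0 < n ->
  chord_line X Y L a b p q <-> chord_line X Y L a b (n * p) (n * q).
Proof.
move=> n0; have E t : rcross X Y a t (n * p) (n * q) = n * rcross X Y a t p q.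
  by rewrite /rcross /cross; ring.
split=> -[h1 h2]; split=> t ht.
- by rewrite E pmulr_rle0 //; exact: h1.
- by rewrite E pmulr_rge0 //; exact: h2.
- by rewrite -(pmulr_rle0 _ n0) -E; exact: h1.
- by rewrite -(pmulr_rge0 _ n0) -E; exact: h2.
Qed.

Lemma admissible_scale p q a b c d n : 0 < n ->
  admissible p q a b c d <-> admissible (n * p) (n * q) a b c d.
Proof.
move=> n0; rewrite /admissible.
have -> : - rotp (n * p) (n * q) = n * - rotp p q by rewrite /rotp; ring.
have -> : - rotq (n * p) (n * q) = n * - rotq p q by rewrite /rotq; ring.
by rewrite -!(chord_line_scale _ _ _ _ n0).
Qed.

Lemma energy_scale p q a b c d n : n != 0 -> p ^+ 2 + q ^+ 2 != 0 ->
  energy (n * p) (n * q) a b c d = energy p q a b c d.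
Proof.
move=> n0 pq0; rewrite /energy /wedge_area.
have -> : rcross X Y a d (n * p) (n * q) = n * rcross X Y a d p q.
  by rewrite /rcross /cross; ring.
have -> : rcross X Y a d (rotp (n * p) (n * q)) (rotq (n * p) (n * q)) =
    n * rcross X Y a d (rotp p q) (rotq p q).
  by rewrite /rotp /rotq /rcross /cross; ring.
have -> : (n * p) ^+ 2 + (n * q) ^+ 2 = n ^+ 2 * (p ^+ 2 + q ^+ 2) by ring.
congr (_ + (_ - _)); field.
by rewrite pq0 n0 lt0r_neq0.
Qed.

(** Here the range of the parameter [r] no longer depends on [a] and [b], so each [r] contributes a
    closed condition on [(p, q, a, b)]. *)
Lemma chord_line_unitP a b p q : a <= b <= a + L ->
  chord_line X Y L a b p q <->
  (forall r, 0 <= r <= 1 ->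
    rcross X Y a (a + r * (b - a)) p q <= 0 /\
    - rcross X Y a (b + r * (a + L - b)) p q <= 0).
Proof.
move=> /andP[ab ba]; split=> [[h1 h2] r /andP[r0 r1]|h].
  have u : 0 <= r * (b - a) <= b - a.
    by rewrite mulr_ge0 ?subr_ge0 //= ler_piMl ?subr_ge0.
  have v : 0 <= r * (a + L - b) <= a + L - b.
    by rewrite mulr_ge0 ?subr_ge0 //= ler_piMl ?subr_ge0.
  split; first by apply: h1; move: u; lra.
  by rewrite oppr_le0; apply: h2; move: v; lra.
split=> t /andP[t1 t2].
  have [ab0|ab0] := eqVneq (b - a) 0.
    have [+ _] := h 0 (introT andP (conj (lexx _) ler01)).
    by rewrite mul0r addr0 (_ : t = a) //; lra.
  have p0 : 0 < b - a by rewrite lt_neqAle eq_sym ab0 subr_ge0.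
  have [|+ _] := h ((t - a) / (b - a)).
    by rewrite divr_ge0 ?subr_ge0 //= ler_pdivrMr // mul1r lerB.
  by rewrite divfK // subrKC.
have [ab0|ab0] := eqVneq (a + L - b) 0.
  have [_] := h 0 (introT andP (conj (lexx _) ler01)).
  by rewrite mul0r addr0 oppr_le0 (_ : t = b) //; lra.
have p0 : 0 < a + L - b by rewrite lt_neqAle eq_sym ab0 subr_ge0.
have [|_ +] := h ((t - b) / (a + L - b)).
  by rewrite divr_ge0 ?subr_ge0 //= ler_pdivrMr // mul1r lerB.
by rewrite divfK // subrKC oppr_le0.
Qed.

Local Notation R6 := (R * R * R * R * R * R)%type.

(** A minimum over unit directions and [a] in [[0, L]] exists by compactness. Homogeneity and
    periodicity extend its minimality to all nonzero directions and to a longer range of [a], so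
    that small variations are allowed even from the ends of [[0, L]]. *)
Lemma minimizer_exists : exists p q a b c d : R,
  [/\ p ^+ 2 + q ^+ 2 = 1, 0 <= a <= L, admissible p q a b c d &
    forall p' q' a' b' c' d', 0 < p' ^+ 2 + q' ^+ 2 -> - L <= a' <= L + L ->
      admissible p' q' a' b' c' d' ->
      energy p q a b c d <= energy p' q' a' b' c' d'].
Proof.
pose P (z : R6) := z.1.1.1.1.1.
pose Q (z : R6) := z.1.1.1.1.2.
pose A (z : R6) := z.1.1.1.2.
pose B (z : R6) := z.1.1.2.
pose C (z : R6) := z.1.2.
pose D (z : R6) := z.2.
have cP : continuous P by rewrite /P; continuity_rules fail.
have cQ : continuous Q by rewrite /Q; continuity_rules fail.
have cA : continuous A by rewrite /A; continuity_rules fail.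
have cB : continuous B by rewrite /B; continuity_rules fail.
have cC : continuous C by rewrite /C; continuity_rules fail.
have cD : continuous D by rewrite /D; continuity_rules fail.
have cRP : continuous (fun z => rotp (P z) (Q z)).
  by rewrite /rotp; continuity_rules ltac:(first [exact cP|exact cQ]).
have cRQ : continuous (fun z => rotq (P z) (Q z)).
  by rewrite /rotq; continuity_rules ltac:(first [exact cP|exact cQ]).
pose seg (u v : R) : set R := `[u, v]%classic.
pose box : set (R6) :=
  seg (-1) 1 `*` seg (-1) 1 `*` seg 0 L `*` seg 0 (L + L) `*` seg 0 (L + L)
    `*` seg 0 (L + L).
have cbox : compact box by do ?apply: compact_setX; exact: segment_compact.
pose F z := energy (P z) (Q z) (A z) (B z) (C z) (D z).
pose S z := [/\ P z ^+ 2 + Q z ^+ 2 = 1, 0 <= A z <= L &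
  admissible (P z) (Q z) (A z) (B z) (C z) (D z)].
pose U z1 r := rcross X Y (A z1) (A z1 + r * (B z1 - A z1)) (P z1) (Q z1).
pose U' z1 r := rcross X Y (A z1) (B z1 + r * (A z1 + L - B z1)) (P z1) (Q z1).
pose V z1 r := rcross X Y (C z1) (C z1 + r * (D z1 - C z1))
  (- rotp (P z1) (Q z1)) (- rotq (P z1) (Q z1)).
pose V' z1 r := rcross X Y (C z1) (D z1 + r * (C z1 + L - D z1))
  (- rotp (P z1) (Q z1)) (- rotq (P z1) (Q z1)).
pose base z := [/\ P z ^+ 2 + Q z ^+ 2 = 1, 0 <= A z <= L,
  A z <= B z /\ B z <= C z & C z <= D z /\ D z <= A z + L].
have SP z : S z <-> base z /\ forall r, 0 <= r <= 1 ->
    [/\ U z r <= 0, - U' z r <= 0, V z r <= 0 & - V' z r <= 0].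
  split.
    move=> [h1 h2 [[h3 h4 h5 h6] [l1 l2]]]; split => // r hr.
    have [|l1' _] := @chord_line_unitP (A z) (B z) (P z) (Q z).
      by apply/andP; split; lra.
    have [|l2' _] := @chord_line_unitP (C z) (D z)
      (- rotp (P z) (Q z)) (- rotq (P z) (Q z)).
      by apply/andP; split; lra.
    have [u1 u2] := l1' l1 r hr; have [v1 v2] := l2' l2 r hr.
    by split.
  move=> [[h1 h2 [h3 h4] [h5 h6]] H]; split => //; split; first by split.
  split.
    apply/chord_line_unitP; first by apply/andP; split; lra.
    by move=> r /H[].
  apply/chord_line_unitP; first by apply/andP; split; lra.
  by move=> r /H[].
have closedS : closed S.
  (* [S] is cut out by all continuous functions that are nonpositive on it; it remains to name, for
     each clause of [SP], a function that enforces it. *)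
  have -> : S = \bigcap_(f in [set f : R6 -> R |
      continuous f /\ forall z, S z -> f z <= 0]) [set z | f z <= 0].
    apply/seteqP; split=> [z Sz f [_ /(_ z Sz)]//|z H].
    have use (f : R6 -> R) : continuous f -> (forall z, S z -> f z <= 0) -> f z <= 0.
      by move=> cf hf; exact: H.
    apply/SP; split.
      split.
      - apply/eqP; rewrite eq_le; apply/andP; split.
          rewrite -subr_le0; apply: (use (fun z => P z * P z + Q z * Q z - 1)).
            by continuity_rules ltac:(first [exact cP|exact cQ]).
          by move=> z1 [h _ _]; rewrite -!expr2 h subrr.
        rewrite -subr_le0; apply: (use (fun z => 1 - (P z * P z + Q z * Q z))).
          by continuity_rules ltac:(first [exact cP|exact cQ]).
        by move=> z1 [h _ _]; rewrite -!expr2 h subrr.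
      - apply/andP; split.
          rewrite -oppr_le0; apply: (use (fun z => - A z)).
            by continuity_rules ltac:(first [exact cA]).
          by move=> z1 [_ /andP[h _] _]; rewrite oppr_le0.
        rewrite -subr_le0; apply: (use (fun z => A z - L)).
          by continuity_rules ltac:(first [exact cA]).
        by move=> z1 [_ /andP[_ h] _]; rewrite subr_le0.
      - split; rewrite -subr_le0.
          apply: (use (fun z => A z - B z)).
            by continuity_rules ltac:(first [exact cA|exact cB]).
          by move=> z1 [_ _ [[h _ _ _] _]]; rewrite subr_le0.
        apply: (use (fun z => B z - C z)).
          by continuity_rules ltac:(first [exact cC|exact cB]).
        by move=> z1 [_ _ [[_ h _ _] _]]; rewrite subr_le0.
      - split; rewrite -subr_le0.
          apply: (use (fun z => C z - D z)).
            by continuity_rules ltac:(first [exact cC|exact cD]).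
          by move=> z1 [_ _ [[_ _ h _] _]]; rewrite subr_le0.
        apply: (use (fun z => D z - (A z + L))).
          by continuity_rules ltac:(first [exact cA|exact cD]).
        by move=> z1 [_ _ [[_ _ _ h] _]]; rewrite subr_le0.
    move=> r hr; split.
    - apply: (use (fun z => U z r)); last by move=> z1 /SP[_ /(_ r hr)[]].
      apply: continuous_rcross_comp; continuity_rules ltac:(
        first [exact cA|exact cB|exact cP|exact cQ]).
    - apply: (use (fun z => - U' z r)); last by move=> z1 /SP[_ /(_ r hr)[]].
      apply: continuous_opp; apply: continuous_rcross_comp; continuity_rules ltac:(
        first [exact cA|exact cB|exact cP|exact cQ]).
    - apply: (use (fun z => V z r)); last by move=> z1 /SP[_ /(_ r hr)[]].
      apply: continuous_rcross_comp; continuity_rules ltac:(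
        first [exact cC|exact cD|exact cRP|exact cRQ]).
    - apply: (use (fun z => - V' z r)); last by move=> z1 /SP[_ /(_ r hr)[]].
      apply: continuous_opp; apply: continuous_rcross_comp; continuity_rules ltac:(
        first [exact cC|exact cD|exact cRP|exact cRQ]).
  by apply: closed_bigI => f [cf _]; exact: closed_le0.
have Sbox : S `<=` box.
  move=> z /SP[[h1 /andP[h2 h3] [h4 h5] [h6 h7]] _].
  rewrite /box /seg /= !in_itv /=.
  have p1 : P z ^+ 2 <= 1 by rewrite -h1 lerDl sqr_ge0.
  have q1 : Q z ^+ 2 <= 1 by rewrite -h1 lerDr sqr_ge0.
  have bnd x : x ^+ 2 <= 1 :> R -> -1 <= x <= 1.
    by move=> h; apply/andP; split; nra.
  rewrite -/(P z) -/(Q z) -/(A z) -/(B z) -/(C z) -/(D z).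
  split; last by apply/andP; split; lra.
  split; last by apply/andP; split; lra.
  split; last by apply/andP; split; lra.
  split; last by apply/andP; split; lra.
  by split; exact: bnd.
have cS : compact S by exact: subclosed_compact closedS cbox Sbox.
have S0 : S !=set0.
  have [a [/andP[a0 aL] ta]] := tangent_exists 1 0 0.
  have [c [/andP[ac ca] tc]] := tangent_exists (- rotp 1 0) (- rotq 1 0) a.
  exists (1, 0, a, a, c, c); split => //=.
  - by rewrite /P /Q /=; ring.
  - by rewrite a0 -[L]add0r.
have cF : {within S, continuous F}.
  (* On [S] the direction is a unit vector, so the energy agrees with an expression that has no
     variable denominator and is continuous everywhere. *)
  pose F' z := w1 * arc_cap (A z) (B z) + w2 * arc_cap (C z) (D z)
    + (rcross X Y (A z) (D z) (P z) (Q z) *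
       rcross X Y (A z) (D z) (rotp (P z) (Q z)) (rotq (P z) (Q z))
       / (2 * s) - arc_cap (D z) (A z + L)).
  have cF' : continuous F'.
    have c1 := continuous_arc_cap cA cB.
    have c2 := continuous_arc_cap cC cD.
    have c3 := continuous_arc_cap cD (continuous_add cA (@continuous_const _ _ L)).
    have c4 := continuous_rcross_comp cA cD cP cQ.
    have c5 := continuous_rcross_comp cA cD cRP cRQ.
    rewrite /F'; continuity_rules ltac:(
      first [exact c1|exact c2|exact c3|exact c4|exact c5]).
  apply: (@subspace_eq_continuous _ _ _ F').
    move=> z; rewrite inE => -[h _ _].
    rewrite /from_subspace /F /F' /energy /wedge_area.
    by rewrite h mulr1.
  exact: continuous_subspaceT.
have [z zS zm] := compact_EVT_min S0 cS cF.
move: zS; rewrite inE => -[h1 h2 h3].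
exists (P z), (Q z), (A z), (B z), (C z), (D z); split => //.
move=> p q a b c d pq0 /andP[a1 a2] adm.
pose n := (Num.sqrt (p ^+ 2 + q ^+ 2))^-1.
have n0 : 0 < n by rewrite invr_gt0 sqrtr_gt0.
have n2 : (n * p) ^+ 2 + (n * q) ^+ 2 = 1.
  have -> : (n * p) ^+ 2 + (n * q) ^+ 2 = n ^+ 2 * (p ^+ 2 + q ^+ 2) by ring.
  by rewrite exprVn sqr_sqrtr ?ltW // mulVf ?lt0r_neq0.
rewrite -(energy_scale a b c d (lt0r_neq0 n0) (lt0r_neq0 pq0)).
move/(admissible_scale p q a b c d n0): adm.
move: (n * p) (n * q) n2 => {pq0 n n0} {}p {}q n2 adm.
have zm' a' b' c' d' : 0 <= a' <= L -> admissible p q a' b' c' d' ->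
    F z <= energy p q a' b' c' d'.
  move=> ha hadm.
  by apply: (zm (p, q, a', b', c', d')); rewrite inE.
have [a0|a0] := ltP a 0.
  rewrite -(energyL p q a b c d); apply: zm'; first by apply/andP; split; lra.
  exact/admissibleL.
have [aL|aL] := leP a L; first by apply: zm' => //; rewrite a0 aL.
rewrite -(subrK L a) -(subrK L b) -(subrK L c) -(subrK L d) energyL.
apply: zm'; first by apply/andP; split; lra.
by apply/admissibleL; rewrite !subrK.
Qed.
End Minimization.

(** * First variation of the energy *)

Lemma near_gt0 (R : realType) (f : R -> R) (x : R) :
  {for x, continuous f} -> 0 < f x -> \forall y \near x, 0 < f y.
Proof.
move=> cf fx; have [d d0 H] := continuous_ball cf fx.
by apply: (ball_near d0) => y /H; rewrite ltr_distl => /andP[h _]; lra.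
Qed.

Lemma derive_ge0_of_min_right (R : realType) (f : R -> R) (l : R) :
  is_derive (0 : R) 1 f l ->
  (\forall h \near (0 : R), 0 < h -> f 0 <= f h) -> 0 <= l.
Proof.
move=> df /near_ball[e e0 He]; rewrite leNgt; apply/negP => l0.
have l1 : 0 < - l by rewrite oppr_gt0.
have [d d0 H] := derive_pos_right (is_derive_opp df) l1.
pose h := Num.min (d / 2) (e / 2).
have h0 : 0 < h by rewrite lt_min !divr_gt0.
have hd : `|h - 0| < d.
  rewrite subr0 gtr0_norm // gt_min; apply/orP; left; lra.
have he : `|h - 0| < e.
  rewrite subr0 gtr0_norm // gt_min; apply/orP; right; lra.
by have [/(_ h0) + _] := H h hd; have := He h he h0; lra.
Qed.

Lemma derive_le0_of_min_left (R : realType) (f : R -> R) (l : R) :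
  is_derive (0 : R) 1 f l ->
  (\forall h \near (0 : R), h < 0 -> f 0 <= f h) -> l <= 0.
Proof.
move=> df /near_ball[e e0 He]; rewrite leNgt; apply/negP => l0.
have [d d0 H] := derive_pos_right df l0.
pose h := Num.min (d / 2) (e / 2).
have h0 : 0 < h by rewrite lt_min !divr_gt0.
have hd : `|- h - 0| < d.
  rewrite subr0 normrN gtr0_norm // gt_min; apply/orP; left; lra.
have he : `|- h - 0| < e.
  rewrite subr0 normrN gtr0_norm // gt_min; apply/orP; right; lra.
have hn : - h < 0 by rewrite oppr_lt0.
by have [_ /(_ hn)] := H _ hd; have := He _ he hn; lra.
Qed.

Section Variation.
Context (R : realType) (X Y X' Y' : R -> R) (L : R).
Hypothesis sc : strict_curve X Y X' Y' L.
Context (sg : R -> R).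
Hypothesis dsg : forall t : R,
  is_derive t 1 sg (cross (X t) (Y t) (X' t) (Y' t) / 2).
Context (k s : R).
Hypothesis ks : k ^+ 2 + s ^+ 2 = 1.
Hypothesis s0 : 0 < s.

Let L0 : 0 < L. Proof. exact: sc_period sc. Qed.
Let dX := sc_dX sc.
Let dY := sc_dY sc.
Let cX : continuous X. Proof. exact: is_derive_fun_continuous dX. Qed.
Let cY : continuous Y. Proof. exact: is_derive_fun_continuous dY. Qed.
Let csg : continuous sg. Proof. exact: is_derive_fun_continuous dsg. Qed.
Let pX := sc_pX sc.
Let pY := sc_pY sc.

Local Notation rc := (rcross X Y).
Local Notation cap := (arc_cap X Y sg).
Local Notation vp := (rotp k s).
Local Notation vq := (rotq k s).
Local Notation adm := (admissible X Y L k s).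
Local Notation wedge := (wedge_area X Y L sg k s).

Lemma rot_unit p q : p ^+ 2 + q ^+ 2 = 1 -> (vp p q) ^+ 2 + (vq p q) ^+ 2 = 1.
Proof.
move=> n; rewrite /rotp /rotq.
transitivity ((k ^+ 2 + s ^+ 2) * (p ^+ 2 + q ^+ 2)); first by ring.
by rewrite ks n mulr1.
Qed.

Lemma cross_rot p q : p ^+ 2 + q ^+ 2 = 1 -> cross p q (vp p q) (vq p q) = s.
Proof.
move=> n; rewrite /cross /rotp /rotq.
by transitivity (s * (p ^+ 2 + q ^+ 2)); [ring|rewrite n mulr1].
Qed.

(** If [b = c], both sides pass through that point. Two tangents there would be parallel, against
    [s > 0]; otherwise [s > 0] puts the other end of one side strictly on the wrong side of the
    other. *)
Lemma admissible_lt p q a b c d : p ^+ 2 + q ^+ 2 = 1 ->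
  adm p q a b c d -> b < c.
Proof.
move=> n [[ab bc cd da] [l1 l2]]; rewrite lt_neqAle bc andbT; apply/eqP => E.
have n' := rot_unit n; have Es := cross_rot n.
have n2 : (- vp p q) ^+ 2 + (- vq p q) ^+ 2 = 1 by rewrite !sqrrN.
have EsN : cross p q (- vp p q) (- vq p q) = - s.
  by rewrite -[X in _ = - X]Es /cross; ring.
have [E1|ab1] := eqVneq a b.
  move: l1 l2; rewrite -E -E1 => l1 l2.
  have [l lp [Ep Eq]] := chord_line_tangent sc n l1.
  have [E2|da1] := eqVneq d a.
    move: l2; rewrite E2 => l2.
    have [l' lp' [Ep' Eq']] := chord_line_tangent sc n2 l2.
    have : cross p q (- vp p q) (- vq p q) = 0.
      by rewrite Ep' Eq' {1}Ep {1}Eq /cross; ring.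
    by rewrite EsN => /eqP; rewrite oppr_eq0 gt_eqF.
  have [E2|da2] := eqVneq d (a + L).
    move: l2; rewrite E2 => l2.
    have [l' lp' [Ep' Eq']] := chord_line_tangentL sc n2 l2.
    have : cross p q (- vp p q) (- vq p q) = 0.
      by rewrite Ep' Eq' {1}Ep {1}Eq /cross; ring.
    by rewrite EsN => /eqP; rewrite oppr_eq0 gt_eqF.
  have ad : a < d < a + L.
    by rewrite !lt_neqAle eq_sym da1 da2 da andbT /= E1 E cd.
  have [l' lp' [Ep' Eq']] := chord_line_proper sc ad n2 l2.
  have [_ h] := l1.
  have := h d; rewrite (ltW (proj1 (andP ad))) da => /(_ isT).
  have -> : rc a d p q = - (l' * s).
    by rewrite -[X in _ = - (_ * X)]Es /rcross -!(opprB (X a)) -!(opprB (Y a)) Ep' Eq' /cross; ring.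
  by rewrite oppr_ge0 leNgt mulr_gt0.
have {}ab1 : a < b by rewrite lt_neqAle ab1.
have [E1|ba1] := eqVneq b (a + L).
  have Ec : c = a + L by lra.
  have Ed : d = a + L by lra.
  move: l1 l2; rewrite E1 Ec Ed => l1 l2.
  have [l lp [Ep Eq]] := chord_line_tangentL sc n l1.
  have [l' lp' [Ep' Eq']] := chord_line_tangent sc n2 l2.
  have : cross p q (- vp p q) (- vq p q) = 0.
    by rewrite Ep' Eq' (sc_pX' sc) (sc_pY' sc) {1}Ep {1}Eq /cross; ring.
  by rewrite EsN => /eqP; rewrite oppr_eq0 gt_eqF.
have abL : a < b < a + L.
  by rewrite ab1 lt_neqAle ba1 /=; lra.
have [l lp [Ep Eq]] := chord_line_proper sc abL n l1.
have [_ h] := l2; have := h (a + L).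
have -> : d <= a + L <= c + L by apply/andP; split; lra.
move=> /(_ isT).
have -> : rc c (a + L) (- vp p q) (- vq p q) = - (l * s).
  by rewrite -[X in _ = - (_ * X)]Es /rcross pX pY -E Ep Eq /cross; ring.
by rewrite oppr_ge0 leNgt mulr_gt0.
Qed.

(** These numbers are [s] times the distances from the vertex to [d] and to [a]. A tangent side is
    handled by the turning condition, a proper chord by the orientation of three points of the
    curve. *)
Lemma admissible_gt0 p q a b c d : p ^+ 2 + q ^+ 2 = 1 ->
  adm p q a b c d -> d < a + L ->
  0 < rc a d p q /\ 0 < rc a d (vp p q) (vq p q).
Proof.
move=> n H da; have bc := admissible_lt n H.
case: H => [[ab _ cd _] [l1 l2]].
have n2 : (- vp p q) ^+ 2 + (- vq p q) ^+ 2 = 1 by rewrite !sqrrN rot_unit.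
split.
  have [E1|ab1] := eqVneq a b.
    move: l1; rewrite -E1 => l1.
    have [l lp [-> ->]] := chord_line_tangent sc n l1.
    have -> : rc a d (- l * X' a) (- l * Y' a) =
      l * cross (X' a) (Y' a) (X d - X a) (Y d - Y a).
      by rewrite /rcross /cross; ring.
    by rewrite mulr_gt0 // (sc_turn sc) //; apply/andP; split; lra.
  have {}ab1 : a < b by rewrite lt_neqAle ab1.
  have abL : a < b < a + L by apply/andP; split; lra.
  have [l lp [Ep Eq]] := chord_line_proper sc abL n l1.
  rewrite -(pmulr_rgt0 _ lp).
  have -> : l * rc a d p q = rc a b (X d - X a) (Y d - Y a).
    by rewrite /rcross -!(opprB (X a) (X b)) -!(opprB (Y a) (Y b)) Ep Eq /cross; ring.
  by apply: (orientation sc) => //; apply/andP; split; lra.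
have [E1|cd1] := eqVneq c d.
  move: l2; rewrite -E1 => l2.
  have [l lp [Ep Eq]] := chord_line_tangent sc n2 l2.
  have -> : rc a c (vp p q) (vq p q) =
    l * cross (X' c) (Y' c) (X a - X c) (Y a - Y c).
    by rewrite -[vp p q]opprK -[vq p q]opprK Ep Eq /rcross /cross; ring.
  by rewrite mulr_gt0 // (sc_turn_left sc) //; apply/andP; split; lra.
have {}cd1 : c < d by rewrite lt_neqAle cd1.
have cdL : c < d < c + L by apply/andP; split; lra.
have [l lp [Ep Eq]] := chord_line_proper sc cdL n2 l2.
rewrite -(pmulr_rgt0 _ lp).
have -> : l * rc a d (vp p q) (vq p q) = rc c d (X (a + L) - X c) (Y (a + L) - Y c).
  transitivity (rc a d (l * vp p q) (l * vq p q)).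
    by rewrite /rcross /cross; ring.
  rewrite pX pY (_ : l * vp p q = X d - X c); last by move: Ep; rewrite mulrN; lra.
  rewrite (_ : l * vq p q = Y d - Y c); last by move: Eq; rewrite mulrN; lra.
  by rewrite /rcross /cross; ring.
apply: (orientation sc); last by lra.
by apply/andP; split; lra.
Qed.

(** The rate at which a moving chord sweeps area is the cross product of the chord with the velocity
    of its midpoint. *)
Lemma is_derive_cap (fa fb : R -> R) (x a b a' b' : R) :
  fa x = a -> fb x = b -> is_derive x 1 fa a' -> is_derive x 1 fb b' ->
  is_derive x 1 (fun h => cap (fa h) (fb h))
    (cross (X b - X a) (Y b - Y a) (X' a * a' + X' b * b')
       (Y' a * a' + Y' b * b') / 2).
Proof.
move=> Ea Eb da db; rewrite /arc_cap /cross.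
have dXa : is_derive x 1 (fun h => X (fa h)) (X' a * a').
  by apply: is_derive_composite => //; rewrite Ea; exact: dX.
have dYa : is_derive x 1 (fun h => Y (fa h)) (Y' a * a').
  by apply: is_derive_composite => //; rewrite Ea; exact: dY.
have dXb : is_derive x 1 (fun h => X (fb h)) (X' b * b').
  by apply: is_derive_composite => //; rewrite Eb; exact: dX.
have dYb : is_derive x 1 (fun h => Y (fb h)) (Y' b * b').
  by apply: is_derive_composite => //; rewrite Eb; exact: dY.
have dSa : is_derive x 1 (fun h => sg (fa h)) (cross (X a) (Y a) (X' a) (Y' a) / 2 * a').
  by apply: is_derive_composite => //; rewrite Ea; exact: dsg.
have dSb : is_derive x 1 (fun h => sg (fb h)) (cross (X b) (Y b) (X' b) (Y' b) / 2 * b').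
  by apply: is_derive_composite => //; rewrite Eb; exact: dsg.
derive_rules ltac:(first [exact dXa|exact dYa|exact dXb|exact dYb|exact dSa|exact dSb]).
by rewrite Ea Eb /cross; ring.
Qed.

(** The Plücker relation between the four vectors, with [cross_rot] evaluating the factor of the two
    sides as [s]. *)
Lemma decomposition (mx my tx ty p q : R) : p ^+ 2 + q ^+ 2 = 1 ->
  cross tx ty mx my = (cross mx my (vp p q) (vq p q) * cross tx ty p q
    - cross mx my p q * cross tx ty (vp p q) (vq p q)) / s.
Proof.
move=> n; have s1 : s != 0 by exact: lt0r_neq0.
apply: (mulIf s1); rewrite divfK // -[X in _ * X](cross_rot n) /cross; ring.
Qed.

(** Moving [t] translates the first side; the area lost is the normal displacement times the length,
    [rcross / s], of the segment from the point [t] to the vertex. *)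
Lemma is_derive_wedge_left p q d (t : R) : p ^+ 2 + q ^+ 2 = 1 ->
  is_derive t 1 (fun t => wedge p q t d)
    (- cross (X' t) (Y' t) p q * (rc t d (vp p q) (vq p q) / s)).
Proof.
move=> n; rewrite /wedge_area n mulr1.
have dc := is_derive_cap (fa := fun=> d) (fb := fun t => t + L) erefl erefl
  (is_derive_const d t) (is_derive_add (is_derive_var t) (is_derive_const L t)).
rewrite /rcross; derive_rules ltac:(first [exact dc|exact: dX|exact: dY]).
rewrite pX pY (sc_pX' sc) (sc_pY' sc).
have s1 : s != 0 by exact: lt0r_neq0.
have := decomposition (X d - X t) (Y d - Y t) (X' t) (Y' t) n.
set P := vp p q; set Q := vq p q.
set T := cross (X' t) (Y' t) (X d - X t) (Y d - Y t) => K.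
transitivity ((- cross (X' t) (Y' t) p q * cross (X d - X t) (Y d - Y t) P Q
  - cross (X d - X t) (Y d - Y t) p q * cross (X' t) (Y' t) P Q) / (2 * s) - T / 2).
  by rewrite /T /cross; field.
by rewrite K; field.
Qed.

Lemma is_derive_wedge_right p q a (t : R) : p ^+ 2 + q ^+ 2 = 1 ->
  is_derive t 1 (fun t => wedge p q a t)
    (cross (X' t) (Y' t) (vp p q) (vq p q) * (rc a t p q / s)).
Proof.
move=> n; rewrite /wedge_area n mulr1.
have dc := is_derive_cap (fa := fun t => t) (fb := fun=> a + L) erefl erefl
  (is_derive_var t) (is_derive_const (a + L) t).
rewrite /rcross; derive_rules ltac:(first [exact dc|exact: dX|exact: dY]).
rewrite pX pY (sc_pX' sc) (sc_pY' sc).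
have s1 : s != 0 by exact: lt0r_neq0.
have := decomposition (X t - X a) (Y t - Y a) (X' t) (Y' t) n.
set P := vp p q; set Q := vq p q.
set T := cross (X' t) (Y' t) (X t - X a) (Y t - Y a) => K.
transitivity ((cross (X' t) (Y' t) p q * cross (X t - X a) (Y t - Y a) P Q
  + cross (X t - X a) (Y t - Y a) p q * cross (X' t) (Y' t) P Q) / (2 * s) - T / 2).
  by rewrite /T /cross; field.
by rewrite K; field.
Qed.

(** The curve crosses the line transversally at both ends, so the ends of the parallel chord at
    offset [h] are differentiable in [h], and the cap grows at the rate of the chord's length. *)
Lemma chord_shift a b p q l : a < b < a + L -> p ^+ 2 + q ^+ 2 = 1 -> 0 < l ->
  X a - X b = l * p -> Y a - Y b = l * q ->
  exists fa fb : R -> R,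
  [/\ fa 0 = a /\ fb 0 = b,
    cross (X' a) (Y' a) p q < 0 < cross (X' b) (Y' b) p q,
    is_derive (0 : R) 1 fa (cross (X' a) (Y' a) p q)^-1 /\
    is_derive (0 : R) 1 fb (cross (X' b) (Y' b) p q)^-1,
    is_derive (0 : R) 1 (fun h => cap (fa h) (fb h)) l &
    \forall h \near (0 : R), fa h < fb h < fa h + L /\
      chord_line X Y L (fa h) (fb h) p q].
Proof.
move=> /andP[ab ba] n l0 Ep Eq.
have Ta : cross (X' a) (Y' a) p q < 0.
  rewrite -(pmulr_rlt0 _ l0).
  have -> : l * cross (X' a) (Y' a) p q =
    - cross (X' a) (Y' a) (X b - X a) (Y b - Y a).
    by rewrite -!(opprB (X a) (X b)) -!(opprB (Y a) (Y b)) Ep Eq /cross; ring.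
  by rewrite oppr_lt0 (sc_turn sc) // ab.
have Tb : 0 < cross (X' b) (Y' b) p q.
  rewrite -(pmulr_rgt0 _ l0).
  have -> : l * cross (X' b) (Y' b) p q =
    cross (X' b) (Y' b) (X a - X b) (Y a - Y b).
    by rewrite Ep Eq /cross; ring.
  by apply: (sc_turn_left sc); apply/andP; split; lra.
have ka : rc a a p q = 0 by rewrite /rcross !subrr /cross !mul0r subr0.
have kb : rc a b p q = 0.
  by rewrite /rcross -!(opprB (X a) (X b)) -!(opprB (Y a) (Y b)) Ep Eq /cross; ring.
have cr (x : R) : \forall t \near x, {for t, continuous (fun t => rc a t p q)}.
  by near=> t; exact: is_derive_continuous (is_derive_rcross sc a t p q).
have [fa [fa0 dfa Hfa]] := local_inverse (cr _) (is_derive_rcross sc a a p q)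
  (ltr0_neq0 Ta) ka.
have [fb [fb0 dfb Hfb]] := local_inverse (cr _) (is_derive_rcross sc a b p q)
  (lt0r_neq0 Tb) kb.
exists fa, fb; split => //; first by rewrite Ta Tb.
  have := is_derive_cap fa0 fb0 dfa dfb; set D := (X in is_derive _ _ _ X).
  suff -> : D = l by [].
  rewrite /D -!(opprB (X a) (X b)) -!(opprB (Y a) (Y b)) Ep Eq.
  move: (ltr0_neq0 Ta) (lt0r_neq0 Tb); rewrite /cross => Ta' Tb'.
  by field; rewrite Ta' Tb'.
have cfa := is_derive_continuous dfa; have cfb := is_derive_continuous dfb.
pose ll h := (X (fa h) - X (fb h)) * p + (Y (fa h) - Y (fb h)) * q.
have cll : {for (0 : R), continuous ll}.
  have cXa : {for (0 : R), continuous (fun h => X (fa h))}.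
    by apply: continuous_comp => //; exact: cX.
  have cYa : {for (0 : R), continuous (fun h => Y (fa h))}.
    by apply: continuous_comp => //; exact: cY.
  have cXb : {for (0 : R), continuous (fun h => X (fb h))}.
    by apply: continuous_comp => //; exact: cX.
  have cYb : {for (0 : R), continuous (fun h => Y (fb h))}.
    by apply: continuous_comp => //; exact: cY.
  apply: continuousD; apply: continuousM; first [exact: continuousB | exact: cst_continuous].
have ll0 : 0 < ll 0.
  rewrite /ll fa0 fb0 Ep Eq.
  suff -> : l * p * p + l * q * q = l by [].
  by transitivity (l * (p ^+ 2 + q ^+ 2)); [ring|rewrite n mulr1].
have c1 : {for (0 : R), continuous (fun h => fb h - fa h)} by exact: continuousB.
have c2 : {for (0 : R), continuous (fun h => fa h + L - fb h)}.
  by apply: continuousB => //; apply: continuousD => //; exact: cst_continuous.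
have N1 := near_gt0 cll ll0.
have N2 : \forall h \near (0 : R), 0 < fb h - fa h.
  by apply: (near_gt0 c1); rewrite fa0 fb0 subr_gt0.
have N3 : \forall h \near (0 : R), 0 < fa h + L - fb h.
  by apply: (near_gt0 c2); rewrite fa0 fb0 subr_gt0.
near=> h.
have h1 : 0 < fb h - fa h by near: h.
have h2 : 0 < fa h + L - fb h by near: h.
have h3 : 0 < ll h by near: h.
have hab : fa h < fb h < fa h + L by apply/andP; split; lra.
split => //.
have e1 : rc a (fa h) p q = h by near: h.
have e2 : rc a (fb h) p q = h by near: h.
have c0 : cross (X (fa h) - X (fb h)) (Y (fa h) - Y (fb h)) p q = 0.
  transitivity (rc a (fa h) p q - rc a (fb h) p q).
    by rewrite /rcross /cross; ring.
  by rewrite e1 e2 subrr.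
have [E1 E2] := cross_collinear c0 n.
exact: (chord_lineP sc hab h3 E1 E2).
Unshelve. all: by end_near. Qed.

End Variation.

(* Replacing a tangent side by the parallel chord at distance [eps] costs a cap
   of area [o(eps)] and gains an area of order [eps] in the wedge. *)
Lemma tangent_drop (R : realType) (X Y X' Y' : R -> R) (L : R) (sg : R -> R)
    (a p q w del : R) (phi xi : R -> R) :
  strict_curve X Y X' Y' L ->
  (forall t : R, is_derive t 1 sg (cross (X t) (Y t) (X' t) (Y' t) / 2)) ->
  p ^+ 2 + q ^+ 2 = 1 -> chord_line X Y L a a p q -> 0 < w ->
  (forall t : R, is_derive t 1 phi (- cross (X' t) (Y' t) p q * xi t)) ->
  {for a, continuous xi} -> 0 < xi a -> 0 < del ->
  exists a' b', [/\ a - del < a' < a /\ a < b' < a + del, a' < b' < a' + L,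
    chord_line X Y L a' b' p q, w * arc_cap X Y sg a' b' + phi a' < phi a &
    w * arc_cap X Y sg a' b' + phi b' < phi a].
Proof.
move=> sc dsg n la w0 dphi cxi xi0 del0.
have [lam lam0 [Ep Eq]] := chord_line_tangent sc n la.
have L0 := sc_period sc; have dX := sc_dX sc; have dY := sc_dY sc.
(* Coordinates adapted to the tangent at [a]: [k1] is the distance from it, and [z] the coordinate
   along it, increasing with [t] near [a]. *)
pose k1 t := rcross X Y a t p q.
pose z t := - ((X t - X a) * p + (Y t - Y a) * q).
pose k1' t := cross (X' t) (Y' t) p q.
pose z' t := - (X' t * p + Y' t * q).
have dk (t : R) : is_derive t 1 k1 (k1' t) by exact: is_derive_rcross sc a t p q.
have dz (t : R) : is_derive t 1 z (z' t).
  rewrite /z; derive_rules ltac:(first [exact: dX|exact: dY]).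
  by rewrite /z'; ring.
have ka : k1 a = 0 by rewrite /k1 /rcross !subrr /cross !mul0r subr0.
have za : z a = 0 by rewrite /z !subrr !mul0r addr0 oppr0.
have k_ge0 t : a - L <= t <= a + L -> 0 <= k1 t.
  move=> /andP[t1 t2]; case: la => _ h.
  have [ta|ta] := leP a t; first by apply: h; rewrite ta.
  by rewrite /k1 -(rcrossL sc); apply: h; apply/andP; split; lra.
have z'a : 0 < z' a.
  have : lam * z' a = 1.
    rewrite -n /z'; transitivity (- ((lam * X' a) * p + (lam * Y' a) * q)); first ring.
    by rewrite [in RHS]Ep [in RHS]Eq {1}Ep {1}Eq; ring.
  by move=> h; rewrite -(pmulr_rgt0 _ lam0) h.
have cz' : {for a, continuous z'}.
  apply: continuousN; apply: continuousD; apply: continuousM;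
    first [exact: (sc_cX' sc)|exact: (sc_cY' sc)|exact: cst_continuous].
have [d1 d10 H1] := near_ball (near_gt0 cz' z'a).
have cxi' : {for a, continuous (fun t => xi t - xi a / 2)}.
  by apply: continuousB => //; exact: cst_continuous.
have xi2 : 0 < xi a - xi a / 2 by lra.
have [d2 d20 H2] := near_ball (near_gt0 cxi' xi2).
(* If both ends stay within [eta] of [a] along the tangent, a cap of height [y] has area at most
   [2 * eta * y], weighted at most [xi a * y / 4]; the drop of [phi] will be at least
   [xi a * y / 2]. *)
pose eta := xi a / (8 * w).
have eta0 : 0 < eta by rewrite divr_gt0 // mulr_gt0.
have [d3 d30 H3] := continuous_ball (is_derive_continuous (dz a)) eta0.
pose r := Num.min (Num.min d1 d2) (Num.min d3 (Num.min del L)) / 4.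
have r0 : 0 < r by rewrite divr_gt0 // !lt_min d10 d20 d30 del0 L0.
have rle : [/\ r < d1, r < d2, r < d3 & r < del /\ r < L / 2].
  have m (u : R) : Num.min (Num.min d1 d2) (Num.min d3 (Num.min del L)) <= u -> 0 < u ->
    r < u by rewrite /r; lra.
  have M5 : Num.min (Num.min d1 d2) (Num.min d3 (Num.min del L)) <= L.
    by rewrite !ge_min lexx !orbT.
  split; last (split; last by move: M5 L0; rewrite /r; lra);
    by apply: m; rewrite // !ge_min lexx ?orbT.
case: rle => r1 r2 r3 [r4 r5].
have near_a t : a - r <= t <= a + r ->
  [/\ 0 < z' t, xi a / 2 < xi t & `|z t| < eta].
  move=> /andP[t1 t2]; have tr : `|t - a| <= r by rewrite ler_norml; apply/andP; split; lra.
  split.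
  - by apply: H1; apply: le_lt_trans tr r1.
  - by have := H2 t (le_lt_trans tr r2); lra.
  - by have := H3 t (le_lt_trans tr r3); rewrite za subr0.
(* The point [a] is strictly left of the tangent at [t]; in these coordinates this says that
   [k1' * z] exceeds [z' * k1], which is nonnegative. *)
have k_sign t : a - r <= t <= a + r -> t != a -> 0 < k1' t * z t.
  move=> tr ta; have [zt _ _] := near_a t tr.
  have kt : 0 <= k1 t.
    by apply: k_ge0; move: tr r5 L0; clear; move=> /andP[? ?] *; apply/andP; split; lra.
  have : 0 < cross (X' t) (Y' t) (X a - X t) (Y a - Y t).
    move: tr => /andP[t1 t2].
    have [ta1|ta1] := ltP t a; first by apply: (sc_turn sc); apply/andP; split; lra.
    have ta2 : a < t by rewrite lt_neqAle eq_sym ta ta1.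
    by apply: (sc_turn_left sc); apply/andP; split; lra.
  have -> : cross (X' t) (Y' t) (X a - X t) (Y a - Y t) = k1' t * z t - z' t * k1 t.
    transitivity ((p ^+ 2 + q ^+ 2) * cross (X' t) (Y' t) (X a - X t) (Y a - Y t)).
      by rewrite n mul1r.
    by rewrite /k1' /z /z' /k1 /rcross /cross; ring.
  have : 0 <= z' t * k1 t by rewrite mulr_ge0 // ltW.
  by lra.
have z_right t : a < t <= a + r -> 0 < z t.
  move=> /andP[t1 t2]; have [c c1 E] := mean_value dz t1.
  rewrite za subr0 in E; rewrite E mulr_gt0 ?subr_gt0 //.
  by have [] := near_a c; [move: c1 t1 t2 r0; clear; move=> /andP[? ?] *; apply/andP; split; lra|].
have z_left t : a - r <= t < a -> z t < 0.
  move=> /andP[t1 t2]; have [c c1 E] := mean_value dz t2.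
  rewrite za sub0r in E; rewrite -oppr_gt0 E mulr_gt0 ?subr_gt0 //.
  by have [] := near_a c; [move: c1 t1 t2 r0; clear; move=> /andP[? ?] *; apply/andP; split; lra|].
have k'_right t : a < t <= a + r -> 0 < k1' t.
  move=> tr; have zt := z_right t tr; rewrite -(pmulr_lgt0 _ zt) k_sign //.
    by move: tr r0; clear; move=> /andP[? ?] *; apply/andP; split; lra.
  by rewrite gt_eqF //; case/andP: tr.
have k'_left t : a - r <= t < a -> k1' t < 0.
  move=> tr; have zt := z_left t tr; rewrite -(nmulr_lgt0 _ zt) k_sign //.
    by move: tr r0; clear; move=> /andP[? ?] *; apply/andP; split; lra.
  by rewrite lt_eqF //; case/andP: tr.
have kr : 0 < k1 (a + r).
  have ar : a < a + r by rewrite ltrDl.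
  have [c c1 E] := mean_value dk ar.
  rewrite ka subr0 in E; rewrite E; apply: mulr_gt0; last by rewrite subr_gt0.
  by apply: k'_right; case/andP: c1 => -> /ltW->.
have kl : 0 < k1 (a - r).
  have ar : a - r < a by rewrite gtrBl.
  have [c c1 E] := mean_value dk ar.
  rewrite ka sub0r in E; rewrite -oppr_lt0 E pmulr_llt0; last by rewrite subr_gt0.
  by apply: k'_left; case/andP: c1 => /ltW-> ->.
(* An offset attained on both sides of [a]; the chord at this offset is the new side. *)
pose y := Num.min (k1 (a + r)) (k1 (a - r)).
have y0 : 0 < y by rewrite lt_min kr kl.
have ck : continuous k1 by exact: is_derive_fun_continuous dk.
have [||b' /andP[b1 b2] kb] := @intermediate_value _ k1 a (a + r) y ck.
- by rewrite lerDl ltW.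
- by left; rewrite ka ltW //= ge_min lexx.
have [||a' /andP[a1 a2] ka'] := @intermediate_value _ k1 (a - r) a y ck.
- by rewrite gerBl ltW.
- by right; rewrite ka ltW //= ge_min lexx orbT.
have ab' : a < b'.
  by rewrite lt_neqAle b1 andbT; apply/eqP => E; move: y0; rewrite -kb -E ka ltxx.
have a'a : a' < a.
  by rewrite lt_neqAle a2 andbT; apply/eqP => E; move: y0; rewrite -ka' E ka ltxx.
have za' : z a' < 0 by apply: z_left; rewrite a1 a'a.
have zb' : 0 < z b' by apply: z_right; rewrite ab' b2.
have abL : a' < b' < a' + L.
  by move: ab' a'a a1 b2 r5; clear => *; apply/andP; split; lra.
have c0 : cross (X a' - X b') (Y a' - Y b') p q = 0.
  transitivity (k1 a' - k1 b'); first by rewrite /k1 /rcross /cross; ring.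
  by rewrite ka' kb subrr.
have lpos : 0 < (X a' - X b') * p + (Y a' - Y b') * q.
  have -> : (X a' - X b') * p + (Y a' - Y b') * q = z b' - z a' by rewrite /z; ring.
  by rewrite subr_gt0 (lt_trans za').
have [E1 E2] := cross_collinear c0 n.
have capb : w * arc_cap X Y sg a' b' <= w * (y * (z b' - z a')).
  rewrite ler_pM2l //.
  (* [- j] is a primitive of [k1 * z'], that is, the area between the tangent and the curve. The cap
     is the rectangle [y * (z b' - z a')] less this area. *)
  pose j t := sg t + cross (X t) (Y t) (X a) (Y a) / 2 - z t * k1 t / 2.
  have dj (t : R) : is_derive t 1 (fun t => - j t) (k1 t * z' t).
    rewrite /j /cross; derive_rules
      ltac:(first [exact: dX|exact: dY|exact: dsg|exact: dz|exact: dk]).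
    have I : cross (X t - X a) (Y t - Y a) (X' t) (Y' t) = k1' t * z t - z' t * k1 t.
      transitivity ((p ^+ 2 + q ^+ 2) * cross (X t - X a) (Y t - Y a) (X' t) (Y' t)).
        by rewrite n mul1r.
      by rewrite /k1' /z /z' /k1 /rcross /cross; ring.
    transitivity (- (cross (X t - X a) (Y t - Y a) (X' t) (Y' t)
      - (z' t * k1 t + z t * k1' t)) / 2); first by rewrite /cross; field.
    by rewrite I; field.
  have jab : - j a' <= - j b'.
    apply: (nondecreasing_of_derive dj (ltW (lt_trans a'a ab'))) => t /andP[t1 t2].
    have tr : a - r <= t <= a + r.
      by move: t1 t2 a1 a2 b1 b2; clear => *; apply/andP; split; lra.
    have [zt _ _] := near_a t tr.
    apply: mulr_ge0; last exact: ltW.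
    by apply: k_ge0; move: tr r5 L0; clear; move=> /andP[? ?] *; apply/andP; split; lra.
  have I : cross (X b' - X a) (Y b' - Y a) (X a' - X a) (Y a' - Y a) =
      z b' * k1 a' - k1 b' * z a'.
    transitivity ((p ^+ 2 + q ^+ 2) *
      cross (X b' - X a) (Y b' - Y a) (X a' - X a) (Y a' - Y a)).
      by rewrite n mul1r.
    by rewrite /z /k1 /rcross /cross; ring.
  have -> : arc_cap X Y sg a' b' = j b' - j a' + (z b' * k1 b' - z a' * k1 a') / 2
      + cross (X b' - X a) (Y b' - Y a) (X a' - X a) (Y a' - Y a) / 2.
    by rewrite /arc_cap /j /cross; field.
  by rewrite I ka' kb; move: jab; clear; lra.
have eb : z b' < eta.
  by have [] := near_a b'; [move: ab' a'a a1 b2 r0; clear => *; apply/andP; split; lra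
    |rewrite ltr_norml => _ _ /andP[]].
have ea : - eta < z a'.
  by have [] := near_a a'; [move: ab' a'a a1 b2 r0; clear => *; apply/andP; split; lra
    |rewrite ltr_norml => _ _ /andP[]].
have drop : w * (y * (z b' - z a')) < xi a / 2 * y.
  have -> : xi a / 2 * y = w * (y * (4 * eta)).
    by rewrite /eta; field; exact: lt0r_neq0.
  by rewrite !ltr_pM2l //; move: ea eb eta0; clear; lra.
(* [g] does not decrease from [a'] to [a] and does not increase from [a] to [b'], so [phi] loses at
   least [xi a / 2] per unit of offset in either direction. *)
pose g t := phi t + xi a / 2 * k1 t.
have dg (t : R) : is_derive t 1 g (- k1' t * (xi t - xi a / 2)).
  rewrite /g; derive_rules ltac:(first [exact: dphi|exact: dk]).
  by rewrite /k1'; ring.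
have dg' (t : R) : is_derive t 1 (fun t => - g t) (k1' t * (xi t - xi a / 2)).
  by apply: (is_derive_eq (is_derive_opp (dg t))); ring.
exists a', b'; split => //.
- by move: ab' a'a a1 b2 r4; clear => *; split; apply/andP; split; lra.
- exact: (chord_lineP sc abL lpos E1 E2).
- have : g a' <= g a.
    apply: (nondecreasing_of_derive dg (ltW a'a)) => t /andP[t1 t2].
    have tr : a - r <= t <= a + r.
      by move: t1 t2 a1 a2 b1 b2; clear => *; apply/andP; split; lra.
    have [_ xt _] := near_a t tr.
    apply: mulr_ge0; last by rewrite subr_ge0 ltW.
    by rewrite oppr_ge0 ltW // k'_left // t2 andbT; move: t1 a1; clear; lra.
  by rewrite /g ka mulr0 addr0 ka'; move: capb drop; clear; lra.
- have : - g a <= - g b'.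
    apply: (nondecreasing_of_derive dg' (ltW ab')) => t /andP[t1 t2].
    have tr : a - r <= t <= a + r.
      by move: t1 t2 a1 a2 b1 b2; clear => *; apply/andP; split; lra.
    have [_ xt _] := near_a t tr.
    apply: mulr_ge0; last by rewrite subr_ge0 ltW.
    by rewrite ltW // k'_right // t1 /=; move: t2 b2; clear; lra.
  by rewrite /g ka mulr0 addr0 kb; move: capb drop; clear; lra.
Qed.

(** * Minimal wedges *)

Section Minimizer.
Context (R : realType) (X Y X' Y' : R -> R) (L : R).
Hypothesis sc : strict_curve X Y X' Y' L.
Context (sg : R -> R).
Hypothesis dsg : forall t : R,
  is_derive t 1 sg (cross (X t) (Y t) (X' t) (Y' t) / 2).
Context (k s : R).
Hypothesis ks : k ^+ 2 + s ^+ 2 = 1.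
Hypothesis s0 : 0 < s.

Let L0 : 0 < L. Proof. exact: sc_period sc. Qed.
Let dX := sc_dX sc.
Let dY := sc_dY sc.
Let cX : continuous X. Proof. exact: is_derive_fun_continuous dX. Qed.
Let cY : continuous Y. Proof. exact: is_derive_fun_continuous dY. Qed.
Let pX := sc_pX sc.
Let pY := sc_pY sc.

Local Notation rc := (rcross X Y).
Local Notation cap := (arc_cap X Y sg).
Local Notation vp := (rotp k s).
Local Notation vq := (rotq k s).
Local Notation adm := (admissible X Y L k s).
Local Notation wedge := (wedge_area X Y L sg k s).

Local Notation en := (energy X Y L sg).

Context (w1 w2 : R).
Hypothesis w10 : 0 < w1.
Hypothesis w20 : 0 < w2.
Context (p q a b c d : R).
Hypothesis n : p ^+ 2 + q ^+ 2 = 1.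
Hypothesis aL : 0 <= a <= L.
Hypothesis H : adm p q a b c d.
Hypothesis Hmin : forall p' q' a' b' c' d',
  0 < p' ^+ 2 + q' ^+ 2 -> - L <= a' <= L + L -> adm p' q' a' b' c' d' ->
  en w1 w2 k s p q a b c d <= en w1 w2 k s p' q' a' b' c' d'.

Let bc : b < c. Proof. exact: (admissible_lt sc ks s0 n H). Qed.
Let n' : vp p q ^+ 2 + vq p q ^+ 2 = 1. Proof. exact: (rot_unit ks n). Qed.
Let n2 : (- vp p q) ^+ 2 + (- vq p q) ^+ 2 = 1.
Proof. by rewrite !sqrrN. Qed.
Let pq0 : 0 < p ^+ 2 + q ^+ 2. Proof. by rewrite n. Qed.
Let a_near : -L < a < L + L.
Proof. by move: aL L0 => /andP[? ?] ?; apply/andP; split; lra. Qed.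
Let aN : 0 < a + L. Proof. by move: a_near => /andP[? ?]; lra. Qed.
Let aN2 : 0 < L + L - a. Proof. by move: a_near => /andP[? ?]; lra. Qed.

(** Shifts of the first side. If the vertex were on the curve, only shifts that shrink the cap would
    be admissible; as the distance from the vertex to [a] is then 0, they would lower the energy at
    rate [w1 * l]. Otherwise shifts both ways are admissible and the derivative vanishes. *)
Lemma minimizer_left_chord : a < b -> d < a + L /\
  exists2 l, 0 < l & [/\ X a - X b = l * p, Y a - Y b = l * q &
    w1 * l = rc a d (vp p q) (vq p q) / s].
Proof.
move=> ab; have [[_ _ cd da] [l1 l2]] := H. have hbc := bc; have hL := L0.
have abL : a < b < a + L by apply/andP; split; lra.
have [l l0 [Ep Eq]] := chord_line_proper sc abL n l1.
have [fa [fb [[fa0 fb0] /andP[Ta Tb] [dfa dfb] dcap Hn]]] :=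
  chord_shift sc dsg abL n l0 Ep Eq.
pose phi h := en w1 w2 k s p q (fa h) (fb h) c d.
pose x := rc a d (vp p q) (vq p q) / s.
have dphi : is_derive (0 : R) 1 phi (w1 * l - x).
  have dw : is_derive (0 : R) 1 (fun h => wedge p q (fa h) d)
      (- cross (X' a) (Y' a) p q * x * (cross (X' a) (Y' a) p q)^-1).
    apply: (is_derive_composite (f := fun t => wedge p q t d)) dfa.
    by rewrite fa0; exact: (is_derive_wedge_left sc dsg k s0 d a n).
  rewrite /phi /energy; derive_rules ltac:(first [exact dcap|exact dw]).
  by move: (ltr0_neq0 Ta); move: (cross _ _ _ _) => T T0; field.
have cfa := is_derive_continuous dfa; have cfb := is_derive_continuous dfb.
have phi0 : phi 0 = en w1 w2 k s p q a b c d by rewrite /phi fa0 fb0.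
have N1 : \forall h \near (0 : R), 0 < c - fb h.
  apply: near_gt0; last by rewrite fb0 subr_gt0.
  by apply: continuousB => //; exact: cst_continuous.
have N2 : \forall h \near (0 : R), 0 < fa h + L.
  apply: near_gt0; last by rewrite fa0.
  by apply: continuousD => //; exact: cst_continuous.
have N3 : \forall h \near (0 : R), 0 < L + L - fa h.
  apply: near_gt0; last by rewrite fa0.
  by apply: continuousB => //; exact: cst_continuous.
have key h : fa h < fb h < fa h + L /\ chord_line X Y L (fa h) (fb h) p q ->
    0 < c - fb h -> 0 < fa h + L -> 0 < L + L - fa h -> d <= fa h + L ->
    phi 0 <= phi h.
  move=> [/andP[h1 h2] h3] h4 h5 h6 h7; rewrite phi0; apply: Hmin => //.
    by apply/andP; split; lra.
  by split => //; split; lra.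
have [daL|daL] := ltP d (a + L); last first.
  have da' : d = a + L by lra.
  have x0 : x = 0.
    by rewrite /x da' /rcross pX pY !subrr /cross !mul0r subr0 mul0r.
  have Ta' : 0 < - (cross (X' a) (Y' a) p q)^-1 by rewrite oppr_gt0 invr_lt0.
  have [e e0 He] := derive_pos_right (is_derive_opp dfa) Ta'.
  have : w1 * l - x <= 0.
    apply: (derive_le0_of_min_left dphi); near=> h => hn.
    apply: key; [by near: h..|].
    have he : `|h - 0| < e by near: h; apply: (ball_near e0).
    by have [_ /(_ hn)] := He h he; rewrite fa0 da'; lra.
  by rewrite x0 subr0 leNgt mulr_gt0.
split => //; exists l => //; split => //; apply/eqP; rewrite -subr_eq0.
have N4 : \forall h \near (0 : R), 0 < fa h + L - d.
  apply: near_gt0; last by rewrite fa0 subr_gt0.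
  by apply: continuousB; [apply: continuousD => //|]; exact: cst_continuous.
have N : \forall h \near (0 : R), phi 0 <= phi h.
  near=> h; apply: key; [by near: h..|].
  by rewrite -subr_ge0 ltW //; near: h.
rewrite eq_le; apply/andP; split.
  by apply: (derive_le0_of_min_left dphi); apply: filterS N.
by apply: (derive_ge0_of_min_right dphi); apply: filterS N.
Unshelve. all: by end_near. Qed.

Lemma minimizer_right_chord : c < d -> d < a + L /\
  exists2 l, 0 < l & [/\ X d - X c = l * vp p q, Y d - Y c = l * vq p q &
    w2 * l = rc a d p q / s].
Proof.
move=> cd; have [[ab _ _ da] [l1 l2]] := H. have hbc := bc; have hL := L0.
have cdL : c < d < c + L by apply/andP; split; lra.
have [l l0 [Ep Eq]] := chord_line_proper sc cdL n2 l2.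
have [fc [fd [[fc0 fd0] /andP[Tc Td] [dfc dfd] dcap Hn]]] :=
  chord_shift sc dsg cdL n2 l0 Ep Eq.
pose phi h := en w1 w2 k s p q a b (fc h) (fd h).
pose y := rc a d p q / s.
have dphi : is_derive (0 : R) 1 phi (w2 * l - y).
  have dw : is_derive (0 : R) 1 (fun h => wedge p q a (fd h))
      (cross (X' d) (Y' d) (vp p q) (vq p q) * y *
       (cross (X' d) (Y' d) (- vp p q) (- vq p q))^-1).
    apply: (is_derive_composite (f := fun t => wedge p q a t)) dfd.
    by rewrite fd0; exact: (is_derive_wedge_right sc dsg k s0 a d n).
  rewrite /phi /energy; derive_rules ltac:(first [exact dcap|exact dw]).
  have -> : cross (X' d) (Y' d) (vp p q) (vq p q) =
    - cross (X' d) (Y' d) (- vp p q) (- vq p q) by rewrite /cross; ring.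
  by move: (lt0r_neq0 Td); move: (cross _ _ _ _) => T T0; field.
have cfc := is_derive_continuous dfc; have cfd := is_derive_continuous dfd.
have phi0 : phi 0 = en w1 w2 k s p q a b c d by rewrite /phi fc0 fd0.
have N1 : \forall h \near (0 : R), 0 < fc h - b.
  apply: near_gt0; last by rewrite fc0 subr_gt0.
  by apply: continuousB => //; exact: cst_continuous.
have key h : fc h < fd h < fc h + L /\
    chord_line X Y L (fc h) (fd h) (- vp p q) (- vq p q) ->
    0 < fc h - b -> fd h <= a + L -> phi 0 <= phi h.
  move=> [/andP[h1 h2] h3] h4 h5; rewrite phi0; apply: Hmin => //.
    by case/andP: a_near => /ltW-> /ltW->.
  by split => //; split; lra.
have [daL|daL] := ltP d (a + L); last first.
  have da' : d = a + L by lra.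
  have y0 : y = 0.
    by rewrite /y da' /rcross pX pY !subrr /cross !mul0r subr0 mul0r.
  have Td' : 0 < (cross (X' d) (Y' d) (- vp p q) (- vq p q))^-1 by rewrite invr_gt0.
  have [e e0 He] := derive_pos_right dfd Td'.
  have : w2 * l - y <= 0.
    apply: (derive_le0_of_min_left dphi); near=> h => hn.
    apply: key; [by near: h..|].
    have he : `|h - 0| < e by near: h; apply: (ball_near e0).
    by have [_ /(_ hn)] := He h he; rewrite fd0 da'; lra.
  by rewrite y0 subr0 leNgt mulr_gt0.
split => //; exists l => //; split.
- by move: Ep; rewrite mulrN; lra.
- by move: Eq; rewrite mulrN; lra.
apply/eqP; rewrite -subr_eq0.
have N4 : \forall h \near (0 : R), 0 < a + L - fd h.
  apply: near_gt0; last by rewrite fd0 subr_gt0.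
  by apply: continuousB => //; exact: cst_continuous.
have N : \forall h \near (0 : R), phi 0 <= phi h.
  near=> h; apply: key; [by near: h..|].
  by rewrite -subr_ge0 ltW //; near: h.
rewrite eq_le; apply/andP; split.
  by apply: (derive_le0_of_min_left dphi); apply: filterS N.
by apply: (derive_ge0_of_min_right dphi); apply: filterS N.
Unshelve. all: by end_near. Qed.

Lemma minimizer_left_proper : d < a + L -> a < b.
Proof.
move=> daL; have [[ab _ cd _] [l1 l2]] := H. have hbc := bc; have hL := L0.
rewrite lt_neqAle ab andbT; apply/eqP => E.
have [_ x0] := admissible_gt0 sc ks s0 n H daL.
have la : chord_line X Y L a a p q by rewrite {2}E.
have cxi : {for a, continuous (fun t => rc t d (vp p q) (vq p q) / s)}.
  rewrite /rcross /cross; apply: continuousM; last exact: cst_continuous.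
  by apply: continuousB; apply: continuousM; try exact: cst_continuous;
    apply: continuousB; first [exact: cX|exact: cY|exact: cst_continuous].
(* Moving by less than this bound preserves the order of the four points and keeps [a'] in the range
   where minimality is known. *)
have del0 : 0 < Num.min (Num.min (c - a) (a + L - d)) (Num.min (a + L) (L + L - a)).
  by rewrite !lt_min aN aN2 E !subr_gt0 bc -E daL.
have [a' [b' [[/andP[h1 h2] /andP[h3 h4]] /andP[h5 h6] lab dec _]]] :=
  tangent_drop sc dsg n la w10
    (fun t => is_derive_wedge_left sc dsg k s0 d t n) cxi
    (divr_gt0 x0 s0) del0.
move: h1 h4; set del := Num.min _ _ => h1 h4.
have m1 : del <= c - a by rewrite !ge_min lexx.
have m2 : del <= a + L - d by rewrite !ge_min lexx !orbT.
have m3 : del <= a + L by rewrite !ge_min lexx !orbT.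
have m4 : del <= L + L - a by rewrite !ge_min lexx !orbT.
have := @Hmin p q a' b' c d pq0.
move=> HH; move: dec; rewrite ltNge => /negP; apply.
have {}HH : en w1 w2 k s p q a b c d <= en w1 w2 k s p q a' b' c d.
  apply: HH; first by apply/andP; split; lra.
  by split => //; split; lra.
move: HH; rewrite /energy -E.
have -> : cap a a = 0 by rewrite /arc_cap /cross; field.
by lra.
Qed.

Lemma minimizer_right_proper : d < a + L -> c < d.
Proof.
move=> daL; have [[ab _ cd _] [l1 l2]] := H. have hbc := bc; have hL := L0.
rewrite lt_neqAle cd andbT; apply/eqP => E.
have [y0 _] := admissible_gt0 sc ks s0 n H daL.
have lc : chord_line X Y L c c (- vp p q) (- vq p q) by rewrite {2}E.
have cxi : {for c, continuous (fun t => rc a t p q / s)}.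
  rewrite /rcross /cross; apply: continuousM; last exact: cst_continuous.
  by apply: continuousB; apply: continuousM; try exact: cst_continuous;
    apply: continuousB; first [exact: cX|exact: cY|exact: cst_continuous].
have del0 : 0 < Num.min (c - b) (a + L - d).
  by rewrite !lt_min !subr_gt0 bc daL.
have y0' : 0 < rc a c p q / s by rewrite E divr_gt0.
have dphi (t : R) : is_derive t 1 (fun t => wedge p q a t)
    (- cross (X' t) (Y' t) (- vp p q) (- vq p q) * (rc a t p q / s)).
  apply: (is_derive_eq (is_derive_wedge_right sc dsg k s0 a t n)).
  by rewrite /cross; ring.
have [c' [d' [[/andP[h1 h2] /andP[h3 h4]] /andP[h5 h6] lcd _ dec]]] :=
  tangent_drop sc dsg n2 lc w20 dphi cxi y0' del0.
move: h1 h4; set del := Num.min _ _ => h1 h4.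
have m1 : del <= c - b by rewrite !ge_min lexx.
have m2 : del <= a + L - d by rewrite !ge_min lexx !orbT.
move: dec; rewrite ltNge => /negP; apply.
have : en w1 w2 k s p q a b c d <= en w1 w2 k s p q a b c' d'.
  apply: Hmin => //; first by case/andP: a_near => /ltW-> /ltW->.
  by split => //; split; lra.
rewrite /energy -E.
have -> : cap c c = 0 by rewrite /arc_cap /cross; field.
by lra.
Qed.

(** A proper chord on either side already excludes a vertex on the curve. If both sides are
    degenerate, they are tangent at the same point, hence parallel, against [s > 0]. *)
Lemma minimizer_nondegenerate : d < a + L.
Proof.
rewrite ltNge; apply/negP => daL.
have [[ab _ cd da] [l1 l2]] := H. have hbc := bc; have hL := L0.
have [E1|ab1] := eqVneq a b; last first.
  have ab2 : a < b by rewrite lt_neqAle ab1.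
  by have [] := minimizer_left_chord ab2; lra.
have [E2|cd1] := eqVneq c d; last first.
  have cd2 : c < d by rewrite lt_neqAle cd1.
  by have [] := minimizer_right_chord cd2; lra.
have da' : d = a + L by lra.
move: l1 l2; rewrite -E1 E2 da' => l1 l2.
have [l lp [Ep Eq]] := chord_line_tangent sc n l1.
have [l' lp' [Ep' Eq']] := chord_line_tangent sc n2 l2.
have : cross p q (- vp p q) (- vq p q) = 0.
  by rewrite Ep' Eq' (sc_pX' sc) (sc_pY' sc) {1}Ep {1}Eq /cross; ring.
have -> : cross p q (- vp p q) (- vq p q) = - cross p q (vp p q) (vq p q).
  by rewrite /cross; ring.
by rewrite (cross_rot _ _ n) => /eqP; rewrite oppr_eq0 gt_eqF.
Qed.

End Minimizer.

(* Rotating the direction [(p, q)] with one end of the chord fixed: [f tau] is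
   the other end when the direction becomes [(p - tau q, q + tau p)]. *)
Lemma chord_rotation (R : realType) (X Y X' Y' : R -> R) (L : R)
    (a b p q l : R) :
  strict_curve X Y X' Y' L -> a != b -> b - L < a < b + L ->
  p ^+ 2 + q ^+ 2 = 1 -> 0 < l -> X a - X b = l * p -> Y a - Y b = l * q ->
  exists f : R -> R, [/\ f 0 = b, cross (X' b) (Y' b) p q != 0,
    is_derive (0 : R) 1 f (l / cross (X' b) (Y' b) p q) &
    \forall tau \near (0 : R), exists2 m, 0 < m &
      X a - X (f tau) = m * (p - tau * q) /\
      Y a - Y (f tau) = m * (q + tau * p)].
Proof.
move=> sc abN /andP[ba ab] n l0 Ep Eq.
have dX := sc_dX sc; have dY := sc_dY sc.
pose e t := (X a - X t) * p + (Y a - Y t) * q.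
pose c t := cross (X a - X t) (Y a - Y t) p q.
have de (t : R) : is_derive t 1 e (- (X' t * p + Y' t * q)).
  rewrite /e; derive_rules ltac:(first [exact: dX|exact: dY]); ring.
have dc (t : R) : is_derive t 1 c (- cross (X' t) (Y' t) p q).
  rewrite /c /cross; derive_rules ltac:(first [exact: dX|exact: dY]); ring.
have eb : e b = l.
  rewrite /e Ep Eq; transitivity (l * (p ^+ 2 + q ^+ 2)); first by ring.
  by rewrite n mulr1.
have cb : c b = 0 by rewrite /c Ep Eq /cross; ring.
have T0 : cross (X' b) (Y' b) p q != 0.
  have : 0 < cross (X' b) (Y' b) (X a - X b) (Y a - Y b).
    have [ab1|ab1] := ltP a b.
      by apply: (sc_turn_left sc); rewrite ba ab1.
    by apply: (sc_turn sc); rewrite ab lt_neqAle eq_sym abN ab1.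
  rewrite Ep Eq => h; apply/eqP => h0; move: h.
  suff -> : cross (X' b) (Y' b) (l * p) (l * q) = l * cross (X' b) (Y' b) p q.
    by rewrite h0 mulr0 ltxx.
  by rewrite /cross; ring.
(* The slope, in the frame of [(p, q)], of the direction from the point [t] to the point [a]. Its
   local inverse gives the end of the chord as a function of the slope [tau]. *)
pose T t := - c t * (e t)^-1.
have dT : is_derive b 1 T (cross (X' b) (Y' b) p q / l).
  have e0 : e b != 0 by rewrite eb lt0r_neq0.
  apply: (is_derive_eq (is_derive_mul (is_derive_opp (dc b)) (is_derive_inv (de b) e0))).
  by rewrite cb eb oppr0 mul0r addr0 opprK.
have epos : \forall t \near b, 0 < e t.
  by apply: near_gt0; [exact: is_derive_continuous (de b)|rewrite eb].
have cT : \forall t \near b, {for t, continuous T}.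
  apply: filterS epos => t et.
  apply: (is_derive_continuous (is_derive_mul (is_derive_opp (dc t))
    (is_derive_inv (de t) (lt0r_neq0 et)))).
have Tb : T b = 0 by rewrite /T cb oppr0 mul0r.
have T0' : cross (X' b) (Y' b) p q / l != 0 by rewrite mulf_neq0 // invr_neq0 // lt0r_neq0.
have [f [f0 df Hf]] := local_inverse cT dT T0' Tb.
exists f; split => //; first by rewrite -invf_div.
have cf := is_derive_continuous df.
have epos' : \forall h \near (0 : R), 0 < e (f h).
  apply: near_gt0; last by rewrite f0 eb.
  by apply: continuous_comp => //; exact: is_derive_continuous (de _).
near=> tau.
have et : 0 < e (f tau) by near: tau.
have : T (f tau) = tau by near: tau.
rewrite /T => HT.
have {}HT : c (f tau) = - tau * e (f tau).
  by rewrite mulNr -{2}HT mulrVK ?unitfE ?lt0r_neq0 // opprK.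
exists (e (f tau)) => //; move: HT; rewrite /c /e /cross.
move: (X a - X _) (Y a - Y _) => x y HT.
split.
  transitivity (x * (p ^+ 2 + q ^+ 2)); first by rewrite n mulr1.
  transitivity ((x * p + y * q) * p + (x * q - y * p) * q); first by ring.
  by rewrite HT; ring.
transitivity (y * (p ^+ 2 + q ^+ 2)); first by rewrite n mulr1.
transitivity ((x * p + y * q) * q - (x * q - y * p) * p); first by ring.
by rewrite HT; ring.
Unshelve. all: by end_near. Qed.

(** [(u, v)] is the vertex of a minimal wedge, and [x], [y] are its distances to the near points.
    The bounds on the parameters serve the later compactness argument. *)
Lemma wedge_inscribed (R : realType) (X Y X' Y' : R -> R) (L k s r1 r2 : R) :
  strict_curve X Y X' Y' L -> k ^+ 2 + s ^+ 2 = 1 -> 0 < s -> 1 < r1 -> 1 < r2 ->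
  exists p q x y u v a b c d : R,
  [/\ [/\ 0 <= a, a <= b, b <= c, c <= d & d <= L + L] /\ p ^+ 2 + q ^+ 2 = 1,
    0 < x /\ 0 < y, r1 * x ^+ 2 = r2 * y ^+ 2,
    (X a = u - x * p /\ Y a = v - x * q) /\
    (X b = u - r1 * x * p /\ Y b = v - r1 * x * q) &
    (X c = u - r2 * y * rotp k s p q /\ Y c = v - r2 * y * rotq k s p q) /\
    (X d = u - y * rotp k s p q /\ Y d = v - y * rotq k s p q)].
Proof.
move=> sc ks s0 r11 r21.
have dX := sc_dX sc; have dY := sc_dY sc; have L0 := sc_period sc.
have [sg dsg] : exists sg : R -> R, forall t : R,
    is_derive t 1 sg (cross (X t) (Y t) (X' t) (Y' t) / 2).
  apply: (@primitive_exists R (fun t => cross (X t) (Y t) (X' t) (Y' t) / 2)).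
  have cX : continuous X := is_derive_fun_continuous dX.
  have cY : continuous Y := is_derive_fun_continuous dY.
  have cX' := sc_cX' sc; have cY' := sc_cY' sc.
  rewrite /cross; continuity_rules ltac:(first [exact cX|exact cY|exact cX'|exact cY']).
pose w1 := (r1 - 1)^-1; pose w2 := (r2 - 1)^-1.
have w10 : 0 < w1 by rewrite invr_gt0 subr_gt0.
have w20 : 0 < w2 by rewrite invr_gt0 subr_gt0.
have [p [q [a [b [c [d [n aL H Hmin]]]]]]] := minimizer_exists sc dsg w1 w2 k s0.
have daL := minimizer_nondegenerate sc dsg ks s0 w10 w20 n aL H Hmin.
have ab := minimizer_left_proper sc dsg ks s0 w10 n aL H Hmin daL.
have cd := minimizer_right_proper sc dsg ks s0 w20 n aL H Hmin daL.
have [_ [l1 l10 [Ep1 Eq1 E1]]] := minimizer_left_chord sc dsg ks s0 w10 n aL H Hmin ab.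
have [_ [l2 l20 [Ep2 Eq2 E2]]] := minimizer_right_chord sc dsg ks s0 w20 n aL H Hmin cd.
have bc := admissible_lt sc ks s0 n H.
have [y0 x0] := admissible_gt0 sc ks s0 n H daL.
have n2 := rot_unit ks n.
set P := rotp k s p q in Ep2 E1 x0 n2 *; set Q := rotq k s p q in Eq2 E1 x0 n2 *.
set x := rcross X Y a d P Q / s in E1; set y := rcross X Y a d p q / s in E2.
have xp : 0 < x by rewrite divr_gt0.
have yp : 0 < y by rewrite divr_gt0.
have [] : [/\ b - L < a < b + L, c - L < d < c + L, a != b & d != c].
  split; [| |by rewrite lt_eqF|by rewrite gt_eqF];
    clear -ab bc cd daL L0; apply/andP; split; lra.
move=> ho1 ho2 abN dcN.
have [fb [fb0 Tb dfb Hb]] := chord_rotation sc abN ho1 n l10 Ep1 Eq1.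
have [fc [fc0 Tc dfc Hc]] := chord_rotation sc dcN ho2 n2 l20 Ep2 Eq2.
have s1 : s != 0 by exact: lt0r_neq0.
have Ex : s * x = rcross X Y a d P Q by rewrite mulrC divfK.
have Ey : s * y = rcross X Y a d p q by rewrite mulrC divfK.
(* Going [x] from the point [a] along the first side or [y] from the point [d] along the second
   leads to the same point, the vertex. *)
have decX : X d - X a = x * p - y * P.
  apply: (mulfI s1).
  transitivity (cross p q P Q * (X d - X a)); first by rewrite (cross_rot k s n).
  transitivity (s * x * p - s * y * P); last by ring.
  by rewrite Ex Ey /rcross /cross; ring.
have decY : Y d - Y a = x * q - y * Q.
  apply: (mulfI s1).
  transitivity (cross p q P Q * (Y d - Y a)); first by rewrite (cross_rot k s n).
  transitivity (s * x * q - s * y * Q); last by ring.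
  by rewrite Ex Ey /rcross /cross; ring.
have dot1 : (X d - X a) * p + (Y d - Y a) * q = x - k * y.
  rewrite decX decY; transitivity ((x - k * y) * (p ^+ 2 + q ^+ 2)).
    by rewrite /P /Q /rotp /rotq; ring.
  by rewrite n mulr1.
have dot2 : (X d - X a) * P + (Y d - Y a) * Q = k * x - y.
  rewrite decX decY.
  transitivity (k * x * (p ^+ 2 + q ^+ 2) - y * (P ^+ 2 + Q ^+ 2)).
    by rewrite /P /Q /rotp /rotq; ring.
  by rewrite n n2 !mulr1.
have main : w1 * l1 ^+ 2 - w2 * l2 ^+ 2 + x ^+ 2 - y ^+ 2 = 0.
  (* Both sides turn by the same angle, the first about the point [a] and the second about the point
     [d], so the angle of the wedge is unchanged. The direction is not normalised. *)
  pose phi tau := energy X Y L sg w1 w2 k s (p - tau * q) (q + tau * p)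
    a (fb tau) (fc tau) d.
  have nt tau : (p - tau * q) ^+ 2 + (q + tau * p) ^+ 2 = 1 + tau * tau.
    transitivity ((p ^+ 2 + q ^+ 2) * (1 + tau * tau)); first by ring.
    by rewrite n mul1r.
  have t0 (tau : R) : 0 < 1 + tau * tau by rewrite ltr_pwDl // -expr2 sqr_ge0.
  have phiE : phi = fun tau => w1 * arc_cap X Y sg a (fb tau)
      + w2 * arc_cap X Y sg (fc tau) d
      + ((s * y + tau * (x - k * y)) * (s * x + tau * (k * x - y))
         * (2 * s * (1 + tau * tau))^-1 - arc_cap X Y sg d (a + L)).
    apply/funext => tau; rewrite /phi /energy /wedge_area nt -dot1 -dot2 Ex Ey.
    congr (_ + (_ * _ * _ - _)); rewrite /rcross /cross; first by ring.
    by rewrite /P /Q /rotp /rotq; ring.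
  (* A chord of length [l] turning about its fixed end sweeps [l ^+ 2 / 2] per unit of angle; the
     two sides contribute with opposite signs. *)
  have capb : cross (X b - X a) (Y b - Y a)
      (X' a * 0 + X' b * (l1 / cross (X' b) (Y' b) p q))
      (Y' a * 0 + Y' b * (l1 / cross (X' b) (Y' b) p q)) / 2 = l1 ^+ 2 / 2.
    rewrite -!(opprB (X a) (X b)) -!(opprB (Y a) (Y b)) Ep1 Eq1.
    by move: Tb; rewrite /cross => Tb; field.
  have capc : cross (X d - X c) (Y d - Y c)
      (X' c * (l2 / cross (X' c) (Y' c) P Q) + X' d * 0)
      (Y' c * (l2 / cross (X' c) (Y' c) P Q) + Y' d * 0) / 2 = - l2 ^+ 2 / 2.
    by rewrite Ep2 Eq2; move: Tc; rewrite /cross => Tc; field.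
  have dcb := is_derive_cap sc dsg (fa := fun=> a) (x := 0) erefl fb0
    (is_derive_const a 0) dfb.
  have dcc := is_derive_cap sc dsg (fb := fun=> d) (x := 0) fc0 erefl dfc
    (is_derive_const d 0).
  have D0 : (2 * s * (1 + 0 * 0)) != 0 :> R.
    by rewrite mul0r addr0 mulr1 mulf_neq0.
  have ddi := is_derive_inv (f := fun tau => 2 * s * (1 + tau * tau))
    (is_derive_mul (is_derive_const (2 * s) 0)
      (is_derive_add (is_derive_const 1 0)
        (is_derive_mul (is_derive_var 0) (is_derive_var 0)))) D0.
  have dphi : is_derive (0 : R) 1 phi
     ((w1 * l1 ^+ 2 - w2 * l2 ^+ 2 + x ^+ 2 - y ^+ 2) / 2).
    rewrite phiE.
    rewrite capb in dcb; rewrite capc in dcc.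
    derive_rules ltac:(first [exact dcb|exact dcc|exact ddi]).
    by rewrite !mul0r !mulr0 !add0r !addr0 ?oppr0 ?mul0r ?mulr0 ?addr0; field.
  have phi0 : phi 0 = energy X Y L sg w1 w2 k s p q a b c d.
    by rewrite /phi fb0 fc0 !mul0r subr0 addr0.
  have cfb := is_derive_continuous dfb; have cfc := is_derive_continuous dfc.
  have N1 : \forall h \near (0 : R), 0 < fb h - a.
    apply: near_gt0; last by rewrite fb0 subr_gt0.
    by apply: continuousB => //; exact: cst_continuous.
  have N2 : \forall h \near (0 : R), 0 < fc h - fb h.
    apply: near_gt0; last by rewrite fc0 fb0 subr_gt0.
    exact: continuousB.
  have N3 : \forall h \near (0 : R), 0 < d - fc h.
    apply: near_gt0; last by rewrite fc0 subr_gt0.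
    by apply: continuousB => //; exact: cst_continuous.
  have N : \forall h \near (0 : R), phi 0 <= phi h.
    near=> h; rewrite phi0; apply: Hmin.
    - by rewrite nt.
    - by clear -aL L0; case/andP: aL => *; apply/andP; split; lra.
    have h1 : 0 < fb h - a by near: h.
    have h2 : 0 < fc h - fb h by near: h.
    have h3 : 0 < d - fc h by near: h.
    have [m1 m10 [F1 G1]] : exists2 m, 0 < m & X a - X (fb h) = m * (p - h * q) /\
      Y a - Y (fb h) = m * (q + h * p) by near: h.
    have [m2 m20 [F2 G2]] : exists2 m, 0 < m & X d - X (fc h) = m * (P - h * Q) /\
      Y d - Y (fc h) = m * (Q + h * P) by near: h.
    split; first by clear -h1 h2 h3 daL; split; lra.
    split.
      by apply: (chord_lineP sc _ m10 F1 G1);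
        clear -h1 h2 h3 daL; apply/andP; split; lra.
    apply: (chord_lineP sc _ m20);
      first by clear -h1 h2 h3 daL ab bc; apply/andP; split; lra.
      rewrite -(opprB (X d)) F2 /P /Q /rotp /rotq; ring.
    by rewrite -(opprB (Y d)) G2 /P /Q /rotp /rotq; ring.
  have e1 := derive_ge0_of_min_right dphi (filterS (fun h H _ => H) N).
  have e2 := derive_le0_of_min_left dphi (filterS (fun h H _ => H) N).
  have : (w1 * l1 ^+ 2 - w2 * l2 ^+ 2 + x ^+ 2 - y ^+ 2) / 2 = 0.
    by apply/eqP; rewrite eq_le e1 e2.
  by move/eqP; rewrite mulf_eq0 invr_eq0 pnatr_eq0 orbF => /eqP.
have F1 : l1 = (r1 - 1) * x.
  by rewrite -E1 /w1 mulrA mulfV ?mul1r // gt_eqF // subr_gt0.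
have F2 : l2 = (r2 - 1) * y.
  by rewrite -E2 /w2 mulrA mulfV ?mul1r // gt_eqF // subr_gt0.
exists p, q, x, y, (X a + x * p), (Y a + x * q), a, b, c, d; split => //.
- by split => //; case/andP: aL => *; split; lra.
- have r10 : r1 - 1 != 0 by rewrite gt_eqF // subr_gt0.
  have r20 : r2 - 1 != 0 by rewrite gt_eqF // subr_gt0.
  apply/eqP; rewrite -subr_eq0; apply/eqP; rewrite -[RHS]main F1 F2 /w1 /w2.
  by field; rewrite r10 r20.
- rewrite !addrK; split => //; split.
    by move: Ep1; rewrite F1; lra.
  by move: Eq1; rewrite F1; lra.
- rewrite -/P -/Q; split; last by split; [move: decX|move: decY]; lra.
  split; [move: decX Ep2|move: decY Eq2]; rewrite F2; lra.
Unshelve. all: by end_near. Qed.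

(** * Strict convexification *)

(** The origin is strictly left of every tangent, the curve itself only weakly, as it may contain
    segments. Injectivity then has to be a separate field, while [wc_origin] still gives nonzero
    speed. *)
Record weak_curve (R : realType) (X Y X' Y' : R -> R) (L : R) : Prop := {
  wc_period : 0 < L;
  wc_dX : forall t : R, is_derive t 1 X (X' t);
  wc_dY : forall t : R, is_derive t 1 Y (Y' t);
  wc_cX' : continuous X';
  wc_cY' : continuous Y';
  wc_pX : forall t, X (t + L) = X t;
  wc_pY : forall t, Y (t + L) = Y t;
  wc_pX' : forall t, X' (t + L) = X' t;
  wc_pY' : forall t, Y' (t + L) = Y' t;
  wc_inj : forall t s, t < s < t + L -> X s != X t \/ Y s != Y t;
  wc_origin : forall t, 0 < cross (X t) (Y t) (X' t) (Y' t);
  wc_turn : forall t s, 0 <= cross (X' t) (Y' t) (X s - X t) (Y s - Y t) }.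

Section Shrink.
Context (R : realType) (X Y X' Y' : R -> R).

(* The planar map [p |-> p / sqrt (1 + e |p|^2)] sends a line missing the origin
   into an ellipse, hence makes a convex curve around the origin strictly
   convex. *)
Definition shrink_norm (e t : R) : R := Num.sqrt (1 + e * (X t ^+ 2 + Y t ^+ 2)).
Definition shrink (e : R) (Z : R -> R) (t : R) : R := Z t / shrink_norm e t.
Definition shrink' (e : R) (Z Z' : R -> R) (t : R) : R :=
  Z' t / shrink_norm e t
  - Z t * (e * (X t * X' t + Y t * Y' t)) / shrink_norm e t ^+ 3.

Lemma shrink_norm_sqr e t : 0 <= e ->
  shrink_norm e t ^+ 2 = 1 + e * (X t ^+ 2 + Y t ^+ 2).
Proof.
by move=> e0; rewrite sqr_sqrtr // addr_ge0 // mulr_ge0 // addr_ge0 // sqr_ge0.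
Qed.

Lemma shrink_norm_ge1 e t : 0 <= e -> 1 <= shrink_norm e t.
Proof.
move=> e0; rewrite -[leLHS]sqrtr1 ler_sqrt; last first.
  by rewrite addr_ge0 // mulr_ge0 // addr_ge0 // sqr_ge0.
by rewrite lerDl mulr_ge0 // addr_ge0 // sqr_ge0.
Qed.

Lemma shrink_norm_gt0 e t : 0 <= e -> 0 < shrink_norm e t.
Proof. by move=> e0; apply: lt_le_trans ltr01 (shrink_norm_ge1 t e0). Qed.

Hypothesis dX : forall t : R, is_derive t 1 X (X' t).
Hypothesis dY : forall t : R, is_derive t 1 Y (Y' t).

Lemma is_derive_shrink e (Z Z' : R -> R) (t : R) : 0 <= e ->
  is_derive t 1 Z (Z' t) -> is_derive t 1 (shrink e Z) (shrink' e Z Z' t).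
Proof.
move=> e0 dZ; have N0 := shrink_norm_gt0 t e0.
have A0 : 0 < 1 + e * (X t ^+ 2 + Y t ^+ 2) by rewrite -shrink_norm_sqr ?exprn_gt0.
have dA : is_derive t 1 (fun t => 1 + e * (X t ^+ 2 + Y t ^+ 2))
    (2 * e * (X t * X' t + Y t * Y' t)).
  have -> : (fun t => 1 + e * (X t ^+ 2 + Y t ^+ 2)) =
    (fun t => 1 + e * (X t * X t + Y t * Y t)).
    by apply/funext => r; rewrite !expr2.
  derive_rules ltac:(first [exact: dX|exact: dY]); ring.
have dN := @is_derive_composite _ Num.sqrt _ t _ _ (is_derive1_sqrt A0) dA.
have dI := is_derive_inv dN (lt0r_neq0 N0).
apply: (is_derive_eq (is_derive_mul dZ dI)).
rewrite /shrink' -/(shrink_norm e t).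
by move: (lt0r_neq0 N0); move: (shrink_norm e t) => N NN; field.
Qed.

End Shrink.

(** Up to a positive factor, the new turning expression is the old one plus the [wc_origin] term
    times n m - (1 + e p.q), where p, q are the two points and n, m their norms. This factor is
    positive by the strict Cauchy-Schwarz inequality for (1, sqrt e p) and (1, sqrt e q), which are
    not proportional. *)
Lemma shrink_strict (R : realType) (X Y X' Y' : R -> R) (L e : R) :
  weak_curve X Y X' Y' L -> 0 < e ->
  strict_curve (shrink X Y e X) (shrink X Y e Y)
    (shrink' X Y X' Y' e X X') (shrink' X Y X' Y' e Y Y') L.
Proof.
move=> wc e0; have e1 := ltW e0.
have dX := wc_dX wc; have dY := wc_dY wc.
have cX : continuous X := is_derive_fun_continuous dX.
have cY : continuous Y := is_derive_fun_continuous dY.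
have cX' := wc_cX' wc; have cY' := wc_cY' wc.
have pN t : shrink_norm X Y e (t + L) = shrink_norm X Y e t.
  by rewrite /shrink_norm (wc_pX wc) (wc_pY wc).
have cN : continuous (fun t => (shrink_norm X Y e t)^-1).
  move=> t; apply: continuousV; first by rewrite lt0r_neq0 // shrink_norm_gt0.
  apply: (@continuous_comp _ _ _ (fun t => 1 + e * (X t ^+ 2 + Y t ^+ 2)) Num.sqrt);
    last exact: sqrt_continuous.
  have c : continuous (fun t => 1 + e * (X t * X t + Y t * Y t)).
    by continuity_rules ltac:(first [exact cX|exact cY]).
  by have := c t; under eq_fun do rewrite -!expr2.
have cS (Z Z' : R -> R) : continuous Z -> continuous Z' ->
    continuous (shrink' X Y X' Y' e Z Z').
  move=> cZ cZ'.
  have -> : shrink' X Y X' Y' e Z Z' = fun t =>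
      Z' t * (shrink_norm X Y e t)^-1 - Z t * (e * (X t * X' t + Y t * Y' t)) *
      ((shrink_norm X Y e t)^-1 * ((shrink_norm X Y e t)^-1 * (shrink_norm X Y e t)^-1)).
    by apply/funext => t; rewrite /shrink' -!invfM -!expr2 -exprS.
  by continuity_rules ltac:(first [exact cX|exact cY|exact cX'|exact cY'
    |exact cZ|exact cZ'|exact cN]).
apply: Build_strict_curve.
- exact: wc_period wc.
- by move=> t; exact: is_derive_shrink.
- by move=> t; exact: is_derive_shrink.
- exact: cS.
- exact: cS.
- by move=> t; rewrite /shrink pN (wc_pX wc).
- by move=> t; rewrite /shrink pN (wc_pY wc).
- by move=> t; rewrite /shrink' pN !(wc_pX wc, wc_pY wc, wc_pX' wc, wc_pY' wc).
- by move=> t; rewrite /shrink' pN !(wc_pX wc, wc_pY wc, wc_pX' wc, wc_pY' wc).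
move=> t s ts; rewrite /shrink /shrink'.
have W := wc_origin wc t; have T := wc_turn wc t s.
have I : 0 < (X s - X t) ^+ 2 + (Y s - Y t) ^+ 2.
  rewrite lt_neqAle addr_ge0 ?sqr_ge0 // andbT eq_sym paddr_eq0 ?sqr_ge0 //.
  by rewrite !sqrf_eq0 !subr_eq0 negb_and; apply/orP; exact: (wc_inj wc ts).
have n2 := shrink_norm_sqr X Y t e1; have m2 := shrink_norm_sqr X Y s e1.
have n0 := shrink_norm_gt0 X Y t e1; have m0 := shrink_norm_gt0 X Y s e1.
move: (shrink_norm X Y e t) (shrink_norm X Y e s) n2 m2 n0 m0 => n m n2 m2 n0 m0.
move: (X t) (Y t) (X' t) (Y' t) (X s) (Y s) W T I n2 m2 => x y x' y' z w W T I n2 m2.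
have -> : cross (x' / n - x * (e * (x * x' + y * y')) / n ^+ 3)
     (y' / n - y * (e * (x * x' + y * y')) / n ^+ 3) (z / m - x / n) (w / m - y / n) =
   (n ^+ 2 * cross x' y' z w - n * m * cross x' y' x y
    - e * (x * x' + y * y') * cross x y z w) / (n ^+ 3 * m).
  by rewrite /cross; field; rewrite !lt0r_neq0.
rewrite divr_gt0 ?mulr_gt0 ?exprn_gt0 // n2.
have -> : (1 + e * (x ^+ 2 + y ^+ 2)) * cross x' y' z w - n * m * cross x' y' x y
    - e * (x * x' + y * y') * cross x y z w =
  cross x' y' (z - x) (w - y) + cross x y x' y' * (n * m - (1 + e * (x * z + y * w))).
  by rewrite /cross; ring.
suff : 0 < n * m - (1 + e * (x * z + y * w)).
  by move=> h; have := mulr_gt0 W h; lra.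
have nm0 : 0 < n * m by rewrite mulr_gt0.
rewrite subr_gt0 ltNge; apply/negP => h.
have : (n * m) ^+ 2 <= (1 + e * (x * z + y * w)) ^+ 2.
  by rewrite lerXn2r // nnegrE ltW // (lt_le_trans nm0).
rewrite exprMn n2 m2 leNgt => /negP; apply.
rewrite -subr_gt0.
(* Lagrange's identity, exhibiting the defect in Cauchy-Schwarz as a sum of squares. *)
have -> : (1 + e * (x ^+ 2 + y ^+ 2)) * (1 + e * (z ^+ 2 + w ^+ 2))
   - (1 + e * (x * z + y * w)) ^+ 2 =
   e * ((z - x) ^+ 2 + (w - y) ^+ 2) + e ^+ 2 * cross x y z w ^+ 2.
  by rewrite /cross; ring.
by rewrite ltr_pwDl ?mulr_gt0 // mulr_ge0 // sqr_ge0.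
Qed.

(** * Quadrilaterals in strictly convex curves *)

Lemma chord_cos_sin (R : realType) (a b : R) :
  cos a - cos b = - 2 * sin ((a - b) / 2) * sin ((a + b) / 2) /\
  sin a - sin b = 2 * sin ((a - b) / 2) * cos ((a + b) / 2).
Proof.
set m := (a + b) / 2; set d := (a - b) / 2.
have Ea : a = m + d by rewrite /m /d; field.
have Eb : b = m - d by rewrite /m /d; field.
have -> : cos a = cos m * cos d - sin m * sin d by rewrite -cosD -Ea.
have -> : sin a = sin m * cos d + cos m * sin d by rewrite -sinD -Ea.
have -> : cos b = cos m * cos d + sin m * sin d by rewrite -cosB -Eb.
have -> : sin b = sin m * cos d - cos m * sin d by rewrite -sinB -Eb.
by split; ring.
Qed.

Lemma chord_cross (R : realType) (a b a' b' : R) :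
  cross (cos a - cos b) (sin a - sin b) (cos a' - cos b') (sin a' - sin b') =
  4 * sin ((a - b) / 2) * sin ((a' - b') / 2) * sin ((a' + b') / 2 - (a + b) / 2).
Proof.
have [-> ->] := chord_cos_sin a b; have [-> ->] := chord_cos_sin a' b'.
by rewrite sinB /cross; ring.
Qed.

Lemma counterclockwise_cross (R : realType) (a b c : R) :
  a < b < c -> c < a + 2 * pi ->
  0 < cross (cos b - cos a) (sin b - sin a) (cos c - cos a) (sin c - sin a).
Proof.
move=> /andP[ab bc] ca; rewrite chord_cross.
have h (x : R) : 0 < x < pi -> 0 < sin x by exact: sin_gt0_pi.
rewrite !mulr_gt0 //; apply: h; apply/andP; split; lra.
Qed.

(** Recovers the data of the wedge from four points of the unit circle. The last cross product makes
    the sides from b to a and from c to d converge; the other two place their intersection beyond a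
    and beyond d. *)
Lemma wedge_model (R : realType) (a1 a2 b1 b2 c1 c2 d1 d2 : R) :
  a1 ^+ 2 + a2 ^+ 2 = 1 -> b1 ^+ 2 + b2 ^+ 2 = 1 ->
  c1 ^+ 2 + c2 ^+ 2 = 1 -> d1 ^+ 2 + d2 ^+ 2 = 1 ->
  0 < cross (b1 - a1) (b2 - a2) (d1 - a1) (d2 - a2) ->
  0 < cross (d1 - c1) (d2 - c2) (a1 - c1) (a2 - c2) ->
  0 < cross (a1 - b1) (a2 - b2) (d1 - c1) (d2 - c2) ->
  exists p q x y u v k s r1 r2 : R,
  [/\ p ^+ 2 + q ^+ 2 = 1 /\ k ^+ 2 + s ^+ 2 = 1, [/\ 0 < s, 1 < r1 & 1 < r2],
    [/\ 0 < x, 0 < y & r1 * x ^+ 2 = r2 * y ^+ 2],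
    (a1 = u - x * p /\ a2 = v - x * q) /\
    (b1 = u - r1 * x * p /\ b2 = v - r1 * x * q) &
    (c1 = u - r2 * y * rotp k s p q /\ c2 = v - r2 * y * rotq k s p q) /\
    (d1 = u - y * rotp k s p q /\ d2 = v - y * rotq k s p q)].
Proof.
move=> na nb nc nd oA oC oS.
pose l1 := Num.sqrt ((a1 - b1) ^+ 2 + (a2 - b2) ^+ 2).
pose l2 := Num.sqrt ((d1 - c1) ^+ 2 + (d2 - c2) ^+ 2).
have nz (x y : R) z w : 0 < cross x y z w -> 0 < x ^+ 2 + y ^+ 2.
  move=> h; rewrite lt_neqAle addr_ge0 ?sqr_ge0 // andbT eq_sym paddr_eq0 ?sqr_ge0 //.
  rewrite !sqrf_eq0; apply/negP => /andP[/eqP x0 /eqP y0].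
  by move: h; rewrite x0 y0 /cross !mul0r subrr ltxx.
have l10 : 0 < l1 by rewrite sqrtr_gt0; exact: nz oS.
have l20 : 0 < l2 by rewrite sqrtr_gt0; exact: nz oC.
have l1E : l1 ^+ 2 = (a1 - b1) ^+ 2 + (a2 - b2) ^+ 2.
  by rewrite sqr_sqrtr // addr_ge0 // sqr_ge0.
have l2E : l2 ^+ 2 = (d1 - c1) ^+ 2 + (d2 - c2) ^+ 2.
  by rewrite sqr_sqrtr // addr_ge0 // sqr_ge0.
have n1 := lt0r_neq0 l10; have n2 := lt0r_neq0 l20.
pose p := (a1 - b1) / l1; pose q := (a2 - b2) / l1.
pose P := (d1 - c1) / l2; pose Q := (d2 - c2) / l2.
have pq : p ^+ 2 + q ^+ 2 = 1.
  by rewrite /p /q !expr_div_n -mulrDl -l1E divff // expf_neq0.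
have PQ : P ^+ 2 + Q ^+ 2 = 1.
  by rewrite /P /Q !expr_div_n -mulrDl -l2E divff // expf_neq0.
have Ep : a1 - b1 = l1 * p by rewrite mulrC divfK.
have Eq : a2 - b2 = l1 * q by rewrite mulrC divfK.
have EP : d1 - c1 = l2 * P by rewrite mulrC divfK.
have EQ : d2 - c2 = l2 * Q by rewrite mulrC divfK.
pose k := p * P + q * Q; pose s := cross p q P Q.
have s0 : 0 < s.
  rewrite -(pmulr_rgt0 _ (mulr_gt0 l10 l20)); move: oS; rewrite Ep Eq EP EQ.
  by rewrite /s /cross; lra.
have rp : rotp k s p q = P.
  transitivity (P * (p ^+ 2 + q ^+ 2)); last by rewrite pq mulr1.
  by rewrite /rotp /k /s /cross; ring.
have rq : rotq k s p q = Q.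
  transitivity (Q * (p ^+ 2 + q ^+ 2)); last by rewrite pq mulr1.
  by rewrite /rotq /k /s /cross; ring.
pose x := cross (d1 - a1) (d2 - a2) P Q / s.
pose y := cross (d1 - a1) (d2 - a2) p q / s.
have x0 : 0 < x.
  rewrite divr_gt0 // -(pmulr_rgt0 _ l20); move: oC; congr (0 < _).
  transitivity (cross (d1 - a1) (d2 - a2) (l2 * P) (l2 * Q)).
    by rewrite -EP -EQ /cross; ring.
  by rewrite /cross; ring.
have y0 : 0 < y.
  rewrite divr_gt0 // -(pmulr_rgt0 _ l10); move: oA; congr (0 < _).
  transitivity (cross (d1 - a1) (d2 - a2) (l1 * p) (l1 * q)).
    by rewrite -Ep -Eq /cross; ring.
  by rewrite /cross; ring.
have s1 := lt0r_neq0 s0; have x1 := lt0r_neq0 x0; have y1 := lt0r_neq0 y0.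
have Ex : s * x = cross (d1 - a1) (d2 - a2) P Q by rewrite mulrC divfK.
have Ey : s * y = cross (d1 - a1) (d2 - a2) p q by rewrite mulrC divfK.
have D1 : d1 - a1 = x * p - y * P.
  apply: (mulfI s1); transitivity (s * x * p - s * y * P); last by ring.
  by rewrite Ex Ey /s /cross; ring.
have D2 : d2 - a2 = x * q - y * Q.
  apply: (mulfI s1); transitivity (s * x * q - s * y * Q); last by ring.
  by rewrite Ex Ey /s /cross; ring.
(* A chord of the unit circle ending at [g] with unit direction [f] has length twice the scalar
   product of [g] and [f]. *)
have tang (g1 g2 h1 h2 f1 f2 l : R) : l != 0 ->
    g1 ^+ 2 + g2 ^+ 2 = 1 -> h1 ^+ 2 + h2 ^+ 2 = 1 -> f1 ^+ 2 + f2 ^+ 2 = 1 ->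
    g1 - h1 = l * f1 -> g2 - h2 = l * f2 -> 2 * (g1 * f1 + g2 * f2) = l.
  move=> l0 ng nh nf E1 E2; apply: (mulfI l0).
  have F1 : h1 = g1 - l * f1 by rewrite -E1; ring.
  have F2 : h2 = g2 - l * f2 by rewrite -E2; ring.
  have : l * (2 * (g1 * f1 + g2 * f2)) =
    (g1 ^+ 2 + g2 ^+ 2) - (h1 ^+ 2 + h2 ^+ 2) + l ^+ 2 * (f1 ^+ 2 + f2 ^+ 2).
    by rewrite F1 F2; ring.
  by rewrite ng nh nf => ->; ring.
have TA := tang _ _ _ _ _ _ _ n1 na nb pq Ep Eq.
have TD := tang _ _ _ _ _ _ _ n2 nd nc PQ EP EQ.
(* The power of the vertex with respect to the unit circle, computed along each side. *)
have pow : x ^+ 2 + l1 * x = y ^+ 2 + l2 * y.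
  have G1 : a1 + x * p = d1 + y * P by move: D1; lra.
  have G2 : a2 + x * q = d2 + y * Q by move: D2; lra.
  have : (a1 + x * p) ^+ 2 + (a2 + x * q) ^+ 2 = (d1 + y * P) ^+ 2 + (d2 + y * Q) ^+ 2.
    by rewrite G1 G2.
  have -> : (a1 + x * p) ^+ 2 + (a2 + x * q) ^+ 2 = (a1 ^+ 2 + a2 ^+ 2)
    + x ^+ 2 * (p ^+ 2 + q ^+ 2) + x * (2 * (a1 * p + a2 * q)) by ring.
  have -> : (d1 + y * P) ^+ 2 + (d2 + y * Q) ^+ 2 = (d1 ^+ 2 + d2 ^+ 2)
    + y ^+ 2 * (P ^+ 2 + Q ^+ 2) + y * (2 * (d1 * P + d2 * Q)) by ring.
  by rewrite na nd pq PQ TA TD; lra.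
exists p, q, x, y, (a1 + x * p), (a2 + x * q), k, s, (1 + l1 / x), (1 + l2 / y).
rewrite rp rq.
have -> : (1 + l1 / x) * x = x + l1 by field.
have -> : (1 + l2 / y) * y = y + l2 by field.
split.
- split=> //; transitivity ((p ^+ 2 + q ^+ 2) * (P ^+ 2 + Q ^+ 2)).
    by rewrite /k /s /cross; ring.
  by rewrite pq PQ mulr1.
- by split=> //; rewrite ltrDl divr_gt0.
- split=> //.
  have -> : (1 + l1 / x) * x ^+ 2 = x ^+ 2 + l1 * x by field.
  by have -> : (1 + l2 / y) * y ^+ 2 = y ^+ 2 + l2 * y by field.
- by rewrite !addrK; split=> //; split; [move: Ep|move: Eq]; lra.
- split; split; [move: D1 EP|move: D2 EQ|move: D1|move: D2]; lra.
Qed.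

(* The point of parameter [a] is [b + z exp (i t)] in complex notation. *)
Definition similar_at (R : realType) (X Y : R -> R) (zx zy bx by_ t a : R) : Prop :=
  X a = bx + zx * cos t - zy * sin t /\ Y a = by_ + zx * sin t + zy * cos t.

(** By [chord_cross] the sign of the sine tells at which end the lines t1 t2 and t4 t3 meet;
    negative means beyond the points of angle [t1] and [t4]. *)
Lemma strict_inscribed_wedge (R : realType) (X Y X' Y' : R -> R) (L t1 t2 t3 t4 : R) :
  strict_curve X Y X' Y' L -> [/\ t1 < t2, t2 < t3, t3 < t4 & t4 < t1 + 2 * pi] ->
  sin ((t3 + t4) / 2 - (t1 + t2) / 2) < 0 ->
  exists zx zy bx by_ a b c d : R,
  [/\ (0 < zx ^+ 2 + zy ^+ 2), [/\ 0 <= a <= L + L, 0 <= b <= L + L,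
      0 <= c <= L + L & 0 <= d <= L + L],
    similar_at X Y zx zy bx by_ t1 a /\ similar_at X Y zx zy bx by_ t2 b &
    similar_at X Y zx zy bx by_ t3 c /\ similar_at X Y zx zy bx by_ t4 d].
Proof.
move=> sc [t12 t23 t34 t41] neg.
have u t : cos t ^+ 2 + sin t ^+ 2 = 1 :> R by exact: cos2Dsin2.
have oA : 0 < cross (cos t2 - cos t1) (sin t2 - sin t1) (cos t4 - cos t1) (sin t4 - sin t1).
  by apply: counterclockwise_cross => //; apply/andP; split; lra.
have oC : 0 < cross (cos t4 - cos t3) (sin t4 - sin t3) (cos t1 - cos t3) (sin t1 - sin t3).
  have := @counterclockwise_cross R t3 t4 (t1 + 2 * pi).
  rewrite mulr_natl cosD2pi sinD2pi -mulr_natl; apply; last by lra.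
  by apply/andP; split; lra.
have oS : 0 < cross (cos t1 - cos t2) (sin t1 - sin t2) (cos t4 - cos t3) (sin t4 - sin t3).
  rewrite chord_cross (addrC t4 t3).
  have h1 : 0 < - sin ((t1 - t2) / 2).
    by rewrite -sinN; apply: sin_gt0_pi; apply/andP; split; lra.
  have h2 : 0 < sin ((t4 - t3) / 2).
    by apply: sin_gt0_pi; apply/andP; split; lra.
  have h3 : 0 < - sin ((t3 + t4) / 2 - (t1 + t2) / 2) by rewrite oppr_gt0.
  have h4 : 0 < 4 :> R by [].
  have := mulr_gt0 (mulr_gt0 h4 h2) (mulr_gt0 h1 h3).
  by congr (0 < _); ring.
have [p0 [q0 [x0 [y0 [u0 [v0 [k [s [r1 [r2 [[n0 ks] [s0 r11 r21] [x00 y00 E0]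
  [[A1 A2] [B1 B2]] [[C1 C2] [D1 D2]]]]]]]]]]]]] :=
  wedge_model (u t1) (u t2) (u t3) (u t4) oA oC oS.
have [p [q [x [y [w [z [a [b [c [d [[[a0 ab bc cd dL] n] [xp yp] E
  [[a1 a2] [b1 b2]] [[c1 c2] [d1 d2]]]]]]]]]]]]] :=
  wedge_inscribed sc ks s0 r11 r21.
(* The scale of the similarity: as both wedges satisfy the same relation between squares of
   distances, this is also the ratio of [y] to [y0]. *)
pose l := x / x0.
have l0 : 0 < l by rewrite divr_gt0.
have Ex : x = l * x0 by rewrite divfK ?lt0r_neq0.
have Ey : y = l * y0.
  have : y ^+ 2 = (l * y0) ^+ 2.
    have r20 : r2 != 0 by rewrite lt0r_neq0 // (lt_trans ltr01).
    apply: (mulfI r20); transitivity (l ^+ 2 * (r1 * x0 ^+ 2)).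
      by rewrite -E Ex; ring.
    by rewrite E0; ring.
  have ly : 0 <= l * y0 by exact: ltW (mulr_gt0 l0 y00).
  by move/eqP; rewrite eqrXn2 // ?(ltW yp) // => /eqP.
(* The complex number [l] (p + i q) / (p0 + i q0), which carries the model wedge to the one
   found. *)
pose zx := l * (p * p0 + q * q0); pose zy := l * (q * p0 - p * q0).
have Z1 : zx * p0 - zy * q0 = l * p.
  transitivity (l * p * (p0 ^+ 2 + q0 ^+ 2)); last by rewrite n0 mulr1.
  by rewrite /zx /zy; ring.
have Z2 : zx * q0 + zy * p0 = l * q.
  transitivity (l * q * (p0 ^+ 2 + q0 ^+ 2)); last by rewrite n0 mulr1.
  by rewrite /zx /zy; ring.
have Z3 : zx * rotp k s p0 q0 - zy * rotq k s p0 q0 = l * rotp k s p q.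
  transitivity (k * (zx * p0 - zy * q0) - s * (zx * q0 + zy * p0)).
    by rewrite /rotp /rotq; ring.
  by rewrite Z1 Z2 /rotp; ring.
have Z4 : zx * rotq k s p0 q0 + zy * rotp k s p0 q0 = l * rotq k s p q.
  transitivity (s * (zx * p0 - zy * q0) + k * (zx * q0 + zy * p0)).
    by rewrite /rotp /rotq; ring.
  by rewrite Z1 Z2 /rotq; ring.
exists zx, zy, (w - (zx * u0 - zy * v0)), (z - (zx * v0 + zy * u0)), a, b, c, d.
have key (m g h e f : R) : zx * g - zy * h = l * e -> zx * h + zy * g = l * f ->
  w - l * m * e = w - (zx * u0 - zy * v0) + zx * (u0 - m * g) - zy * (v0 - m * h) /\
  z - l * m * f = z - (zx * v0 + zy * u0) + zx * (v0 - m * h) + zy * (u0 - m * g).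
  move=> H1 H2; split.
    by transitivity (w - m * (zx * g - zy * h)); [rewrite H1; ring|ring].
  by transitivity (z - m * (zx * h + zy * g)); [rewrite H2; ring|ring].
split.
- have -> : zx ^+ 2 + zy ^+ 2 = l ^+ 2 * ((p ^+ 2 + q ^+ 2) * (p0 ^+ 2 + q0 ^+ 2)).
    by rewrite /zx /zy; ring.
  by rewrite n n0 !mulr1 exprn_gt0.
- by clear -a0 ab bc cd dL; split; apply/andP; split; lra.
- rewrite /similar_at a1 a2 b1 b2 A1 A2 B1 B2 Ex mulrCA; split; exact: key.
- rewrite /similar_at c1 c2 d1 d2 C1 C2 D1 D2 Ey mulrCA; split; exact: key.
Qed.

(** If the sides meet at the other end, the cyclic relabelling [t3, t4, t1 + 2 pi, t2 + 2 pi]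
    exchanges them and changes the sign of the sine. *)
Lemma strict_inscribed (R : realType) (X Y X' Y' : R -> R) (L t1 t2 t3 t4 : R) :
  strict_curve X Y X' Y' L -> [/\ t1 < t2, t2 < t3, t3 < t4 & t4 < t1 + 2 * pi] ->
  sin ((t3 + t4) / 2 - (t1 + t2) / 2) != 0 ->
  exists zx zy bx by_ a b c d : R,
  [/\ (0 < zx ^+ 2 + zy ^+ 2), [/\ 0 <= a <= L + L, 0 <= b <= L + L,
      0 <= c <= L + L & 0 <= d <= L + L],
    similar_at X Y zx zy bx by_ t1 a /\ similar_at X Y zx zy bx by_ t2 b &
    similar_at X Y zx zy bx by_ t3 c /\ similar_at X Y zx zy bx by_ t4 d].
Proof.
move=> sc T; rewrite neq_lt => /orP[|pos]; first exact: (strict_inscribed_wedge sc T).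
case: (T) => t12 t23 t34 t41.
have T' : [/\ t3 < t4, t4 < t1 + 2 * pi, t1 + 2 * pi < t2 + 2 * pi &
    t2 + 2 * pi < t3 + 2 * pi] by split; lra.
have neg : sin ((t1 + 2 * pi + (t2 + 2 * pi)) / 2 - (t3 + t4) / 2) < 0.
  rewrite (_ : _ - _ = - ((t3 + t4) / 2 - (t1 + t2) / 2) + pi *+ 2); last by field.
  by rewrite sinD2pi sinN oppr_lt0.
have [zx [zy [bx [by_ [c [d [a [b [z0 [hc hd ha hb] [Sc Sd] [Sa Sb]]]]]]]]]] :=
  strict_inscribed_wedge sc T' neg.
exists zx, zy, bx, by_, a, b, c, d; split => //.
by move: Sa Sb; rewrite /similar_at !mulr_natl !cosD2pi !sinD2pi.
Qed.

(** * Passage to the limit *)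

Lemma sqr_sum_neq0 (R : realType) (x y : R) :
  (0 < x ^+ 2 + y ^+ 2) = (x != 0) || (y != 0).
Proof.
by rewrite lt_neqAle addr_ge0 ?sqr_ge0 // andbT eq_sym paddr_eq0 ?sqr_ge0 //
  !sqrf_eq0 negb_and.
Qed.

Section Limit.
Context (R : realType) (X Y X' Y' : R -> R) (L : R).
Hypothesis wc : weak_curve X Y X' Y' L.

Let dX := wc_dX wc.
Let dY := wc_dY wc.
Let cX : continuous X. Proof. exact: is_derive_fun_continuous dX. Qed.
Let cY : continuous Y. Proof. exact: is_derive_fun_continuous dY. Qed.
Let cX' := wc_cX' wc.
Let cY' := wc_cY' wc.

(** The square as parameter makes the shrunk curves jointly continuous over all real [f], with no
    sign condition. *)
Local Notation N f t := (shrink_norm X Y (f ^+ 2) t).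
Local Notation U f := (shrink X Y (f ^+ 2) X).
Local Notation V f := (shrink X Y (f ^+ 2) Y).
Local Notation U' f := (shrink' X Y X' Y' (f ^+ 2) X X').
Local Notation V' f := (shrink' X Y X' Y' (f ^+ 2) Y Y').

Lemma continuous_shrink_norm_inv (T : topologicalType) (f t : T -> R) :
  continuous f -> continuous t -> continuous (fun z => (N (f z) (t z))^-1).
Proof.
move=> cf ct.
have cXt := @continuous_composite T _ _ X _ cX ct.
have cYt := @continuous_composite T _ _ Y _ cY ct.
have c : continuous (fun z => 1 + f z * f z * (X (t z) * X (t z) + Y (t z) * Y (t z))).
  by continuity_rules ltac:(first [exact cf|exact cXt|exact cYt]).
have cN : continuous (fun z => N (f z) (t z)).
  have -> : (fun z => N (f z) (t z)) = fun z =>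
      Num.sqrt (1 + f z * f z * (X (t z) * X (t z) + Y (t z) * Y (t z))).
    by apply/funext => r; rewrite /shrink_norm !expr2.
  move=> z; apply: (@continuous_comp _ _ _
    (fun z => 1 + f z * f z * (X (t z) * X (t z) + Y (t z) * Y (t z))) Num.sqrt);
    [exact: c|exact: sqrt_continuous].
move=> z; apply: (@continuousV _ _ (fun z => N (f z) (t z))); last exact: cN.
by rewrite lt0r_neq0 // shrink_norm_gt0 // sqr_ge0.
Qed.

Lemma continuous_shrink_joint (T : topologicalType) (Z : R -> R) (f t : T -> R) :
  continuous Z -> continuous f -> continuous t ->
  continuous (fun z => shrink X Y (f z ^+ 2) Z (t z)).
Proof.
move=> cZ cf ct; have cI := continuous_shrink_norm_inv cf ct.
have cZt := @continuous_composite T _ _ Z _ cZ ct.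
by rewrite /shrink; continuity_rules ltac:(first [exact cZt|exact cI]).
Qed.

Lemma continuous_shrink'_joint (T : topologicalType) (Z Z' : R -> R) (f t : T -> R) :
  continuous Z -> continuous Z' -> continuous f -> continuous t ->
  continuous (fun z => shrink' X Y X' Y' (f z ^+ 2) Z Z' (t z)).
Proof.
move=> cZ cZ' cf ct; have cI := continuous_shrink_norm_inv cf ct.
have cZt := @continuous_composite T _ _ Z _ cZ ct.
have cZ't := @continuous_composite T _ _ Z' _ cZ' ct.
have cXt := @continuous_composite T _ _ X _ cX ct.
have cYt := @continuous_composite T _ _ Y _ cY ct.
have cX't := @continuous_composite T _ _ X' _ cX' ct.
have cY't := @continuous_composite T _ _ Y' _ cY' ct.
have -> : (fun z => shrink' X Y X' Y' (f z ^+ 2) Z Z' (t z)) = fun z =>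
    Z' (t z) * (N (f z) (t z))^-1 - Z (t z) *
      (f z * f z * (X (t z) * X' (t z) + Y (t z) * Y' (t z))) *
      ((N (f z) (t z))^-1 * ((N (f z) (t z))^-1 * (N (f z) (t z))^-1)).
  by apply/funext => z; rewrite /shrink' -!invfM -!expr2 -exprS.
by continuity_rules ltac:(first [exact cI|exact cf|exact cZt|exact cZ't|exact cXt
  |exact cYt|exact cX't|exact cY't]).
Qed.

(** The correction to the velocity is radial, so the cross product of position and velocity is
    merely divided by the square of the norm and stays positive. *)
Lemma shrink_speed f t : 0 < U' f t ^+ 2 + V' f t ^+ 2.
Proof.
have W := wc_origin wc t; have n0 := shrink_norm_gt0 X Y t (sqr_ge0 f).
have : 0 < cross (U f t) (V f t) (U' f t) (V' f t).
  rewrite /shrink /shrink'; have n1 := lt0r_neq0 n0.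
  set e := _ * (_ + _).
  have -> : cross (X t / N f t) (Y t / N f t)
     (X' t / N f t - X t * e / N f t ^+ 3) (Y' t / N f t - Y t * e / N f t ^+ 3) =
     cross (X t) (Y t) (X' t) (Y' t) / N f t ^+ 2.
    by move: n1; move: (N f t) => m m0; rewrite /cross; field.
  by rewrite divr_gt0 // exprn_gt0.
move=> h; rewrite sqr_sum_neq0 -negb_and; apply/negP => /andP[/eqP u0 /eqP v0].
by move: h; rewrite u0 v0 /cross !mulr0 subrr ltxx.
Qed.

(** Equal images come from proportional points, with the ratio [l] of their norms; comparing the
    squares of the norms forces [l ^+ 2 = 1]. *)
Lemma shrink_coincide f t s : U f t = U f s -> V f t = V f s ->
  X t = X s /\ Y t = Y s.
Proof.
have n0 := shrink_norm_gt0 X Y t (sqr_ge0 f).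
have m0 := shrink_norm_gt0 X Y s (sqr_ge0 f).
have n2 := shrink_norm_sqr X Y t (sqr_ge0 f).
have m2 := shrink_norm_sqr X Y s (sqr_ge0 f).
rewrite /shrink; move: n0 m0 n2 m2; move: (N f t) (N f s) => n m n0 m0 n2 m2 EX EY.
pose l := n / m.
have l0 : 0 < l by rewrite divr_gt0.
have nE : n = l * m by rewrite divfK // lt0r_neq0.
have FX : X t = l * X s.
  by rewrite -[LHS](divfK (lt0r_neq0 n0)) EX /l; field; rewrite lt0r_neq0.
have FY : Y t = l * Y s.
  by rewrite -[LHS](divfK (lt0r_neq0 n0)) EY /l; field; rewrite lt0r_neq0.
have : l ^+ 2 = 1.
  have : n ^+ 2 = l ^+ 2 * m ^+ 2 by rewrite nE exprMn.
  by rewrite n2 m2 FX FY => h; move: h; rewrite !exprMn; lra.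
move=> l2; have l1 : l = 1.
  by apply/eqP; rewrite -(eqrXn2 (ltn0Sn 1)) ?expr1n ?l2 // ltW.
by rewrite FX FY l1 !mul1r.
Qed.

(** Parameters range over two periods, so a point may have several of them; [d] is one of 0, [L],
    [- L], [L + L], [- L - L]. *)
Lemma coincide_period t s : 0 <= t <= L + L -> 0 <= s <= L + L ->
  X t = X s -> Y t = Y s ->
  exists d, s = t + d /\ forall x, X (x + d) = X x /\ Y (x + d) = Y x.
Proof.
have pX := wc_pX wc; have pY := wc_pY wc; have L0 := wc_period wc.
have main u v : 0 <= u -> u <= v -> v <= L + L -> X u = X v -> Y u = Y v ->
    [\/ v = u, v = u + L | v = u + L + L].
  move=> u0 uv vL EX EY.
  have no w : u < w < u + L -> X w = X u -> Y w = Y u -> False.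
    by move=> uw E1 E2; case: (wc_inj wc uw); rewrite ?E1 ?E2 eqxx.
  move: uv; rewrite le_eqVlt => /predU1P[->|uv]; first by constructor 1.
  have [vu|] := ltP v (u + L); first by case: (no v) => //; rewrite uv vu.
  rewrite le_eqVlt => /predU1P[->|uv2]; first by constructor 2.
  have [vu|] := ltP v (u + L + L); last by move=> ?; constructor 3; lra.
  case: (no (v - L)).
  - by apply/andP; split; lra.
  - by rewrite EX -{2}(subrK L v) pX.
  - by rewrite EY -{2}(subrK L v) pY.
have per x : [/\ X (x - L) = X x, Y (x - L) = Y x, X (x - L - L) = X x & Y (x - L - L) = Y x].
  have hX z : X (z - L) = X z by rewrite -{2}(subrK L z) pX.
  have hY z : Y (z - L) = Y z by rewrite -{2}(subrK L z) pY.
  by rewrite !hX !hY.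
move=> /andP[t0 tL] /andP[s0 sL] EX EY.
have [ts|st] := leP t s.
  case: (main t s t0 ts sL EX EY) => ->.
  - by exists 0; rewrite addr0; split => // x; rewrite addr0.
  - by exists L; split => // x; rewrite pX pY.
  - by exists (L + L); rewrite addrA; split => // x; rewrite addrA !pX !pY.
case: (main s t s0 (ltW st) tL (esym EX) (esym EY)) => E.
- by exists 0; rewrite addr0; split => // x; rewrite addr0.
- exists (- L); split; first by lra.
  by move=> x; have [-> -> _ _] := per x.
- exists (- L - L); split; first by lra.
  by move=> x; rewrite addrA; have [_ _ -> ->] := per x.
Qed.

(** The squared sine of the angle at the point [t1] is at most [kap], multiplied out so as to make
    sense for coinciding points. *)
Definition flat_at (kap f t1 t2 t3 : R) : Prop :=
  cross (U f t2 - U f t1) (V f t2 - V f t1) (U f t3 - U f t1) (V f t3 - V f t1) ^+ 2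
  <= kap * ((U f t2 - U f t1) ^+ 2 + (V f t2 - V f t1) ^+ 2)
     * ((U f t3 - U f t1) ^+ 2 + (V f t3 - V f t1) ^+ 2).

Lemma mean_value_ball (g g' : R -> R) (t0 del r s : R) :
  (forall t : R, is_derive t 1 g (g' t)) -> `|r - t0| < del -> `|s - t0| < del ->
  exists2 x, `|x - t0| < del & g s - g r = g' x * (s - r).
Proof.
move=> dg; rewrite !ltr_distl => /andP[r1 r2] /andP[s1 s2].
have [rs|sr|->] := ltgtP r s.
- have [c /andP[c1 c2] ->] := mean_value dg rs; exists c => //.
  by rewrite ltr_distl; apply/andP; split; lra.
- have [c /andP[c1 c2] E] := mean_value dg sr; exists c.
    by rewrite ltr_distl; apply/andP; split; lra.
  by rewrite -opprB E; ring.
- by exists s; [rewrite ltr_distl s1 s2|rewrite !subrr mulr0].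
Qed.

(** By the mean value theorem the chords from [t1] are multiples of vectors of derivatives near
    [t0]. All these vectors are close to the nonzero velocity at [t0], so they are nearly
    parallel. *)
Lemma flat_local kap f0 t0 : 0 < kap -> exists2 del, 0 < del &
  forall f t1 t2 t3, `|f - f0| < del -> `|t1 - t0| < del -> `|t2 - t0| < del ->
    `|t3 - t0| < del -> flat_at kap f t1 t2 t3.
Proof.
move=> kap0.
(* The two coordinates of a chord have separate intermediate points, hence four time variables
   besides [f]. On the diagonal the cross product vanishes and [kap] times the fourth power of the
   speed remains. *)
pose H (z : R * R * R * R * R) :=
  kap * (U' z.1.1.1.1 z.1.1.1.2 * U' z.1.1.1.1 z.1.1.1.2
      + V' z.1.1.1.1 z.1.1.2 * V' z.1.1.1.1 z.1.1.2)
   * (U' z.1.1.1.1 z.1.2 * U' z.1.1.1.1 z.1.2 + V' z.1.1.1.1 z.2 * V' z.1.1.1.1 z.2)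
  - cross (U' z.1.1.1.1 z.1.1.1.2) (V' z.1.1.1.1 z.1.1.2)
      (U' z.1.1.1.1 z.1.2) (V' z.1.1.1.1 z.2)
    * cross (U' z.1.1.1.1 z.1.1.1.2) (V' z.1.1.1.1 z.1.1.2)
      (U' z.1.1.1.1 z.1.2) (V' z.1.1.1.1 z.2).
have cH : continuous H.
  have c1 : continuous (fun z : R * R * R * R * R => z.1.1.1.1) by continuity_rules fail.
  have c2 : continuous (fun z : R * R * R * R * R => z.1.1.1.2) by continuity_rules fail.
  have c3 : continuous (fun z : R * R * R * R * R => z.1.1.2) by continuity_rules fail.
  have c4 : continuous (fun z : R * R * R * R * R => z.1.2) by continuity_rules fail.
  have c5 : continuous (fun z : R * R * R * R * R => z.2) by continuity_rules fail.
  have e1 := continuous_shrink'_joint cX cX' c1 c2.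
  have e2 := continuous_shrink'_joint cY cY' c1 c3.
  have e3 := continuous_shrink'_joint cX cX' c1 c4.
  have e4 := continuous_shrink'_joint cY cY' c1 c5.
  by rewrite /H /cross; continuity_rules ltac:(first [exact e1|exact e2|exact e3|exact e4]).
have H0 : 0 < H (f0, t0, t0, t0, t0).
  rewrite /H /= -!expr2; have sp := shrink_speed f0 t0.
  have -> : cross (U' f0 t0) (V' f0 t0) (U' f0 t0) (V' f0 t0) = 0.
    by rewrite /cross; ring.
  by rewrite expr0n /= subr0 !mulr_gt0.
have : \forall z \near (f0, t0, t0, t0, t0), 0 < H z.
  have /cvgrPdist_lt/(_ _ H0) := cH (f0, t0, t0, t0, t0).
  by apply: filterS => z; rewrite ltr_norml => /andP[_]; lra.
move=> /nbhs_ballP[del /= del0 Hd]; exists del => // f t1 t2 t3 hf h1 h2 h3.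
have e0 := sqr_ge0 f.
have dU (t : R) : is_derive t 1 (U f) (U' f t) by exact: is_derive_shrink.
have dV (t : R) : is_derive t 1 (V f) (V' f t) by exact: is_derive_shrink.
have [x2 hx2 EU2] := mean_value_ball dU h1 h2.
have [y2 hy2 EV2] := mean_value_ball dV h1 h2.
have [x3 hx3 EU3] := mean_value_ball dU h1 h3.
have [y3 hy3 EV3] := mean_value_ball dV h1 h3.
have : 0 < H (f, x2, y2, x3, y3).
  by apply: Hd; do ?[split]; rewrite /ball /= distrC.
rewrite /H /= /flat_at EU2 EV2 EU3 EV3 => /ltW.
move: (U' f x2) (V' f y2) (U' f x3) (V' f y3) (t2 - t1) (t3 - t1) => a b c d u v h.
rewrite -subr_ge0.
have -> : kap * ((a * u) ^+ 2 + (b * u) ^+ 2) * ((c * v) ^+ 2 + (d * v) ^+ 2)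
  - cross (a * u) (b * u) (c * v) (d * v) ^+ 2 =
  (u * v) ^+ 2 * (kap * (a * a + b * b) * (c * c + d * d) -
    cross a b c d * cross a b c d) by rewrite /cross; ring.
by rewrite mulr_ge0 ?sqr_ge0.
Qed.

(** Where the squared distances sum to zero the three points coincide, so [flat_local], applied up
    to periods, gives a neighbourhood of flat triples. Off the interior of the flat triples the sum
    is positive, and compactness bounds it from below. *)
Lemma flat_uniform kap : 0 < kap -> exists2 m, 0 < m &
  forall f t1 t2 t3, 0 <= f <= 1 -> 0 <= t1 <= L + L -> 0 <= t2 <= L + L ->
    0 <= t3 <= L + L ->
    (U f t2 - U f t1) ^+ 2 + (V f t2 - V f t1) ^+ 2 +
    ((U f t3 - U f t1) ^+ 2 + (V f t3 - V f t1) ^+ 2) < m ->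
    flat_at kap f t1 t2 t3.
Proof.
move=> kap0; pose G (z : R * R * R * R) := flat_at kap z.1.1.1 z.1.1.2 z.1.2 z.2.
pose W := interior G.
pose seg (u v : R) : set R := `[u, v]%classic.
pose box : set (R * R * R * R) :=
  seg 0 1 `*` seg 0 (L + L) `*` seg 0 (L + L) `*` seg 0 (L + L).
have cbox : compact box by do ?apply: compact_setX; exact: segment_compact.
pose S := box `&` ~` W.
have cS : compact S.
  rewrite /S; apply: compact_closedI => //.
  exact: open_closedC (open_interior G).
pose F (z : R * R * R * R) :=
  (U z.1.1.1 z.1.2 - U z.1.1.1 z.1.1.2) * (U z.1.1.1 z.1.2 - U z.1.1.1 z.1.1.2)
  + (V z.1.1.1 z.1.2 - V z.1.1.1 z.1.1.2) * (V z.1.1.1 z.1.2 - V z.1.1.1 z.1.1.2)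
  + ((U z.1.1.1 z.2 - U z.1.1.1 z.1.1.2) * (U z.1.1.1 z.2 - U z.1.1.1 z.1.1.2)
  + (V z.1.1.1 z.2 - V z.1.1.1 z.1.1.2) * (V z.1.1.1 z.2 - V z.1.1.1 z.1.1.2)).
have cF : continuous F.
  have c1 : continuous (fun z : R * R * R * R => z.1.1.1) by continuity_rules fail.
  have c2 : continuous (fun z : R * R * R * R => z.1.1.2) by continuity_rules fail.
  have c3 : continuous (fun z : R * R * R * R => z.1.2) by continuity_rules fail.
  have c4 : continuous (fun z : R * R * R * R => z.2) by continuity_rules fail.
  have e1 := continuous_shrink_joint cX c1 c2.
  have e2 := continuous_shrink_joint cY c1 c2.
  have e3 := continuous_shrink_joint cX c1 c3.
  have e4 := continuous_shrink_joint cY c1 c3.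
  have e5 := continuous_shrink_joint cX c1 c4.
  have e6 := continuous_shrink_joint cY c1 c4.
  by rewrite /F; continuity_rules ltac:(first [exact e1|exact e2|exact e3|exact e4
    |exact e5|exact e6]).
have Fpos z : S z -> 0 < F z.
  move=> [zbox nW]; rewrite lt_neqAle; apply/andP; split; last first.
    by rewrite /F -!expr2 !addr_ge0 // sqr_ge0.
  apply/eqP => F0; apply: nW; move: zbox F0.
  case: z => [[[f t1] t2] t3]; rewrite /box /seg /F /= !in_itv /=.
  move=> [[[_ b1] b2] b3] /esym/eqP.
  rewrite -!expr2 paddr_eq0 ?addr_ge0 ?sqr_ge0 // !paddr_eq0 ?sqr_ge0 // !sqrf_eq0 !subr_eq0.
  move=> /andP[/andP[/eqP u2 /eqP v2] /andP[/eqP u3 /eqP v3]].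
  have [x2 y2] := shrink_coincide (esym u2) (esym v2).
  have [x3 y3] := shrink_coincide (esym u3) (esym v3).
  have [d2 [E2 P2]] := coincide_period b1 b2 x2 y2.
  have [d3 [E3 P3]] := coincide_period b1 b3 x3 y3.
  have [del del0 Hd] := flat_local f t1 kap0.
  apply/nbhs_ballP; exists del => //= -[[[g s1] s2] s3] [[[/= hg h1] h2] h3].
  move: hg h1 h2 h3; rewrite /ball /= => hg h1 h2 h3.
  have per d x : (forall x, X (x + d) = X x /\ Y (x + d) = Y x) ->
      U g (x - d) = U g x /\ V g (x - d) = V g x.
    move=> Pd; have [p1 p2] := Pd (x - d); rewrite subrK in p1 p2.
    by rewrite /shrink /shrink_norm p1 p2.
  have := Hd g s1 (s2 - d2) (s3 - d3); rewrite /G /flat_at /=.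
  have [-> ->] := per d2 s2 P2; have [-> ->] := per d3 s3 P3; apply.
  - by rewrite distrC.
  - by rewrite distrC.
  - by rewrite distrC opprB addrA -E2.
  - by rewrite distrC opprB addrA -E3.
have [S0|S0] := pselect (S !=set0).
  have [z zS zm] := compact_EVT_min S0 cS (continuous_subspaceT cF).
  rewrite inE in zS; exists (F z); first exact: Fpos.
  move=> f t1 t2 t3 hf h1 h2 h3; rewrite ltNge => /negP hm.
  have [//|nG] := pselect (flat_at kap f t1 t2 t3).
  exfalso; apply: hm; rewrite !expr2.
  have := zm (f, t1, t2, t3); apply; rewrite inE; split.
    by rewrite /box /seg /= !in_itv /=.
  by move=> /interior_subset.
exists 1 => // f t1 t2 t3 hf h1 h2 h3 _.
have [//|nG] := pselect (flat_at kap f t1 t2 t3).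
exfalso; apply: S0; exists (f, t1, t2, t3); split.
  by rewrite /box /seg /= !in_itv /=.
by move=> /interior_subset.
Qed.

End Limit.

Lemma shrink0 (R : realType) (X Y Z : R -> R) : shrink X Y (0 ^+ 2) Z = Z.
Proof.
by apply/funext => t; rewrite /shrink /shrink_norm expr0n mul0r addr0 sqrtr1 divr1.
Qed.

(** When the two sides are parallel, moving [t4] by a small [h] turns one of them by [h / 2], and
    the sine becomes that of [h / 2] up to sign. *)
Lemma small_perturbation (R : realType) (t1 t2 t3 t4 eps : R) :
  t3 < t4 < t1 + 2 * pi -> 0 < eps ->
  exists f t : R, [/\ 0 < f <= 1, t4 <= t <= t4 + 1, t < t1 + 2 * pi,
    f * f + (t - t4) * (t - t4) < eps & sin ((t3 + t) / 2 - (t1 + t2) / 2) != 0].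
Proof.
move=> /andP[t34 t41] e0.
(* Numbers in [[0, 1]] dominate their squares, so with [h <= f] the sum of the two squares is at
   most [eps / 2]. *)
pose f := Num.min 1 (eps / 4).
have f0 : 0 < f by rewrite lt_min ltr01 divr_gt0.
have f1 : f <= 1 by rewrite ge_min lexx.
have fe : f <= eps / 4 by rewrite ge_min lexx orbT.
have ff : f * f <= f by rewrite ler_piMr // ltW.
exists f; have [s0|s0] := eqVneq (sin ((t3 + t4) / 2 - (t1 + t2) / 2)) 0; last first.
  exists t4; split => //; [by rewrite f0 f1|by apply/andP; split; lra|].
  by rewrite subrr mul0r; lra.
have p0 := @pi_gt0 R; have p2 := @pi_ge2 R.
pose h := Num.min f ((t1 + 2 * pi - t4) / 2).
have h0 : 0 < h by rewrite lt_min f0 divr_gt0 // subr_gt0.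
have hf : h <= f by rewrite ge_min lexx.
have ht : h <= (t1 + 2 * pi - t4) / 2 by rewrite ge_min lexx orbT.
have hh : h * h <= h by rewrite ler_piMr ?(ltW h0) // (le_trans hf).
exists (t4 + h); split.
- by rewrite f0 f1.
- by apply/andP; split; lra.
- by lra.
- have -> : t4 + h - t4 = h by ring.
  by lra.
have -> : (t3 + (t4 + h)) / 2 - (t1 + t2) / 2 = (t3 + t4) / 2 - (t1 + t2) / 2 + h / 2.
  by field.
rewrite sinD s0 mul0r add0r mulf_neq0 //.
  by apply/eqP => c0; have := cos2Dsin2 ((t3 + t4) / 2 - (t1 + t2) / 2 : R);
    rewrite s0 c0 !expr0n addr0 => /eqP; rewrite eq_sym oner_eq0.
by rewrite lt0r_neq0 // sin_gt0_pi //; apply/andP; split; lra.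
Qed.

Lemma similar_of_residual (R : realType) (X Y : R -> R) (zx zy t1 s a1 a : R) :
  X a - X a1 - (zx * (cos s - cos t1) - zy * (sin s - sin t1)) = 0 ->
  Y a - Y a1 - (zx * (sin s - sin t1) + zy * (cos s - cos t1)) = 0 ->
  similar_at X Y zx zy (X a1 - (zx * cos t1 - zy * sin t1))
    (Y a1 - (zx * sin t1 + zy * cos t1)) s a.
Proof.
move=> /eqP; rewrite subr_eq0 => /eqP EX /eqP; rewrite subr_eq0 => /eqP EY.
by split; [rewrite -(subrK (X a1) (X a)) EX|rewrite -(subrK (Y a1) (Y a)) EY]; ring.
Qed.

Section WeakInscribed.
Context (R : realType) (X Y X' Y' : R -> R) (L : R).
Hypothesis wc : weak_curve X Y X' Y' L.

Let dX := wc_dX wc.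
Let dY := wc_dY wc.
Let cX : continuous X. Proof. exact: is_derive_fun_continuous dX. Qed.
Let cY : continuous Y. Proof. exact: is_derive_fun_continuous dY. Qed.

Local Notation U f := (shrink X Y (f ^+ 2) X).
Local Notation V f := (shrink X Y (f ^+ 2) Y).

Lemma similar_diff (Z W : R -> R) zx zy bx by_ t s a b :
  similar_at Z W zx zy bx by_ t a -> similar_at Z W zx zy bx by_ s b ->
  Z b - Z a = zx * (cos s - cos t) - zy * (sin s - sin t) /\
  W b - W a = zx * (sin s - sin t) + zy * (cos s - cos t).
Proof. by move=> [-> ->] [-> ->]; split; ring. Qed.

(** A similarity keeps the angle at the first point, with squared sine [D ^+ 2 / (g2 * g3)]. A very
    small copy would be flat with half of this value as [kap], which is absurd. *)
Lemma similar_scale_lower (t1 t2 t3 : R) : t1 < t2 < t3 -> t3 < t1 + 2 * pi ->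
  exists2 mu : R, 0 < mu & forall f zx zy bx by_ a1 a2 a3 : R,
    0 <= f <= 1 -> 0 <= a1 <= L + L -> 0 <= a2 <= L + L -> 0 <= a3 <= L + L ->
    0 < zx ^+ 2 + zy ^+ 2 -> similar_at (U f) (V f) zx zy bx by_ t1 a1 ->
    similar_at (U f) (V f) zx zy bx by_ t2 a2 ->
    similar_at (U f) (V f) zx zy bx by_ t3 a3 -> mu <= zx ^+ 2 + zy ^+ 2.
Proof.
move=> t123 t31; have := counterclockwise_cross t123 t31.
set x := cos t2 - cos t1; set y := sin t2 - sin t1.
set u := cos t3 - cos t1; set v := sin t3 - sin t1 => D0.
pose g2 := x ^+ 2 + y ^+ 2; pose g3 := u ^+ 2 + v ^+ 2.
have g20 : 0 < g2.
  rewrite /g2 sqr_sum_neq0 -negb_and; apply/negP => /andP[/eqP x0 /eqP y0].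
  by move: D0; rewrite x0 y0 /cross !mul0r subrr ltxx.
have g30 : 0 < g3.
  rewrite /g3 sqr_sum_neq0 -negb_and; apply/negP => /andP[/eqP x0 /eqP y0].
  by move: D0; rewrite x0 y0 /cross !mulr0 subrr ltxx.
set D := cross x y u v in D0.
have [|m m0 flat] := @flat_uniform _ _ _ _ _ _ wc (D ^+ 2 / (2 * g2 * g3)).
  by rewrite divr_gt0 ?exprn_gt0 // !mulr_gt0.
exists (m / (g2 + g3)); first by rewrite divr_gt0 // addr_gt0.
move=> f zx zy bx by_ a1 a2 a3 hf h1 h2 h3 n0 s1 s2 s3.
have gg : 0 < g2 + g3 by rewrite addr_gt0.
rewrite ler_pdivrMr //. rewrite leNgt; apply/negP => nm.
have [E1 E2] := similar_diff s1 s2; have [E3 E4] := similar_diff s1 s3.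
have := flat f a1 a2 a3 hf h1 h2 h3; rewrite /flat_at E1 E2 E3 E4 -/x -/y -/u -/v.
set n := zx ^+ 2 + zy ^+ 2 in n0 nm.
have -> : (zx * x - zy * y) ^+ 2 + (zx * y + zy * x) ^+ 2 = n * g2 by rewrite /n /g2; ring.
have -> : (zx * u - zy * v) ^+ 2 + (zx * v + zy * u) ^+ 2 = n * g3 by rewrite /n /g3; ring.
have -> : cross (zx * x - zy * y) (zx * y + zy * x) (zx * u - zy * v) (zx * v + zy * u)
  = n * D by rewrite /n /D /cross; ring.
rewrite -mulrDr => /(_ nm); apply/negP; rewrite -ltNge.
have -> : D ^+ 2 / (2 * g2 * g3) * (n * g2) * (n * g3) = (n * D) ^+ 2 / 2.
  by field; rewrite !lt0r_neq0.
have : 0 < (n * D) ^+ 2 by rewrite exprn_gt0 // mulr_gt0.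
by lra.
Qed.

(** Shrinking does not increase the distance to the origin, so one disc, of squared radius [K],
    contains all the shrunk curves, and squared chords are at most [4 * K]. *)
Lemma similar_scale_upper (t1 t2 : R) : t1 < t2 < t1 + 2 * pi ->
  exists M : R, forall f zx zy bx by_ a1 a2 : R,
    0 <= a1 <= L + L -> 0 <= a2 <= L + L ->
    similar_at (U f) (V f) zx zy bx by_ t1 a1 ->
    similar_at (U f) (V f) zx zy bx by_ t2 a2 -> zx ^+ 2 + zy ^+ 2 <= M.
Proof.
move=> /andP[t12 t21].
have L0 := wc_period wc.
have LL : 0 <= L + L by lra.
have cW : continuous (fun t => X t * X t + Y t * Y t).
  by continuity_rules ltac:(first [exact cX|exact cY]).
have [c _ cm] := @EVT_max R (fun t => X t * X t + Y t * Y t) 0 (L + L) LL (continuous_seg cW).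
set K := X c * X c + Y c * Y c in cm.
have bound f a : 0 <= a <= L + L -> U f a ^+ 2 + V f a ^+ 2 <= K.
  move=> ha; have := cm a; rewrite in_itv /= => /(_ ha) aK; apply: le_trans aK.
  rewrite /shrink; have n1 := shrink_norm_ge1 X Y a (sqr_ge0 f).
  move: (shrink_norm X Y (f ^+ 2) a) n1 => n n1.
  have n0 : 0 < n by apply: lt_le_trans n1.
  have i0 : 0 < n^-1 by rewrite invr_gt0.
  have i1 : n^-1 <= 1 by rewrite invf_le1.
  rewrite !exprMn -mulrDl -!expr2 ler_piMr ?addr_ge0 ?sqr_ge0 //.
  by rewrite expr_le1 // ltW.
pose g := (cos t2 - cos t1) ^+ 2 + (sin t2 - sin t1) ^+ 2.
have g0 : 0 < g.
  have D0 := @counterclockwise_cross R t1 t2 ((t2 + (t1 + 2 * pi)) / 2).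
  have {}D0 := D0 ltac:(apply/andP; split; lra) ltac:(lra).
  rewrite /g sqr_sum_neq0 -negb_and; apply/negP => /andP[/eqP x0 /eqP y0].
  by move: D0; rewrite x0 y0 /cross !mul0r subrr ltxx.
exists (4 * K / g) => f zx zy bx by_ a1 a2 h1 h2 s1 s2.
have [E1 E2] := similar_diff s1 s2.
rewrite ler_pdivlMr //.
have -> : (zx ^+ 2 + zy ^+ 2) * g = (U f a2 - U f a1) ^+ 2 + (V f a2 - V f a1) ^+ 2.
  by rewrite E1 E2 /g; ring.
have := bound f a1 h1; have := bound f a2 h2.
move: (U f a1) (V f a1) (U f a2) (V f a2) => p q r s b1 b2.
have := sqr_ge0 (p + r); have := sqr_ge0 (q + s); move: b1 b2.
by rewrite !expr2; lra.
Qed.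

(** [F] measures how far a tuple is from an exact solution on the original curve with the original
    angle [t4]. Nearby strictly convex problems make it arbitrarily small on a compact set, so its
    minimum there is zero. *)
Theorem weak_inscribed (t1 t2 t3 t4 : R) :
  [/\ t1 < t2, t2 < t3, t3 < t4 & t4 < t1 + 2 * pi] ->
  exists zx zy bx by_ a b c d : R,
  [/\ (0 < zx ^+ 2 + zy ^+ 2),
    similar_at X Y zx zy bx by_ t1 a /\ similar_at X Y zx zy bx by_ t2 b &
    similar_at X Y zx zy bx by_ t3 c /\ similar_at X Y zx zy bx by_ t4 d].
Proof.
move=> [t12 t23 t34 t41].
have [||mu mu0 lower] := @similar_scale_lower t1 t2 t3.
- by rewrite t12 t23.
- by lra.
have [|M upper] := @similar_scale_upper t1 t2; first by apply/andP; split; lra.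
pose B := `|M| + 1.
have bnd x y : x ^+ 2 + y ^+ 2 <= M -> (- B <= x <= B) && (- B <= y <= B).
  move=> h; have hM := ler_norm M; have M0 := normr_ge0 M.
  have bb w : w ^+ 2 <= M -> -B <= w <= B.
    by move=> hw; apply/andP; split; rewrite /B; nra.
  by rewrite !bb //; have := sqr_ge0 x; have := sqr_ge0 y; lra.
pose R8 := (R * R * R * R * R * R * R * R)%type.
pose f (z : R8) := z.1.1.1.1.1.1.1.
pose t (z : R8) := z.1.1.1.1.1.1.2.
pose x (z : R8) := z.1.1.1.1.1.2.
pose y (z : R8) := z.1.1.1.1.2.
pose a1 (z : R8) := z.1.1.1.2.
pose a2 (z : R8) := z.1.1.2.
pose a3 (z : R8) := z.1.2.
pose a4 (z : R8) := z.2.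
have cf : continuous f by rewrite /f; continuity_rules fail.
have ct : continuous t by rewrite /t; continuity_rules fail.
have cx : continuous x by rewrite /x; continuity_rules fail.
have cy : continuous y by rewrite /y; continuity_rules fail.
have c1 : continuous a1 by rewrite /a1; continuity_rules fail.
have c2 : continuous a2 by rewrite /a2; continuity_rules fail.
have c3 : continuous a3 by rewrite /a3; continuity_rules fail.
have c4 : continuous a4 by rewrite /a4; continuity_rules fail.
pose seg (u v : R) : set R := `[u, v]%classic.
pose box : set R8 := seg 0 1 `*` seg t4 (t4 + 1) `*` seg (- B) B `*` seg (- B) B
  `*` seg 0 (L + L) `*` seg 0 (L + L) `*` seg 0 (L + L) `*` seg 0 (L + L).
have cbox : compact box by do ?apply: compact_setX; exact: segment_compact.
(* The lower bound on the squared scale is part of the compact set, so the limit cannot collapse to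
   a point. *)
pose S := box `&` [set z | mu - (x z * x z + y z * y z) <= 0].
have cS : compact S.
  apply: compact_closedI => //; apply: closed_le0.
  by continuity_rules ltac:(first [exact cx|exact cy]).
pose ru a s z := U (f z) (a z) - U (f z) (a1 z)
  - (x z * (cos (s z) - cos t1) - y z * (sin (s z) - sin t1)).
pose rv a s z := V (f z) (a z) - V (f z) (a1 z)
  - (x z * (sin (s z) - sin t1) + y z * (cos (s z) - cos t1)).
pose r a s z := ru a s z * ru a s z + rv a s z * rv a s z.
have cr a s : continuous a -> continuous s -> continuous (r a s).
  move=> ca cs.
  have cu := continuous_shrink_joint wc cX cf ca.
  have cv := continuous_shrink_joint wc cY cf ca.
  have cu1 := continuous_shrink_joint wc cX cf c1.
  have cv1 := continuous_shrink_joint wc cY cf c1.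
  have ccos := continuous_composite (@continuous_cos R) cs.
  have csin := continuous_composite (@continuous_sin R) cs.
  have cru : continuous (ru a s).
    by rewrite /ru; continuity_rules ltac:(first [exact cu|exact cu1|exact cx|exact cy
      |exact ccos|exact csin]).
  have crv : continuous (rv a s).
    by rewrite /rv; continuity_rules ltac:(first [exact cv|exact cv1|exact cx|exact cy
      |exact ccos|exact csin]).
  by rewrite /r; continuity_rules ltac:(first [exact cru|exact crv]).
(* The residuals [r] test the similarity relative to the point [a1], which eliminates the
   translation from the variables. *)
pose F z := f z * f z + (t z - t4) * (t z - t4)
  + (r a2 (fun=> t2) z + r a3 (fun=> t3) z + r a4 t z).
have cF : continuous F.
  have r2 := cr a2 _ c2 (@continuous_const _ _ t2).
  have r3 := cr a3 _ c3 (@continuous_const _ _ t3).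
  have r4 := cr a4 t c4 ct.
  by rewrite /F; continuity_rules ltac:(first [exact cf|exact ct|exact r2|exact r3|exact r4]).
have small eps : 0 < eps -> exists2 z, S z & F z < eps.
  move=> e0; have [|ff [tt [hf ht t1' small s0]]] := @small_perturbation R t1 t2 t3 t4 eps _ e0.
    by rewrite t34.
  have /andP[f0 f1] := hf; have /andP[ht1 ht2] := ht.
  have sc := shrink_strict wc (exprn_gt0 2 f0).
  have [|zx [zy [bx [by_ [b1 [b2 [b3 [b4 [n0 [h1 h2 h3 h4] [s1 s2] [s3 s4]]]]]]]]]] :=
    @strict_inscribed _ _ _ _ _ _ t1 t2 t3 tt sc _ s0.
    by split => //; lra.
  have f01 : 0 <= ff <= 1 by rewrite f1 ltW.
  have lo := lower ff _ _ _ _ _ _ _ f01 h1 h2 h3 n0 s1 s2 s3.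
  have /andP[ux uy] := bnd _ _ (upper ff _ _ _ _ _ _ h1 h2 s1 s2).
  exists (ff, tt, zx, zy, b1, b2, b3, b4).
    split; first by rewrite /box /seg /= !in_itv /=.
    by rewrite /= /x /y /= -!expr2; lra.
  have E a s z : similar_at (U (f z)) (V (f z)) (x z) (y z) bx by_ t1 (a1 z) ->
      similar_at (U (f z)) (V (f z)) (x z) (y z) bx by_ (s z) (a z) -> r a s z = 0.
    by move=> g1 g2; have [E1 E2] := similar_diff g1 g2; rewrite /r /ru /rv E1 E2;
      rewrite !subrr mul0r addr0.
  by rewrite /F !E // !addr0.
have S0 : S !=set0 by have [z zS _] := small 1 ltr01; exists z.
have [z zS zm] := compact_EVT_min S0 cS (continuous_subspaceT cF).
rewrite inE in zS.
have Fz : F z <= 0.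
  rewrite leNgt; apply/negP => /small[w wS]; apply/negP; rewrite -leNgt; apply: zm.
  by rewrite inE.
have r0 a s : 0 <= r a s z by rewrite addr_ge0 // -expr2 sqr_ge0.
have req a s : r a s z <= 0 -> ru a s z = 0 /\ rv a s z = 0.
  move=> h; have : r a s z == 0 by rewrite eq_le h r0.
  by rewrite /r -!expr2 paddr_eq0 ?sqr_ge0 // !sqrf_eq0 => /andP[/eqP ? /eqP].
have := r0 a2 (fun=> t2); have := r0 a3 (fun=> t3); have := r0 a4 t.
have q1 := sqr_ge0 (f z); have q2 := sqr_ge0 (t z - t4); rewrite !expr2 in q1 q2.
rewrite /F in Fz => p4 p3 p2.
have [|u2 v2] := req a2 (fun=> t2); first by lra.
have [|u3 v3] := req a3 (fun=> t3); first by lra.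
have [|u4 v4] := req a4 t; first by lra.
have f0 : f z = 0.
  by apply/eqP; rewrite -sqrf_eq0 expr2 eq_le q1 andbT; lra.
have tz : t z = t4.
  by apply/eqP; rewrite -subr_eq0 -sqrf_eq0 expr2 eq_le q2 andbT; lra.
case: zS => _ /=; rewrite -!expr2 subr_le0 => n0.
rewrite /ru /rv f0 !shrink0 in u2 v2 u3 v3 u4 v4; rewrite tz in u4 v4.
exists (x z), (y z), (X (a1 z) - (x z * cos t1 - y z * sin t1)),
  (Y (a1 z) - (x z * sin t1 + y z * cos t1)), (a1 z), (a2 z), (a3 z), (a4 z).
split; first exact: lt_le_trans n0.
  split; last exact: similar_of_residual.
  by apply: similar_of_residual; ring.
by split; exact: similar_of_residual.
Qed.

End WeakInscribed.

(** * Parametrization of convex curves *)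

(** The cross product of position and velocity is continuous without zeros, hence of constant sign;
    if it is negative, the curve runs clockwise and is traversed backwards. *)
Lemma weak_curve_or_reverse (R : realType) (X Y X' Y' : R -> R) (L : R) :
  0 < L -> (forall t : R, is_derive t 1 X (X' t)) ->
  (forall t : R, is_derive t 1 Y (Y' t)) -> continuous X' -> continuous Y' ->
  (forall t, X (t + L) = X t) -> (forall t, Y (t + L) = Y t) ->
  (forall t s, t < s < t + L -> X s != X t \/ Y s != Y t) ->
  (forall t, cross (X t) (Y t) (X' t) (Y' t) != 0) ->
  (forall t s, 0 <= cross (X t) (Y t) (X' t) (Y' t)
    * cross (X' t) (Y' t) (X s - X t) (Y s - Y t)) ->
  weak_curve X Y X' Y' L \/
  weak_curve (fun t => X (- t)) (fun t => Y (- t)) (fun t => - X' (- t))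
    (fun t => - Y' (- t)) L.
Proof.
move=> L0 dX dY cX' cY' pX pY inj tr turn.
have per (Z Z' : R -> R) (dZ : forall t : R, is_derive t 1 Z (Z' t)) :
    (forall t, Z (t + L) = Z t) -> forall t, Z' (t + L) = Z' t.
  move=> pZ t.
  have d1 := @is_derive_composite _ Z (fun t => t + L) t _ _
    (dZ (t + L)) (is_derive_add (is_derive_var t) (is_derive_const L t)).
  have E : (fun t => Z (t + L)) = Z by apply/funext.
  rewrite E addr0 mulr1 in d1.
  by rewrite -(@derive_val _ _ _ _ _ _ _ d1) (@derive_val _ _ _ _ _ _ _ (dZ t)).
have pX' := per X X' dX pX; have pY' := per Y Y' dY pY.
have cX := is_derive_fun_continuous dX; have cY := is_derive_fun_continuous dY.
pose w t := cross (X t) (Y t) (X' t) (Y' t).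
have cw : continuous w.
  by rewrite /w /cross; continuity_rules ltac:(first [exact cX|exact cY|exact cX'|exact cY']).
have [pos|] := pselect (forall t, 0 < w t).
  left; apply: Build_weak_curve => // t s.
  by rewrite -(pmulr_rge0 _ (pos t)); exact: turn.
move=> /existsNP[t0 /negP]; rewrite -leNgt => wt0.
have neg t : w t < 0.
  rewrite ltNge; apply/negP => wt.
  have [c wc] : exists c, w c = 0.
    have [le|le] := leP t0 t.
      by have [|c _ wc] := @intermediate_value _ w t0 t 0 cw le;
        [left; rewrite wt0 wt|exists c].
    by have [|c _ wc] := @intermediate_value _ w t t0 0 cw (ltW le);
      [right; rewrite wt0 wt|exists c].
  by have := tr c; rewrite -/(w c) wc eqxx.
have dN (Z Z' : R -> R) (dZ : forall t : R, is_derive t 1 Z (Z' t)) (t : R) :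
    is_derive t 1 (fun t => Z (- t)) (- Z' (- t)).
  have d := @is_derive_composite _ Z (fun t => - t) t _ _ (dZ (- t))
    (is_derive_opp (is_derive_var t)).
  by rewrite mulrN1 in d.
have cN (Z : R -> R) : continuous Z -> continuous (fun t => - Z (- t)).
  move=> cZ; apply: continuous_opp.
  exact: (continuous_composite cZ (continuous_opp (@continuous_ident R))).
have pN (Z : R -> R) : (forall t, Z (t + L) = Z t) -> forall t, Z (- (t + L)) = Z (- t).
  by move=> pZ t; rewrite -[LHS]pZ; congr Z; ring.
right; apply: Build_weak_curve => //.
- exact: (cN X' cX').
- exact: (cN Y' cY').
- exact: pN.
- exact: pN.
- by move=> t; rewrite pN.
- by move=> t; rewrite pN.
- move=> t s /andP[ts st]; rewrite eq_sym [Y _ == _]eq_sym; apply: inj.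
  by apply/andP; split; lra.
- move=> t; have := neg (- t); rewrite /w /cross; lra.
- move=> t s; have := turn (- t) (- s); rewrite nmulr_rge0 ?neg //.
  by rewrite /cross; lra.
Qed.

Lemma periodic_injective (R : realType) (V : zmodType) (c : R -> V) (L : R) :
  0 < L -> periodic c L -> {in `[0, L[ &, injective c} ->
  forall t s, t < s < t + L -> c s <> c t.
Proof.
move=> L0 pc inj t s /andP[ts st] E.
have pz (n : int) x : c (x + n%:~R * L) = c x.
  case: n => n; first by rewrite -pmulrn mulr_natl periodicn.
  rewrite NegzE mulrNz mulNr -pmulrn mulr_natl.
  by rewrite -(periodicn pc n.+1) subrK.
(* This translates [t] into [[0, L[]; then [s] lands below [2 L], so at most one more period has to
   be subtracted from it. *)
pose n := - Num.floor (t / L).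
have t0 : 0 <= t + n%:~R * L.
  rewrite /n mulrNz mulNr subr_ge0 -ler_pdivlMr //; exact: floor_le.
have tL : t + n%:~R * L < L.
  rewrite /n mulrNz mulNr ltrBlDr -[X in X + _]mul1r -mulrDl -ltr_pdivrMr //.
  by rewrite addrC; have := floorD1_gt (t / L); rewrite intrD.
have E' : c (s + n%:~R * L) = c (t + n%:~R * L) by rewrite !pz.
move: (n%:~R * L) t0 tL E' => d t0 tL E'.
have [sL|sL] := ltP (s + d) L.
  have := inj _ _ _ _ E'; rewrite !in_itv /= t0 tL sL => /(_ _ isT).
  by move=> /(_ ltac:(apply/andP; split; lra)); lra.
have E2 : c (s + d - L) = c (t + d) by rewrite -E' -[in RHS](subrK L (s + d)) pc.
have := inj _ _ _ _ E2; rewrite !in_itv /= t0 tL => /(_ _ isT).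
by move=> /(_ ltac:(apply/andP; split; lra)); lra.
Qed.

Lemma convex_set_comb (R : realType) (V : lmodType R) (K : set V) (x y : V) (s : R) :
  convex_set K -> K x -> K y -> 0 <= s <= 1 -> K (s *: x + (1 - s) *: y).
Proof.
move=> cK Kx Ky /andP[s0 s1].
have := cK x y (Itv01 s0 s1) (mem_set Kx) (mem_set Ky).
by rewrite inE.
Qed.

(** The homothety of centre [y] and ratio [s] carries a ball of radius [e] about [x] to the ball of
    radius [s * e] about the combination. *)
Lemma interior_convex_comb (R : realType) (V : normedModType R) (K : set V) (x y : V) (s : R) :
  convex_set K -> interior K x -> K y -> 0 < s <= 1 ->
  interior K (s *: x + (1 - s) *: y).
Proof.
move=> cK /nbhs_ballP[e /= e0 xe] Ky /andP[s0 s1].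
apply/nbhs_ballP; exists (s * e) => /=; first by rewrite mulr_gt0.
move=> z; rewrite -ball_normE /= => zs.
pose w := x + s^-1 *: (z - (s *: x + (1 - s) *: y)).
have -> : z = s *: w + (1 - s) *: y.
  by rewrite /w scalerDr scalerA divff ?gt_eqF // scale1r -addrA addrCA subrK.
apply: convex_set_comb => //; last by rewrite ltW.
apply: xe; rewrite -ball_normE /= /w opprD addrA subrr add0r normrN normrZ.
by rewrite gtr0_norm ?invr_gt0 // -ltr_pdivlMl ?invr_gt0 // invrK distrC.
Qed.

(* If [q = c t + k c'(t)] were interior then so would be [c t], which lies on a
   segment from [c (t + h)] to a point near [q], for small [h] of the sign of
   [- k]. *)
Lemma interior_off_tangent (R : realType) (V : normedModType R) (K : set V)
    (c : R -> V) (t k : R) (d : V) :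
  convex_set K -> (forall s, K (c s)) -> ~ interior K (c t) ->
  is_derive t 1 c d -> ~ interior K (c t + k *: d).
Proof.
move=> cK Kc nK [dc <-] Kq.
have [k0|k0] := eqVneq k 0; first by rewrite k0 scale0r addr0 in Kq.
have cv : (fun h : R => c t + k *: (h^-1 *: (c (h *: 1 + t) - c t))) h @[h --> 0^']
    --> c t + k *: 'D_1 c t.
  by apply: cvgD; [exact: cvg_cst|apply: cvgZr; exact: dc].
have := cv _ (nbhs_interior Kq); rewrite /= => /nbhs_ballP[e /= e0 he].
(* Then [|h| = e / 2] and [k / h = - 1 / r]: the interior point is [c t - (x - c t) / r] with
   [x = c (h + t)], and [c t] divides the segment from it to [x] with weights [r / (1 + r)] and
   [1 / (1 + r)]. *)
pose r := e / 2 / `|k|; pose h := - k * r.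
have r0 : 0 < r by rewrite !divr_gt0 // normr_gt0.
have h0 : h != 0 by rewrite mulf_neq0 ?oppr_eq0 // gt_eqF.
have := he h; rewrite /ball /= sub0r normrN.
have -> : `|h| = e / 2 by rewrite normrM normrN (gtr0_norm r0) mulrC divfK // normr_eq0.
rewrite ltr_pdivrMr // ltr_pMr // ltr1n => /(_ isT h0).
rewrite scalerA [h *: 1](mulr1 h).
have -> : k * h^-1 = - r^-1 by rewrite /h mulNr invrN invfM mulrN mulVKf.
rewrite scaleNr; set x := c (h + t) => Ko.
have s01 : 0 < r / (1 + r) <= 1.
  have r1 : 0 < 1 + r by rewrite addr_gt0.
  by rewrite divr_gt0 //= ler_pdivrMr // mul1r lerDr.
have := interior_convex_comb cK Ko (Kc (h + t)) s01; rewrite -/x.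
have -> : 1 - r / (1 + r) = r / (1 + r) * r^-1.
  by field; rewrite !lt0r_neq0 // addr_gt0.
set s := r / (1 + r); rewrite scalerBr scalerA scalerBr opprB addrA subrK.
rewrite -scalerDl (_ : s + s / r = 1) ?scale1r //.
by rewrite /s; field; rewrite !lt0r_neq0 // addr_gt0.
Qed.

Lemma rV2P (R : realType) (u v : 'rV[R]_2) : u 0 0 = v 0 0 -> u 0 1 = v 0 1 -> u = v.
Proof.
move=> e0 e1; apply/rowP => -[[|[|//]] i2].
  by rewrite (_ : Ordinal i2 = 0) //; exact: val_inj.
by rewrite (_ : Ordinal i2 = 1) //; exact: val_inj.
Qed.

Lemma vec2_0 (R : realType) (x y : R) : vec2 x y 0 0 = x.
Proof. by rewrite mxE. Qed.

Lemma vec2_1 (R : realType) (x y : R) : vec2 x y 0 1 = y.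
Proof. by rewrite mxE. Qed.

Lemma collinear_vec2 (R : realType) (u d : 'rV[R]_2) :
  d != 0 -> cross (u 0 0) (u 0 1) (d 0 0) (d 0 1) = 0 -> exists k, u = k *: d.
Proof.
move=> d0 cr; have n0 : d 0 0 ^+ 2 + d 0 1 ^+ 2 != 0.
  rewrite paddr_eq0 ?sqr_ge0 // !sqrf_eq0; apply: contra d0 => /andP[/eqP e0 /eqP e1].
  by apply/eqP/rV2P; rewrite !mxE.
exists ((u 0 0 * d 0 0 + u 0 1 * d 0 1) / (d 0 0 ^+ 2 + d 0 1 ^+ 2)).
apply: rV2P; rewrite mxE; apply: (mulIf n0); rewrite mulrAC divfK //.
  transitivity ((u 0 0 * d 0 0 + u 0 1 * d 0 1) * d 0 0
    + d 0 1 * cross (u 0 0) (u 0 1) (d 0 0) (d 0 1)); first by rewrite /cross; ring.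
  by rewrite cr mulr0 addr0.
transitivity ((u 0 0 * d 0 0 + u 0 1 * d 0 1) * d 0 1
    - d 0 0 * cross (u 0 0) (u 0 1) (d 0 0) (d 0 1)); first by rewrite /cross; ring.
by rewrite cr mulr0 subr0.
Qed.

(** An interior point [p] of the convex set is taken as origin. That no tangent meets the interior
    yields both the nonvanishing and the turning condition of [weak_curve_or_reverse]. *)
Lemma convex_curve_inscribed (R : realType) (g : set 'rV[R]_2) (t1 t2 t3 t4 : R) :
  closed_convex_curve g -> C1_closed_curve g ->
  [/\ t1 < t2, t2 < t3, t3 < t4 & t4 < t1 + 2 * pi] ->
  exists zx zy bx by_ : R, 0 < zx ^+ 2 + zy ^+ 2 /\
    forall t, t \in [:: t1; t2; t3; t4] ->
      g (vec2 (bx + zx * cos t - zy * sin t) (by_ + zx * sin t + zy * cos t)).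
Proof.
move=> [K [cptK cK [p Kp] gE]] [L [c [[L0 pc] inj [dc cc'] c'0 gc]]] tt.
have clK : closed K by apply: compact_closed cptK; exact: norm_hausdorff.
have gc' s : g (c s) by rewrite gc; exists s.
have Kc s : K (c s).
  by have := gc' s; rewrite gE => -[]; rewrite -(closure_id K).1.
have nK s : ~ interior K (c s) by have := gc' s; rewrite gE => -[].
have isd (s : R) : is_derive s 1 c (derive1 c s).
  by rewrite derive1E; exact: derivableP.
have off s q : interior K q ->
    cross (q 0 0 - c s 0 0) (q 0 1 - c s 0 1) (derive1 c s 0 0) (derive1 c s 0 1) != 0.
  move=> Kq; apply/eqP => cr.
  have [k E] : exists k, q - c s = k *: derive1 c s.
    by apply: collinear_vec2 => //; rewrite !mxE.
  apply: (interior_off_tangent (k := k) cK Kc (nK s) (isd s)).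
  by rewrite -E addrC subrK.
pose X s := c s 0 0 - p 0 0; pose Y s := c s 0 1 - p 0 1.
pose X' s := derive1 c s 0 0; pose Y' s := derive1 c s 0 1.
have dcoord i (s : R) : is_derive s 1 (fun s => c s 0 i) (derive1 c s 0 i).
  have dci := (derivable_mxP c s 1).1 (dc s) 0 i.
  by apply: DeriveDef => //; rewrite derive1E derive_mx // mxE.
have dX (s : R) : is_derive s 1 X (X' s).
  by rewrite -[X' s]subr0; exact: (is_derive_sub (dcoord _ s) (is_derive_const _ _)).
have dY (s : R) : is_derive s 1 Y (Y' s).
  by rewrite -[Y' s]subr0; exact: (is_derive_sub (dcoord _ s) (is_derive_const _ _)).
have ccoord i : continuous (fun s => derive1 c s 0 i).
  exact: (continuous_composite (@coord_continuous _ _ _ 0 i) cc').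
have wc : weak_curve X Y X' Y' L \/ weak_curve (fun t => X (- t)) (fun t => Y (- t))
    (fun t => - X' (- t)) (fun t => - Y' (- t)) L.
  apply: weak_curve_or_reverse => //.
  - exact: ccoord.
  - exact: ccoord.
  - by move=> s; rewrite /X pc.
  - by move=> s; rewrite /Y pc.
  - move=> t s ts; have := periodic_injective L0 pc inj ts.
    rewrite /X /Y !(inj_eq (subIr _)) => ne; apply/orP; rewrite -negb_and.
    by apply/negP => /andP[/eqP e0 /eqP e1]; apply: ne; exact: rV2P.
  - move=> s; have := off s p Kp; rewrite -oppr_eq0; congr (_ != 0).
    by rewrite /cross /X /Y /X' /Y'; ring.
  move=> t s; rewrite leNgt; apply/negP.
  set w := cross (X t) (Y t) (X' t) (Y' t).
  set v := cross (X' t) (Y' t) (X s - X t) (Y s - Y t) => wv.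
  (* If [p] and [c s] were strictly on opposite sides of the tangent at [c t], the segment between
     them would meet it at weight [r] on [p], and that point is interior. *)
  pose r := v / (v - w).
  have wv0 : v - w != 0.
    by apply/eqP => /subr0_eq E; move: wv; rewrite E -expr2 ltNge sqr_ge0.
  have r01 : 0 < r <= 1.
    have [v0|v0] := ltP 0 v.
      have w0 : w < 0 by move: wv; rewrite pmulr_llt0.
      have d0 : 0 < v - w by lra.
      by rewrite /r divr_gt0 //= ler_pdivrMr // mul1r; lra.
    have v1 : v < 0.
      by rewrite lt_neqAle v0 andbT; apply/eqP => E; move: wv; rewrite E mulr0 ltxx.
    have w0 : 0 < w by move: wv; rewrite nmulr_llt0.
    have d0 : 0 < w - v by lra.
    have -> : r = - v / (w - v) by rewrite /r -(opprB w v) invrN mulrN mulNr.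
    by rewrite divr_gt0 ?oppr_gt0 //= ler_pdivrMr // mul1r; lra.
  have := off t _ (interior_convex_comb cK Kp (Kc s) r01).
  rewrite !mxE => /eqP; apply.
  transitivity (- (r * w) - (1 - r) * v).
    by rewrite /w /v /cross /X /Y /X' /Y'; ring.
  by rewrite /r; field.
have [zx [zy [bx [by_ [z0 pts]]]]] : exists zx zy bx by_ : R, 0 < zx ^+ 2 + zy ^+ 2 /\
    forall t, t \in [:: t1; t2; t3; t4] -> exists a, similar_at X Y zx zy bx by_ t a.
  have main u v u' v' : weak_curve u v u' v' L ->
      (forall a, exists b, u a = X b /\ v a = Y b) ->
      exists zx zy bx by_ : R, 0 < zx ^+ 2 + zy ^+ 2 /\
      forall t, t \in [:: t1; t2; t3; t4] -> exists a, similar_at X Y zx zy bx by_ t a.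
    move=> w uv; have [zx [zy [bx [by_ [a [b [d [e [z0 [s1 s2] [s3 s4]]]]]]]]]] :=
      weak_inscribed w tt.
    have use t a1 : similar_at u v zx zy bx by_ t a1 ->
        exists a, similar_at X Y zx zy bx by_ t a.
      by move=> [e1 e2]; have [b1 [E1 E2]] := uv a1; exists b1; rewrite /similar_at -E1 -E2.
    exists zx, zy, bx, by_; split => // t; rewrite !inE.
    by move=> /or4P[] /eqP ->; [exact: (use _ a)|exact: (use _ b)|exact: (use _ d)
      |exact: (use _ e)].
  by case: wc => w; [apply: (main _ _ _ _ w) => a; exists a
    |apply: (main _ _ _ _ w) => a; exists (- a)].
exists zx, zy, (bx + p 0 0), (by_ + p 0 1); split => // t /pts[a [EX EY]].
rewrite gc; exists a => //; apply: rV2P.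
  by rewrite vec2_0 -[LHS](subrK (p 0 0)) -/(X a) EX; ring.
by rewrite vec2_1 -[LHS](subrK (p 0 1)) -/(Y a) EY; ring.
Qed.

(** * From complex coefficients to direct similarities *)

Lemma unit_angle (R : realType) (u v : R) : u ^+ 2 + v ^+ 2 = 1 ->
  exists t, cos t = u /\ sin t = v.
Proof.
move=> uv; have u1 : -1 <= u <= 1.
  by have v0 := sqr_ge0 v; apply/andP; split; nra.
have ca : cos (acos u) = u by rewrite acosK // in_itv.
have sa : sin (acos u) = `|v| by rewrite sin_acos // -uv addrC addKr sqrtr_sqr.
have [v0|v0] := leP 0 v; first by exists (acos u); rewrite sa ger0_norm.
by exists (- acos u); rewrite cosN sinN sa ltr0_norm // opprK.
Qed.

Lemma counterclockwise_inscribed (R : realType) (g : set 'rV[R]_2) (q : 'I_4 -> 'rV[R]_2)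
    (o : 'rV[R]_2) (r : R) :
  closed_convex_curve g -> C1_closed_curve g -> 0 < r ->
  counterclockwise_on_circle o r q ->
  exists phi, direct_similarity phi /\ forall i, g (phi (q i)).
Proof.
move=> gc g1 r0 [t [mono turn qE]].
pose i0 : 'I_4 := ord0; pose i1 : 'I_4 := @Ordinal 4 1 isT.
pose i2 : 'I_4 := @Ordinal 4 2 isT; pose i3 : 'I_4 := ord_max.
have tt : [/\ t i0 < t i1, t i1 < t i2, t i2 < t i3 & t i3 < t i0 + 2 * pi].
  by split => //; exact: mono.
have [zx [zy [bx [by_ [z0 pts]]]]] := convex_curve_inscribed gc g1 tt.
have mem i : t i \in [:: t i0; t i1; t i2; t i3].
  rewrite !inE; case: i => -[|[|[|[|//]]]] hi.
  - by rewrite (_ : Ordinal hi = i0) ?eqxx //; exact: val_inj.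
  - by rewrite (_ : Ordinal hi = i1) ?eqxx ?orbT //; exact: val_inj.
  - by rewrite (_ : Ordinal hi = i2) ?eqxx ?orbT //; exact: val_inj.
  - by rewrite (_ : Ordinal hi = i3) ?eqxx ?orbT //; exact: val_inj.
pose n := Num.sqrt (zx ^+ 2 + zy ^+ 2).
have n0 : 0 < n by rewrite sqrtr_gt0.
have n2 : n ^+ 2 = zx ^+ 2 + zy ^+ 2 by rewrite sqr_sqrtr // ltW.
have [th [cth sth]] : exists t, cos t = zx / n /\ sin t = zy / n.
  by apply: unit_angle; rewrite !expr_div_n -mulrDl -n2 divff // expf_neq0 // lt0r_neq0.
(* The copy was found for points of the unit circle about the origin, so the scale is divided by
   [r], and the image [w] of the centre is taken off the translation. *)
pose l := n / r; pose w := rotation th (scaling l o).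
exists (translation (vec2 bx by_ - w) \o rotation th \o scaling l); split.
  by exists l, th, (vec2 bx by_ - w); split => //; rewrite divr_gt0.
move=> i; have := pts _ (mem i); congr (g _).
have nn := lt0r_neq0 n0; have rr := lt0r_neq0 r0.
rewrite qE /w /translation /rotation /scaling /circle_point /= cth sth /l.
by apply: rV2P; rewrite !mxE /=; field; rewrite nn rr.
Qed.

Theorem theorem1 (R : realType) (g : set 'rV[R]_2) (q : 'I_4 -> 'rV[R]_2)
    (g_convex : closed_convex_curve g) (g_C1 : C1_closed_curve g)
    (q_cyclic : cyclic_quadrilateral q) :
  exists phi : 'rV[R]_2 -> 'rV[R]_2,
    direct_similarity phi /\ forall i : 'I_4, g (phi (q i)).
Proof.
have [ o [r [r0 [ccw|cw]]]] := q_cyclic.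
  exact: counterclockwise_inscribed ccw.
(* The conclusion concerns all vertices alike, so a similarity for the reversed listing serves
   without any reflection. *)
have [phi [phiS phiq]] := counterclockwise_inscribed g_convex g_C1 r0 cw.
exists phi; split => // i; have := phiq (rev_ord i).
by rewrite rev_ordK.
Qed.
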